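(* Let $t\in\mathbb{R}\cup\{\infty\}$, let $\mu_t$ be the corresponding N-extremal measure of an indeterminate Hamburger moment problem, let $T_t$ be the corresponding self-adjoint extension of the Jacobi operator, and let $\lambda\in\mathbb{C}\setminus\operatorname{supp}(\mu_t)$. Then $$w_{\mu_t}(\lambda)\,\mathfrak{p}_\lambda+\mathfrak{q}_\lambda\in D(T_t),$$ where $$w_{\mu_t}(\lambda):=\int\frac{1}{x-\lambda}\,d\mu_t(x)=-\frac{C(\lambda,x)}{D(\lambda,x)},\qquad x\in\operatorname{supp}(\mu_t).$$ In particular, the ratio $C(\lambda,x)/D(\lambda,x)$ does not depend on $x\in\operatorname{supp}(\mu_t)$.
   Context: Setting: $s=(s_n)_{n\ge0}$, $s_0=1$, is an indeterminate Hamburger moment sequence, i.e. $s_n=\int x^n\,d\mu(x)$ for all $n\ge 0$ for more than one positive measure $\mu$ on $\mathbb{R}$ (with infinite support); $V$ is the set of all such $\mu$ (probability measures). $(p_n)_{n\ge0}$ are the orthonormal polynomials ($\deg p_n=n$, positive leading coefficient, $p_0=1$, $\int p_np_m\,d\mu=\delta_{n,m}$), satisfying $xp_n=a_np_{n+1}+b_np_n+a_{n-1}p_{n-1}$, $a_n>0$, $b_n\in\mathbb{R}$, $a_{-1}:=0$. The polynomials of the second kind are $q_n(z)=\int\frac{p_n(z)-p_n(x)}{z-x}\,d\mu(x)$, $\mu\in V$ arbitrary. It is known that $\mathfrak{p}_z:=(p_n(z))_{n\ge0}$ and $\mathfrak{q}_z:=(q_n(z))_{n\ge0}$ belong to $\ell^2$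 for every $z\in\mathbb{C}$. Jacobi operator: $J$ is the tridiagonal matrix acting by $(Jc)_n=a_{n-1}c_{n-1}+b_nc_n+a_nc_{n+1}$, $n\ge0$, and $\mathcal F\subset\ell^2$ is the space of complex sequences with finitely many non-zero terms. The Jacobi operator $(T,D(T))$ is the closure in the complex Hilbert space $\ell^2$ of $(J,\mathcal F)$. It is symmetric with deficiency indices $(1,1)$; its adjoint $T^*$ has domain $D(T^* )=\{c\in\ell^2: Jc\in\ell^2\}$ and $T^*c=Jc$. Self-adjoint extensions and N-extremal measures: for $t\in\mathbb{R}^*:=\mathbb{R}\cup\{\infty\}$, $T_t$ is the restriction of $T^*$ to $D(T_t)=D(T)\oplus\mathbb{C}(\mathfrak{q}_0+t\mathfrak{p}_0)$ for $t\in\mathbb{R}$, and $D(T_\infty)=D(T)\oplus\mathbb{C}\mathfrak{p}_0$; these are the self-adjoint extensions of $T$ in $\ell^2$. With $E_t$ the spectral measure of $T_t$ and $e_0=(1,0,0,\dots)$, the N-extremal measure is $\mu_t(\cdot):=\langle E_t(\cdot)e_0,e_0\rangle\in V$. It is known that $\mu_t$ is discrete. Nevanlinna functions (entire on $\mathbb{C}^2$): $C(u,v)=1+(u-v)\sum_{k=0}^\infty q_k(u)p_k(v)$, $D(u,v)=(u-v)\sum_{k=0}^\infty p_k(u)p_k(v)$. *)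

(* Defs.v *)
From HB Require Import structures.
From mathcomp Require Import all_boot all_order all_algebra.
From mathcomp Require Import all_classical all_reals all_analysis.
From mathcomp Require Export complex.

Set Implicit Arguments.
Unset Strict Implicit.
Unset Printing Implicit Defensive.

Import Order.TTheory GRing.Theory Num.Theory.
Import numFieldNormedType.Exports.

Local Open Scope classical_set_scope.
Local Open Scope ring_scope.
Local Open Scope complex_scope.

Notation borel_measure R := {measure set (measurableTypeR R) -> \bar R}.
Notation cseq R := (nat -> R[i]).

Section measures.
Context {R : realType}.

(* The closed (topological) support. *)
Definition supp (mu : borel_measure R) : set R :=
  [set x | forall U : set R, open U -> U x -> (0 < mu U)%E].

Definition cintegral (mu : borel_measure R) (f : R -> R[i]) : R[i] :=
  Rintegral mu setT (fun x => complex.Re (f x))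
    +i* Rintegral mu setT (fun x => complex.Im (f x)).

Definition moment_solutions (s : nat -> R) : set (borel_measure R) :=
  [set mu | infinite_set (supp mu) /\
    forall n, mu.-integrable setT (fun x => (x ^+ n)%:E) /\
      (\int[mu]_x (x ^+ n)%:E = (s n)%:E)%E].

Definition indeterminate (s : nat -> R) : Prop :=
  exists mu nu, [/\ moment_solutions s mu, moment_solutions s nu &
    exists2 B : set (measurableTypeR R), measurable B & mu B <> nu B].

Definition orthonormal_polynomials (mu : borel_measure R)
    (p : nat -> {poly R}) : Prop :=
  [/\ forall n, size (p n) = n.+1,
      forall n, 0 < lead_coef (p n),
      p 0%N = 1 &
      forall n m, (\int[mu]_x ((p n).[x] * (p m).[x])%:E = (n == m)%:R%:E)%E].

Definition jacobi_parameters (p : nat -> {poly R}) (a b : nat -> R) : Prop :=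
  (forall n, 0 < a n) /\
  forall n, 'X * p n = a n *: p n.+1 + b n *: p n
                       + (if n is m.+1 then a m *: p m else 0).

Definition cpoly (f : {poly R}) (z : R[i]) : R[i] :=
  (map_poly (real_complex R) f).[z].

Definition first_kind (p : nat -> {poly R}) (z : R[i]) : cseq R :=
  fun n => cpoly (p n) z.

(* The difference quotient (p_n(z) - p_n(x)) / (z - x) is taken as a polynomial
   in z, so that it is also defined when z = x. *)
Definition second_kind (mu : borel_measure R) (p : nat -> {poly R})
    (z : R[i]) : cseq R :=
  fun n => cintegral mu
    (fun x => cpoly ((p n - (p n).[x]%:P) %/ ('X - x%:P)) z).

End measures.

Section l2.
Context {R : realType}.
Implicit Types c d : cseq R.

Definition csum c : R[i] :=
  limn (series (fun n => complex.Re (c n)))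
    +i* limn (series (fun n => complex.Im (c n))).

Definition l2 : set (cseq R) :=
  [set c | cvgn (series (fun n => ComplexField.Normc.normc (c n) ^+ 2))].

Definition l2norm c : R :=
  Num.sqrt (limn (series (fun n => ComplexField.Normc.normc (c n) ^+ 2))).

Definition l2dot c d : R[i] := csum (fun n => c n * conjc (d n)).

Definition finitely_supported : set (cseq R) :=
  [set c | exists N, forall n, (N <= n)%N -> c n = 0].

Definition e0 : cseq R := fun n => (n == 0%N)%:R.

(* A partially defined operator in l2; [act] is only relevant on [dom]. *)
Record operator := Operator { dom : set (cseq R); act : cseq R -> cseq R }.

Definition restriction (A : operator) (D : set (cseq R)) : operator :=
  Operator D (act A).

(* (c, d) is in the closure of the graph of A. *)
Definition graph_closure (A : operator) c d : Prop :=
  [/\ l2 c, l2 d & forall eps : R, 0 < eps -> exists2 f, dom A f &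
    l2norm (f - c) < eps /\ l2norm (act A f - d) < eps].

Definition jacobi_matrix (a b : nat -> R) c : cseq R :=
  fun n => (if n is m.+1 then (a m)%:C * c m else 0)
           + (b n)%:C * c n + (a n)%:C * c n.+1.

Definition jacobi_domain (a b : nat -> R) : set (cseq R) :=
  [set c | exists d,
    graph_closure (Operator finitely_supported (jacobi_matrix a b)) c d].

Definition jacobi_adjoint (a b : nat -> R) : operator :=
  Operator [set c | l2 c /\ l2 (jacobi_matrix a b c)] (jacobi_matrix a b).

(* [None] encodes t = oo. *)
Definition extension_domain (mu : borel_measure R) (p : nat -> {poly R})
    (a b : nat -> R) (t : option R) : set (cseq R) :=
  let v : cseq R := if t is Some t' then
      fun n => second_kind mu p 0 n + t'%:C * first_kind p 0 n
    else first_kind p 0 in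
  [set c | exists2 u, jacobi_domain a b u &
    exists alpha : R[i], c = fun n => u n + alpha * v n].

Definition extension (mu : borel_measure R) (p : nat -> {poly R})
    (a b : nat -> R) (t : option R) : operator :=
  restriction (jacobi_adjoint a b) (extension_domain mu p a b t).

Definition pv_fun := set (measurableTypeR R) -> cseq R -> cseq R.

(* nu is the measure B |-> <E(B) c, c>. *)
Definition scalar_measure (E : pv_fun) c (nu : borel_measure R) : Prop :=
  forall B, measurable B -> ((complex.Re (l2dot (E B c) c))%:E = nu B)%E.

Definition orthogonal_projection (P : cseq R -> cseq R) : Prop :=
  [/\ forall c, l2 c -> l2 (P c),
      forall (alpha : R[i]) c d, l2 c -> l2 d ->
        P (fun n => alpha * c n + d n) = fun n => alpha * P c n + P d n,
      forall c d, l2 c -> l2 d -> l2dot (P c) d = l2dot c (P d) &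
      forall c, l2 c -> P (P c) = P c].

(* For projections, countable additivity in the strong topology amounts to
   countable additivity of all the set functions B |-> <E(B) c, c>. *)
Definition projection_valued_measure (E : pv_fun) : Prop :=
  [/\ forall B, measurable B -> orthogonal_projection (E B),
      forall c, l2 c -> E setT c = c &
      forall c, l2 c -> exists nu, scalar_measure E c nu].

(* A = \int x dE(x): the domain of A consists of the c such that x is square
   integrable for <E(.) c, c>, and <A c, c> = \int x d<E(x) c, c> there; by
   polarization this determines A c. *)
Definition spectral_measure (A : operator) (E : pv_fun) : Prop :=
  projection_valued_measure E /\
  forall c nu, l2 c -> scalar_measure E c nu ->
    (dom A c <-> (\int[nu]_x (x ^+ 2)%:E < +oo)%E) /\
    (dom A c -> l2dot (act A c) c = (Rintegral nu setT (fun x => x))%:C).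

End l2.

Section nevanlinna.
Context {R : realType}.
Variables (mu : borel_measure R) (p : nat -> {poly R}).

Definition nevanlinna_C (u v : R[i]) : R[i] :=
  1 + (u - v) * csum (fun k => second_kind mu p u k * first_kind p v k).

Definition nevanlinna_D (u v : R[i]) : R[i] :=
  (u - v) * csum (fun k => first_kind p u k * first_kind p v k).

End nevanlinna.

(* The Stieltjes transform of mu, with 1 / (x - z). *)
Definition stieltjes {R : realType} (mu : borel_measure R) (z : R[i]) : R[i] :=
  cintegral mu (fun x => (x%:C - z)^-1).

(* Main.v *)
Require Import Defs.
From mathcomp Require Import all_boot all_order all_algebra.
From mathcomp Require Import all_classical all_reals all_analysis.
From mathcomp Require Import separable measurable_realfun ring lra.
Import Order.TTheory GRing.Theory Num.Theory.
Import numFieldNormedType.Exports.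
Local Open Scope classical_set_scope.
Local Open Scope ring_scope.
Local Open Scope complex_scope.

Local Notation Re := complex.Re.
Local Notation Im := complex.Im.

(** Let [J] be the Jacobi matrix, [P z] and [Q z] the sequences of orthogonal
    polynomials of the first and second kind at [z].  They satisfy
    [J (P z) = z P z] and [J (Q z) = z Q z + e0], and, since [J] is a three-term
    recurrence, every solution of [J c = z c + e0] is [c 0 *: P z + Q z].

    The vector [w P la + Q la] is therefore the only candidate for
    [(T_t - la)^-1 e0]: the resolvent vector solves [J c = la c + e0], and its
    zeroth coordinate is [<(T_t - la)^-1 e0, e0>], the Stieltjes transform [w] of
    [mu_t] at [la].  The spectral measure [E] enters only through the measures
    [<E(.)c, c>], so this argument is carried out on step functions:
    on the range of [E(B)], for a short interval [B], the operator is close to a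
    scalar ([local_scalar_estimate], [step_function_estimate]); hence the step
    vector [sum_j f(x_j) E(B_j) e0] built from [f(x) = 1 / (x - la)] almost solves
    the equation, and variation of constants ([nsq_variation]) moves it, with a
    small error in [l2], to an exact solution, whose zeroth coordinate is a
    Riemann sum for [w] ([resolvent_approximation]).  The decay of [f] at infinity
    passes to the limit and gives membership in the domain ([resolvent_dom]).

    If [x] is in the support of [mu_t], the same two estimates applied to
    [E(x - de, x + de) e0] show that [P x] is in the domain of [T_t]
    ([support_eigenvector]).  As [T_t] is symmetric, the boundary form of
    [w P la + Q la] and [P x] vanishes.  By the Green formula the boundary forms
    of [P la] and [Q la] with [P x] are [D(la, x)] and [C(la, x)], so
    [w D(la, x) + C(la, x) = 0].  Finally [D(la, x)] is nonzero: otherwise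
    [C(la, x)] vanishes too, against the Pluecker relation between the Wronskians
    of the fundamental systems at [la] and [x] ([wronskian_pluecker]).

    All this needs [P z] and [Q z] to be in [l2] for every [z].  For a solution
    [nu] of the moment problem and a nonreal [z], the sequence
    [w_nu(z) P z + Q z] consists of the Fourier coefficients of [1 / (x - z)], and
    is in [l2] by the Bessel inequality ([l2_weyl_solution]).  Two solutions whose
    Stieltjes transforms differ at [z] thus put [P z] and [Q z] in [l2]; such a
    [z] exists because a finite measure is determined by its Stieltjes transform
    ([stieltjes_inj]).  From one point the property spreads to all of them
    ([limit_circle_invariance]). *)

(** * Squared moduli *)

Section modulus.
Context {R : realType}.
Implicit Types z w : R[i].

(** All estimates are made on squared moduli and squared norms.  This avoids
    square roots; the price is the factor 2 in [sqmodD_le]. *)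
Definition sqmod z : R := Re z ^+ 2 + Im z ^+ 2.
Definition redot z w : R := Re z * Re w + Im z * Im w.

Lemma Re_add z w : Re (z + w) = Re z + Re w. Proof. by case: z; case: w. Qed.
Lemma Im_add z w : Im (z + w) = Im z + Im w. Proof. by case: z; case: w. Qed.
Lemma Re_opp z : Re (- z) = - Re z. Proof. by case: z. Qed.
Lemma Im_opp z : Im (- z) = - Im z. Proof. by case: z. Qed.
Lemma Re_mul z w : Re (z * w) = Re z * Re w - Im z * Im w.
Proof. by case: z; case: w. Qed.
Lemma Im_mul z w : Im (z * w) = Re z * Im w + Im z * Re w.
Proof. by case: z; case: w. Qed.
Lemma Re_sum I (r : seq I) (Q : pred I) (F : I -> R[i]) :
  Re (\sum_(i <- r | Q i) F i) = \sum_(i <- r | Q i) Re (F i).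
Proof. by apply: (big_morph (@Re R)) => // x y; rewrite Re_add. Qed.
Lemma Im_sum I (r : seq I) (Q : pred I) (F : I -> R[i]) :
  Im (\sum_(i <- r | Q i) F i) = \sum_(i <- r | Q i) Im (F i).
Proof. by apply: (big_morph (@Im R)) => // x y; rewrite Im_add. Qed.
Lemma Re_real (x : R) : Re x%:C = x. Proof. by []. Qed.
Lemma Im_real (x : R) : Im x%:C = 0. Proof. by []. Qed.
Definition ii : R[i] := 0 +i* 1.
Lemma Re_ii : Re ii = 0. Proof. by []. Qed.
Lemma Im_ii : Im ii = 1. Proof. by []. Qed.
Lemma Re_conjc z : Re (conjc z) = Re z. Proof. by case: z. Qed.
Lemma Im_conjc z : Im (conjc z) = - Im z. Proof. by case: z. Qed.

Definition ReImE := (Re_add, Im_add, Re_opp, Im_opp, Re_mul, Im_mul, Re_real, Im_real, Re_conjc, Im_conjc,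
  Re_ii, Im_ii).

Lemma complex_eq z w : Re z = Re w -> Im z = Im w -> z = w.
Proof. by case: z => a b; case: w => c d /= -> ->. Qed.

Lemma sqmod_normc z : ComplexField.Normc.normc z ^+ 2 = sqmod z.
Proof. by case: z => a b; rewrite /= sqr_sqrtr// addr_ge0// sqr_ge0. Qed.

Lemma sqmod_ge0 z : 0 <= sqmod z.
Proof. by rewrite addr_ge0// sqr_ge0. Qed.

Lemma sqmod0 : sqmod 0 = 0 :> R.
Proof. by rewrite /sqmod !expr0n addr0. Qed.

Lemma sqmod_eq0 z : (sqmod z == 0) = (z == 0).
Proof.
by rewrite paddr_eq0 ?sqr_ge0// !sqrf_eq0; case: z => a b; rewrite eq_complex.
Qed.

Lemma sqmodM z w : sqmod (z * w) = sqmod z * sqmod w.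
Proof. by rewrite /sqmod !ReImE; ring. Qed.

Lemma sqmodN z : sqmod (- z) = sqmod z.
Proof. by rewrite /sqmod !ReImE; ring. Qed.

Lemma sqmodC (x : R) : sqmod x%:C = x ^+ 2.
Proof. by rewrite /sqmod expr0n addr0. Qed.

Lemma sqmodD_le z w : sqmod (z + w) <= 2 * sqmod z + 2 * sqmod w.
Proof.
rewrite /sqmod !ReImE -subr_ge0.
suff -> : 2 * (Re z ^+ 2 + Im z ^+ 2) + 2 * (Re w ^+ 2 + Im w ^+ 2) -
  ((Re z + Re w) ^+ 2 + (Im z + Im w) ^+ 2) =
  (Re z - Re w) ^+ 2 + (Im z - Im w) ^+ 2 by rewrite addr_ge0// sqr_ge0.
by ring.
Qed.

Lemma sqmodV z : sqmod z^-1 = (sqmod z)^-1.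
Proof.
have [->|z0] := eqVneq z 0; first by rewrite invr0 sqmod0 invr0.
have sz0 : sqmod z != 0 by rewrite sqmod_eq0.
apply: (mulIf sz0); rewrite -sqmodM mulVf// mulVf//.
by rewrite /sqmod expr1n expr0n addr0.
Qed.

Lemma redotzz z : redot z z = sqmod z. Proof. by rewrite /redot -!expr2. Qed.

Lemma redot_le z w : `|redot z w| <= (sqmod z + sqmod w) / 2.
Proof.
rewrite ler_norml; apply/andP; split; rewrite -subr_ge0.
  suff -> : redot z w - - ((sqmod z + sqmod w) / 2) =
    ((Re z + Re w) ^+ 2 + (Im z + Im w) ^+ 2) / 2.
    by rewrite divr_ge0// addr_ge0// sqr_ge0.
  by rewrite /redot /sqmod; field.
suff -> : (sqmod z + sqmod w) / 2 - redot z w =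
    ((Re z - Re w) ^+ 2 + (Im z - Im w) ^+ 2) / 2.
  by rewrite divr_ge0// addr_ge0// sqr_ge0.
by rewrite /redot /sqmod; field.
Qed.

(** The Cauchy-Schwarz inequality. *)
Lemma sqmod_sum_le (n : nat) (u v : nat -> R[i]) :
  sqmod (\sum_(k < n) u k * v k) <=
  (\sum_(k < n) sqmod (u k)) * (\sum_(k < n) sqmod (v k)).
Proof.
elim: n => [|n IH]; first by rewrite !big_ord0 sqmod0 mulr0.
rewrite !big_ord_recr /=.
set S := \sum_(i < n) _ in IH *.
set U := \sum_(i < n) _ in IH *; set V := \sum_(i < n) _ in IH *.
have U0 : 0 <= U by apply: sumr_ge0 => i _; apply: sqmod_ge0.
have V0 : 0 <= V by apply: sumr_ge0 => i _; apply: sqmod_ge0.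
have -> : sqmod (S + u n * v n) =
  sqmod S + 2 * redot S (u n * v n) + sqmod (u n) * sqmod (v n).
  by rewrite -sqmodM /sqmod /redot !ReImE; ring.
have -> : (U + sqmod (u n)) * (V + sqmod (v n)) =
  U * V + (U * sqmod (v n) + V * sqmod (u n)) + sqmod (u n) * sqmod (v n).
  by ring.
rewrite lerD2r lerD//.
set x := U * sqmod (v n); set y := V * sqmod (u n).
have x0 : 0 <= x by rewrite mulr_ge0 ?sqmod_ge0.
have y0 : 0 <= y by rewrite mulr_ge0 ?sqmod_ge0.
apply: (@le_trans _ _ `|2 * redot S (u n * v n)|); first exact: ler_norm.
rewrite -(ler_pXn2r (n := 2)) ?nnegrE ?addr_ge0// real_normK ?num_real//.
apply: (@le_trans _ _ (4 * (x * y))); last first.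
  by rewrite -subr_ge0 (_ : _ - _ = (x - y) ^+ 2) ?sqr_ge0//; ring.
have -> : (2 * redot S (u n * v n)) ^+ 2 = 4 * redot S (u n * v n) ^+ 2 by ring.
rewrite ler_pM2l//.
apply: (@le_trans _ _ (sqmod S * sqmod (u n * v n))).
  rewrite -subr_ge0 (_ : _ - _ =
    (Re S * Im (u n * v n) - Im S * Re (u n * v n)) ^+ 2) ?sqr_ge0//.
  by rewrite /sqmod /redot; ring.
rewrite sqmodM (_ : x * y = (U * V) * (sqmod (u n) * sqmod (v n))); last first.
  by rewrite /x /y; ring.
by rewrite ler_wpM2r// mulr_ge0 ?sqmod_ge0.
Qed.

End modulus.

(** * The Hilbert space l2 *)

Section l2_theory.
Context {R : realType}.
Implicit Types c d : cseq R.

(** The real part of the inner product: [l2] is treated as a real Hilbert space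
    on which multiplication by [ii] is an isometry, and [l2dotE] recovers the
    complex inner product. *)
Definition rdot c d : R := limn (series (fun n => redot (c n) (d n))).
Definition nsq c : R := rdot c c.

Lemma series_ord (u : nat -> R) : series u = (fun n => \sum_(k < n) u k).
Proof. by apply/funext => n; rewrite /series /= big_mkord. Qed.

Lemma cvg_series_ge0 (u : nat -> R) M : (forall n, 0 <= u n) ->
  (forall n, \sum_(k < n) u k <= M) -> cvgn (series u).
Proof.
move=> u0 uM; apply: nondecreasing_is_cvgn.
  exact: nondecreasing_series.
by exists M => _ [n _ <-]; rewrite series_ord; apply: uM.
Qed.

Lemma series_ge0_le_lim (u : nat -> R) n : (forall n, 0 <= u n) ->
  cvgn (series u) -> \sum_(k < n) u k <= limn (series u).
Proof.
move=> u0 cv; have nd : nondecreasing_seq (series u).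
  exact: nondecreasing_series.
by have := nondecreasing_cvgn_le nd cv n; rewrite {1}series_ord.
Qed.

Lemma l2P c : l2 c <-> exists M, forall n, \sum_(k < n) sqmod (c k) <= M.
Proof.
rewrite /l2 /=.
under eq_fun do rewrite sqmod_normc.
split=> [cv|[M cM]]; last first.
  by apply: cvg_series_ge0 cM => n; apply: sqmod_ge0.
exists (limn (series (fun n => sqmod (c n)))) => n.
by apply: series_ge0_le_lim => // k; apply: sqmod_ge0.
Qed.

Lemma cvg_rdot c d : l2 c -> l2 d ->
  (fun n => \sum_(k < n) redot (c k) (d k)) @ \oo --> rdot c d.
Proof.
move=> /l2P[M cM] /l2P[N dN]; rewrite /rdot -(series_ord (fun n => redot (c n) (d n))).
apply: normed_cvg.
apply: (@cvg_series_ge0 (fun n => `|redot (c n) (d n)|) ((M + N) / 2)) => [n|n]; first exact: normr_ge0.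
apply: (@le_trans _ _ (\sum_(k < n) (sqmod (c k) + sqmod (d k)) / 2)).
  by apply: ler_sum => i _; apply: redot_le.
by rewrite -mulr_suml big_split /= ler_pM2r// lerD// ?cM ?dN.
Qed.

Lemma rdot_eq c d l :
  (fun n => \sum_(k < n) redot (c k) (d k)) @ \oo --> l -> rdot c d = l.
Proof.
by rewrite /rdot -(series_ord (fun n => redot (c n) (d n))) => /cvg_lim ->.
Qed.

Lemma nsqE c : nsq c = limn (series (fun n => sqmod (c n))).
Proof. by congr (limn (series _)); apply/funext => n; apply: redotzz. Qed.

Lemma cvg_nsq c : l2 c -> (fun n => \sum_(k < n) sqmod (c k)) @ \oo --> nsq c.
Proof.
move=> cl; have := cvg_rdot _ _ cl cl.
by under [X in X @ _]eq_fun do under eq_bigr do rewrite redotzz.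
Qed.

Lemma sum_le_nsq c n : l2 c -> \sum_(k < n) sqmod (c k) <= nsq c.
Proof.
move=> cl; have cv := cvg_nsq _ cl; rewrite nsqE.
apply: (@series_ge0_le_lim (fun n => sqmod (c n))).
  by move=> k; apply: sqmod_ge0.
by apply/cvg_ex; exists (nsq c); rewrite series_ord.
Qed.

Lemma nsq_le c M : l2 c -> (forall n, \sum_(k < n) sqmod (c k) <= M) -> nsq c <= M.
Proof.
move=> cl cM; have cv := cvg_nsq _ cl.
rewrite -(cvg_lim _ cv)//; apply: limr_le; first by apply/cvg_ex; exists (nsq c).
by apply: nearW => n; apply: cM.
Qed.

Lemma nsq_ge0 c : l2 c -> 0 <= nsq c.
Proof. by move=> cl; have := sum_le_nsq _ 0 cl; rewrite big_ord0. Qed.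

Lemma sqmod_le_nsq c n : l2 c -> sqmod (c n) <= nsq c.
Proof.
move=> cl; apply: le_trans (sum_le_nsq _ n.+1 cl); rewrite big_ord_recr /=.
by rewrite lerDr sumr_ge0// => i _; apply: sqmod_ge0.
Qed.

Lemma nsq_eq0 c : l2 c -> nsq c <= 0 -> c = fun=> 0.
Proof.
move=> cl c0; apply/funext => n; apply/eqP; rewrite -sqmod_eq0.
by rewrite eq_le sqmod_ge0 andbT (le_trans _ c0)// sqmod_le_nsq.
Qed.

Lemma l2D c d : l2 c -> l2 d -> l2 (fun n => c n + d n).
Proof.
move=> /l2P[M cM] /l2P[N dN]; apply/l2P; exists (2 * M + 2 * N) => n.
apply: (@le_trans _ _ (\sum_(k < n) (2 * sqmod (c k) + 2 * sqmod (d k)))).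
  by apply: ler_sum => i _; apply: sqmodD_le.
by rewrite big_split /= -!mulr_sumr lerD// ler_pM2l ?cM ?dN.
Qed.

Lemma l2Z al c : l2 c -> l2 (fun n => al * c n).
Proof.
move=> /l2P[M cM]; apply/l2P; exists (sqmod al * M) => n.
under eq_bigr do rewrite sqmodM.
by rewrite -mulr_sumr ler_wpM2l ?cM// sqmod_ge0.
Qed.

Lemma l2_0 : l2 (fun=> 0 : R[i]).
Proof.
apply/l2P; exists 0 => n.
by rewrite big1// => i _; rewrite sqmod0.
Qed.

Lemma l2_sum (m : nat) (F : nat -> cseq R) :
  (forall j, (j < m)%N -> l2 (F j)) -> l2 (fun n => \sum_(j < m) F j n).
Proof.
elim: m => [_|m IH Fl].
  by under eq_fun do rewrite big_ord0; exact: l2_0.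
under eq_fun do rewrite big_ord_recr /=.
apply: l2D; last exact: Fl.
by apply: IH => j jm; apply: Fl; apply: ltnW.
Qed.

Lemma l2B c d : l2 c -> l2 d -> l2 (fun n => c n - d n).
Proof.
move=> cl /(l2Z (-1) _) dl; under eq_fun do rewrite -mulN1r.
exact: l2D.
Qed.

Lemma fin_l2 c : finitely_supported c -> l2 c.
Proof.
move=> [N cN]; apply/l2P; exists (\sum_(k < N) sqmod (c k)) => n.
apply: (@le_trans _ _ (\sum_(k < N + n) sqmod (c k))).
  rewrite addnC big_split_ord /= lerDl sumr_ge0// => i _; exact: sqmod_ge0.
rewrite big_split_ord /= [X in _ + X]big1 ?addr0// => i _.
by rewrite cN ?leq_addr// sqmod0.
Qed.

Lemma rdotC c d : rdot c d = rdot d c.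
Proof.
by congr (limn (series _)); apply/funext => n; rewrite /redot mulrC (mulrC (Im _)).
Qed.

Lemma rdotDl c c' d : l2 c -> l2 c' -> l2 d ->
  rdot (fun n => c n + c' n) d = rdot c d + rdot c' d.
Proof.
move=> cl c'l dl; apply: rdot_eq.
rewrite (_ : (fun n => _) = (fun n => \sum_(k < n) redot (c k) (d k) +
    \sum_(k < n) redot (c' k) (d k))).
  by apply: cvgD; apply: cvg_rdot.
apply/funext => n; rewrite -big_split /=.
by apply: eq_bigr => i _; rewrite /redot !ReImE; ring.
Qed.

Lemma rdotZl (r : R) c d : l2 c -> l2 d ->
  rdot (fun n => r%:C * c n) d = r * rdot c d.
Proof.
move=> cl dl; apply: rdot_eq.
rewrite (_ : (fun n => _) = (fun n => r * \sum_(k < n) redot (c k) (d k))).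
  by apply: cvgM; [exact: cvg_cst|exact: cvg_rdot].
apply/funext => n; rewrite mulr_sumr.
by apply: eq_bigr => i _; rewrite /redot !ReImE; ring.
Qed.

Lemma rdotDr c d d' : l2 c -> l2 d -> l2 d' ->
  rdot c (fun n => d n + d' n) = rdot c d + rdot c d'.
Proof. by move=> cl dl dl'; rewrite rdotC rdotDl// !(rdotC c). Qed.

Lemma rdotZr (r : R) c d : l2 c -> l2 d ->
  rdot c (fun n => r%:C * d n) = r * rdot c d.
Proof. by move=> cl dl; rewrite rdotC rdotZl// rdotC. Qed.

Lemma rdotBl c c' d : l2 c -> l2 c' -> l2 d ->
  rdot (fun n => c n - c' n) d = rdot c d - rdot c' d.
Proof.
move=> cl c'l dl.
rewrite (_ : (fun n => c n - c' n) = fun n => c n + (-1)%:C * c' n); last first.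
  by apply/funext => n; rewrite rmorphN1 mulN1r.
by rewrite rdotDl ?rdotZl ?mulN1r//; exact: l2Z.
Qed.

Lemma rdotBr c d d' : l2 c -> l2 d -> l2 d' ->
  rdot c (fun n => d n - d' n) = rdot c d - rdot c d'.
Proof. by move=> cl dl dl'; rewrite rdotC rdotBl// !(rdotC c). Qed.

Lemma rdot0l d : rdot (fun=> 0) d = 0.
Proof.
apply: rdot_eq; rewrite (_ : (fun n => _) = fun=> 0); first exact: cvg_cst.
by apply/funext => n; rewrite big1// => i _; rewrite /redot /= !mul0r addr0.
Qed.

Lemma rdot_suml (m : nat) (F : nat -> cseq R) d :
  (forall j, (j < m)%N -> l2 (F j)) -> l2 d ->
  rdot (fun n => \sum_(j < m) F j n) d = \sum_(j < m) rdot (F j) d.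
Proof.
move=> + dl; elim: m => [_|m IH Fl].
  by rewrite big_ord0 -[RHS](rdot0l d); congr rdot; apply/funext => n; rewrite big_ord0.
rewrite big_ord_recr /= -IH => [|j jm]; last by apply: Fl; apply: ltnW.
rewrite -rdotDl//; last 2 first.
- by apply: l2_sum => j jm; apply: Fl; apply: ltnW.
- exact: Fl.
by congr rdot; apply/funext => n; rewrite big_ord_recr.
Qed.

Lemma rdot_ii c d : rdot (fun n => ii * c n) (fun n => ii * d n) = rdot c d.
Proof.
congr (limn (series _)); apply/funext => n; rewrite /redot !ReImE; ring.
Qed.

Lemma nsqD_le c d : l2 c -> l2 d ->
  nsq (fun n => c n + d n) <= 2 * nsq c + 2 * nsq d.
Proof.
move=> cl dl; apply: nsq_le; first exact: l2D.
move=> n; apply: (@le_trans _ _ (\sum_(k < n) (2 * sqmod (c k) + 2 * sqmod (d k)))).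
  by apply: ler_sum => i _; apply: sqmodD_le.
by rewrite big_split /= -!mulr_sumr lerD// ler_pM2l ?sum_le_nsq.
Qed.

Lemma nsqZ al c : l2 c -> nsq (fun n => al * c n) = sqmod al * nsq c.
Proof.
move=> cl; apply: rdot_eq.
rewrite (_ : (fun n => _) = (fun n => sqmod al * \sum_(k < n) sqmod (c k))).
  by apply: cvgM; [exact: cvg_cst|exact: cvg_nsq].
apply/funext => n; rewrite mulr_sumr.
by apply: eq_bigr => i _; rewrite redotzz sqmodM.
Qed.

Lemma nsqN c : nsq (fun n => - c n) = nsq c.
Proof. by rewrite !nsqE; under eq_fun do rewrite sqmodN. Qed.

Lemma nsqB_le c d : l2 c -> l2 d ->
  nsq (fun n => c n - d n) <= 2 * nsq c + 2 * nsq d.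
Proof.
move=> cl dl; rewrite -(nsqN d); apply: nsqD_le => //.
by have := l2Z (-1) d dl; under eq_fun do rewrite mulN1r.
Qed.

Lemma l2dotE c d : l2dot c d = rdot c d +i* rdot c (fun n => ii * d n).
Proof.
rewrite /l2dot /csum /rdot; congr (_ +i* _); congr (limn (series _));
by apply/funext => n; rewrite /redot !ReImE; ring.
Qed.

End l2_theory.

(** * Jacobi recurrences and variation of constants *)

Section jacobi.
Context {R : realType}.
Variables (a b : nat -> R).
Hypothesis a_gt0 : forall n, 0 < a n.
Local Notation J := (jacobi_matrix a b).
Implicit Types (c d h P Q : cseq R) (z : R[i]).

Let aC_neq0 n : (a n)%:C != 0 :> R[i].
Proof. by rewrite eq_complex /= eqxx andbT gt_eqF. Qed.

Lemma jacobiD c d n : J (fun n => c n + d n) n = J c n + J d n.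
Proof. by case: n => [|n]; rewrite /jacobi_matrix /=; ring. Qed.

Lemma jacobiZ al c n : J (fun n => al * c n) n = al * J c n.
Proof. by case: n => [|n]; rewrite /jacobi_matrix /=; ring. Qed.

Lemma jacobi_sum (m : nat) (F : nat -> cseq R) n :
  J (fun n => \sum_(j < m) F j n) n = \sum_(j < m) J (F j) n.
Proof.
elim: m => [|m IH].
  rewrite big_ord0 /jacobi_matrix !big_ord0 !mulr0 !addr0.
  by case: n => // n; rewrite big_ord0 mulr0.
rewrite big_ord_recr /= -IH -jacobiD; congr (J _ n).
by apply/funext => k; rewrite big_ord_recr.
Qed.

(** As [a n] is nonzero, row [n] of the system determines [c n.+1]. *)
Lemma jacobi_unique z h c d : c 0%N = d 0%N ->
  (forall n, J c n = z * c n + h n) -> (forall n, J d n = z * d n + h n) -> c = d.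
Proof.
move=> cd0 Jc Jd; apply/funext => n.
suff: c n = d n /\ c n.+1 = d n.+1 by case.
have step k : a k != 0 -> (if k is m.+1 then c m = d m else True) ->
    c k = d k -> c k.+1 = d k.+1.
  move=> ak0 ckm ck; apply: (mulfI (aC_neq0 k)).
  have : J c k - z * c k = J d k - z * d k by rewrite Jc Jd; ring.
  rewrite ck => /addIr; rewrite /jacobi_matrix ck.
  by case: k {ak0 ck} ckm => [_|k ->] /addrI.
elim: n => [|n [IH1 IH2]].
  by split=> //; apply: step => //; rewrite gt_eqF.
by split=> //; apply: step => //; rewrite gt_eqF.
Qed.

(** The Wronskian is the boundary term of the Green formula for [J]. *)
Definition wronskian c d n : R[i] :=
  (a n)%:C * (c n.+1 * d n - c n * d n.+1).

Lemma green c d n :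
  wronskian c d n = \sum_(k < n.+1) (J c k * d k - c k * J d k).
Proof.
elim: n => [|n IH].
  by rewrite big_ord_recr big_ord0 /wronskian /jacobi_matrix /=; ring.
by rewrite big_ord_recr -IH /wronskian /jacobi_matrix /=; ring.
Qed.

Section fundamental_system.
Variables (z : R[i]) (P Q : cseq R).
Hypothesis P0 : P 0%N = 1.
Hypothesis JP : forall n, J P n = z * P n.
Hypothesis Q0 : Q 0%N = 0.
Hypothesis JQ : forall n, J Q n = z * Q n + e0 n.

(** In the Green formula for [Q] and [P] only the term [e0 0 * P 0] survives. *)
Lemma wronskian_QP n : wronskian Q P n = 1.
Proof.
rewrite green (eq_bigr (fun k : 'I_n.+1 => e0 k * P k)); last first.
  by move=> k _; rewrite JP JQ; ring.
rewrite big_ord_recl big1 /= => [|i _]; first by rewrite /e0 /= mul1r addr0.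
by rewrite /e0 /= mul0r.
Qed.

(** The discrete Duhamel sum: [n |-> Q n * P k - P n * Q k] solves the
    homogeneous equation and vanishes at [k], with unit Wronskian there. *)
Definition duhamel h : cseq R :=
  fun n => \sum_(k < n) (Q n * P k - P n * Q k) * h k.

Let duhamelE h n : duhamel h n =
  Q n * (\sum_(k < n) P k * h k) - P n * (\sum_(k < n) Q k * h k).
Proof.
by rewrite !mulr_sumr -sumrB; apply: eq_bigr => k _; ring.
Qed.

Lemma jacobi_duhamel h n : J (duhamel h) n = z * duhamel h n + h n.
Proof.
set A := \sum_(k < n) P k * h k; set B := \sum_(k < n) Q k * h k.
have En : duhamel h n = Q n * A - P n * B by rewrite duhamelE.
have ES : duhamel h n.+1 =
    Q n.+1 * A - P n.+1 * B + (Q n.+1 * P n - Q n * P n.+1) * h n.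
  by rewrite duhamelE !big_ord_recr /= -/A -/B; ring.
have W : (a n)%:C * (Q n.+1 * P n - Q n * P n.+1) = 1 := wronskian_QP n.
transitivity (A * J Q n - B * J P n +
    (a n)%:C * (Q n.+1 * P n - Q n * P n.+1) * h n).
  rewrite /jacobi_matrix; case: n @A @B En ES W => [|n] A B En ES W.
    by rewrite En ES /=; ring.
  have -> : duhamel h n = Q n * A - P n * B.
    by rewrite duhamelE /A /B !big_ord_recr /=; ring.
  by rewrite En ES /=; ring.
rewrite W JQ JP En; have -> : A * (z * Q n + e0 n) = A * (z * Q n).
  rewrite mulrDr; case: n @A {B En ES W} => [|n] A; last by rewrite /e0 mulr0 addr0.
  by rewrite /A big_ord0 !mul0r addr0.
by ring.
Qed.

(** Both sides solve the same recurrence with the same initial value. *)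
Lemma variation_of_constants g h c :
  (forall n, J c n = z * c n + g * e0 n + h n) ->
  forall n, c n = c 0%N * P n + g * Q n + duhamel h n.
Proof.
move=> Jc n.
suff : c = (fun n => c 0%N * P n + g * Q n + duhamel h n) by move=> {1}->.
apply: (jacobi_unique z (fun n => g * e0 n + h n)).
- by rewrite P0 Q0 /duhamel big_ord0; ring.
- by move=> k; rewrite Jc addrA.
move=> k; rewrite jacobiD jacobiD !jacobiZ jacobi_duhamel JP JQ; ring.
Qed.

Hypothesis Pl2 : l2 P.
Hypothesis Ql2 : l2 Q.

Lemma sqmod_duhamel_le h n : sqmod (duhamel h n) <=
  2 * (sqmod (Q n) * nsq P + sqmod (P n) * nsq Q) * \sum_(k < n) sqmod (h k).
Proof.
rewrite duhamelE.
set A := \sum_(k < n) P k * h k; set B := \sum_(k < n) Q k * h k.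
set H := \sum_(k < n) sqmod (h k).
have H0 : 0 <= H by apply: sumr_ge0 => i _; apply: sqmod_ge0.
have HA : sqmod A <= nsq P * H.
  apply: le_trans (sqmod_sum_le _ _ _) _.
  by rewrite ler_wpM2r// sum_le_nsq.
have HB : sqmod B <= nsq Q * H.
  apply: le_trans (sqmod_sum_le _ _ _) _.
  by rewrite ler_wpM2r// sum_le_nsq.
apply: le_trans (sqmodD_le _ _) _.
rewrite sqmodN !sqmodM.
apply: (@le_trans _ _ (2 * (sqmod (Q n) * (nsq P * H)) +
  2 * (sqmod (P n) * (nsq Q * H)))).
  by rewrite lerD// ler_pM2l// ler_wpM2l// sqmod_ge0.
by rewrite le_eqVlt; apply/orP; left; apply/eqP; ring.
Qed.

Lemma duhamel_l2 h : l2 h -> l2 (duhamel h) /\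
  nsq (duhamel h) <= 4 * nsq P * nsq Q * nsq h.
Proof.
move=> hl; have key n : \sum_(k < n) sqmod (duhamel h k) <=
    4 * nsq P * nsq Q * nsq h.
  apply: (@le_trans _ _ (\sum_(k < n)
    2 * (sqmod (Q k) * nsq P + sqmod (P k) * nsq Q) * nsq h)).
    apply: ler_sum => k _; apply: le_trans (sqmod_duhamel_le _ _) _.
    rewrite ler_wpM2l ?sum_le_nsq// mulr_ge0// addr_ge0//;
      by rewrite mulr_ge0 ?sqmod_ge0 ?nsq_ge0.
  rewrite -mulr_suml -mulr_sumr big_split /= -!mulr_suml.
  rewrite ler_wpM2r ?nsq_ge0//.
  apply: (@le_trans _ _ (2 * (nsq Q * nsq P + nsq P * nsq Q))).
    by rewrite ler_pM2l// lerD// ler_wpM2r ?nsq_ge0 ?sum_le_nsq.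
  by rewrite le_eqVlt; apply/orP; left; apply/eqP; ring.
have dl : l2 (duhamel h) by apply/l2P; eexists; exact: key.
by split=> //; apply: nsq_le.
Qed.

(** In the limit circle case an approximate solution with a small error in [l2]
    is close in [l2] to an exact one. *)
Lemma nsq_variation g h c : l2 h ->
  (forall n, J c n = z * c n + g * e0 n + h n) ->
  l2 c /\ nsq (fun n => c n - (c 0%N * P n + g * Q n)) <= 4 * nsq P * nsq Q * nsq h.
Proof.
move=> hl /variation_of_constants E; have [dl dn] := duhamel_l2 _ hl; split.
  rewrite (funext E); apply: l2D => //.
  by apply: l2D; apply: l2Z.
rewrite (_ : (fun n => _) = duhamel h)//.
by apply/funext => n; rewrite [c n]E; ring.
Qed.

(** The limit circle case does not depend on the spectral parameter: squaring
    the variation of constants formula for the parameter [w], the partial sums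
    [S n] of [sqmod (c k)] satisfy [1 + S n.+1 <= (1 + S n) * (1 + G n)] with a
    summable [G]. *)
Lemma limit_circle_invariance w g c :
  (forall n, J c n = w * c n + g * e0 n) -> l2 c.
Proof.
move=> Jc; pose h n := (w - z) * c n.
have E : forall n, c n = c 0%N * P n + g * Q n + duhamel h n.
  by apply: variation_of_constants => n; rewrite Jc /h; ring.
pose S n := \sum_(k < n) sqmod (c k).
have S0 n : 0 <= S n by apply: sumr_ge0 => i _; apply: sqmod_ge0.
pose K := 2 * (2 * sqmod (c 0%N) + 2 * sqmod g +
  2 * (nsq P + nsq Q) * sqmod (w - z)).
have PQ0 : 0 <= nsq P + nsq Q by rewrite addr_ge0// nsq_ge0.
pose G n := K * (sqmod (P n) + sqmod (Q n)).
have K0 : 0 <= K.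
  by rewrite mulr_ge0// !addr_ge0 ?mulr_ge0 ?sqmod_ge0.
have G0 n : 0 <= G n by rewrite mulr_ge0// addr_ge0 ?sqmod_ge0.
have cG n : sqmod (c n) <= G n * (1 + S n).
  rewrite E; apply: le_trans (sqmodD_le _ _) _.
  have h1 := sqmodD_le (c 0%N * P n) (g * Q n); rewrite !sqmodM in h1.
  have := sqmod_duhamel_le h n.
  rewrite (_ : \sum_(k < n) sqmod (h k) = sqmod (w - z) * S n); last first.
    by rewrite /S mulr_sumr; apply: eq_bigr => k _; rewrite sqmodM.
  move=> h2.
  apply: (@le_trans _ _ (2 * (2 * (sqmod (c 0%N) * sqmod (P n)) + 2 * (sqmod g * sqmod (Q n))) +
    2 * (2 * (sqmod (Q n) * nsq P + sqmod (P n) * nsq Q) * (sqmod (w - z) * S n)))).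
    by rewrite lerD// ler_pM2l.
  have := S0 n; have := sqmod_ge0 (P n); have := sqmod_ge0 (Q n).
  have := sqmod_ge0 (c 0%N); have := sqmod_ge0 g; have := sqmod_ge0 (w - z).
  have := nsq_ge0 _ Pl2; have := nsq_ge0 _ Ql2.
  rewrite /G /K.
  move: (nsq P) (nsq Q) (sqmod (w - z)) (sqmod g) (sqmod (c 0%N)) (sqmod (P n))
    (sqmod (Q n)) (S n) => nP nQ s sg sc p q t nQ0 nP0 s0 sg0 sc0 q0 p0 t0.
  rewrite -subr_ge0 (_ : _ - _ = 4 * (sc * q + sg * p + (sc + sg) * (p + q) * t
    + s * (nP + nQ) * (p + q)
    + s * t * (nP * p + nQ * q))); last by ring.
  by rewrite mulr_ge0// !addr_ge0// ?mulr_ge0// ?addr_ge0 ?mulr_ge0.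
have GK n : \sum_(k < n) G k <= K * (nsq P + nsq Q).
  by rewrite -mulr_sumr ler_wpM2l// big_split /= lerD// sum_le_nsq.
have SE n : 1 + S n <= expR (\sum_(k < n) G k).
  elim: n => [|n IH]; first by rewrite /S !big_ord0 addr0 expR0.
  rewrite big_ord_recr /= expRD.
  apply: (@le_trans _ _ ((1 + S n) * (1 + G n))).
    rewrite /S big_ord_recr /= -/(S n) mulrDr mulr1 addrA lerD2l.
    by rewrite mulrC cG.
  by rewrite ler_pM ?expR_ge1Dx// addr_ge0.
apply/l2P; exists (expR (K * (nsq P + nsq Q))) => n.
apply: (@le_trans _ _ (1 + S n)); first by rewrite lerDr.
by apply: le_trans (SE n) _; rewrite ler_expR.
Qed.

End fundamental_system.

(** A Pluecker relation.  When both Wronskians on the left are 1, those of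
    [P] and [Q] with [c] cannot both tend to 0 while those with [d] stay
    bounded. *)
Lemma wronskian_pluecker P Q c d n :
  wronskian Q P n * wronskian d c n =
  wronskian Q d n * wronskian P c n - wronskian Q c n * wronskian P d n.
Proof. by rewrite /wronskian; ring. Qed.

End jacobi.

(** * Integrability for finite measures on the line *)

Section finite_measure_integrability.
Context {R : realType}.
Variable nu : borel_measure R.
Hypothesis nu_fin : (nu setT < +oo)%E.

Lemma integrable_const (r : R) (D : set (measurableTypeR R)) :
  measurable D -> nu.-integrable D (EFin \o cst r).
Proof.
move=> mD; apply/integrableP; split.
  by apply/measurable_EFinP; apply: measurable_cst.
rewrite (eq_integral (cst `|r|%:E))//.
rewrite integral_cst// lte_mul_pinfty// ?lee_fin//.
by apply: le_lt_trans nu_fin; apply: le_measure; rewrite ?inE.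
Qed.

Lemma integrable_dominated (f g : measurableTypeR R -> R) :
  measurable_fun setT f -> (forall x, `|f x| <= g x) ->
  nu.-integrable setT (EFin \o g) -> nu.-integrable setT (EFin \o f).
Proof.
move=> mf fg gi; apply: (le_integrable _ _ _ gi) => //.
  exact/measurable_EFinP.
move=> x _ /=; rewrite lee_fin (le_trans (fg x))//; exact: ler_norm.
Qed.

Lemma integrable_bounded (f : measurableTypeR R -> R) M :
  measurable_fun setT f -> (forall x, `|f x| <= M) ->
  nu.-integrable setT (EFin \o f).
Proof.
by move=> mf fM; apply: (integrable_dominated _ _ mf fM); apply: integrable_const.
Qed.

Lemma integrable_id_of_sq :
  (\int[nu]_x (x ^+ 2)%:E < +oo)%E ->
  nu.-integrable setT (EFin \o (fun x : measurableTypeR R => x)).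
Proof.
move=> h.
have msq : measurable_fun setT (fun x : measurableTypeR R => x ^+ 2).
  by apply: measurable_funX; apply: measurable_id.
apply: (@integrable_dominated _ (fun x => 1 + x ^+ 2)).
- exact: measurable_id.
- move=> x; rewrite ler_norml; apply/andP; split; rewrite -subr_ge0.
    have -> : x - - (1 + x ^+ 2) = (x + 1 / 2) ^+ 2 + 3 / 4 by field.
    by rewrite addr_ge0 ?sqr_ge0.
  have -> : 1 + x ^+ 2 - x = (x - 1 / 2) ^+ 2 + 3 / 4 by field.
  by rewrite addr_ge0 ?sqr_ge0.
rewrite (_ : EFin \o _ = (EFin \o cst 1) \+ (EFin \o (fun x => x ^+ 2))); last first.
  by apply/funext => x /=.
apply: integrableD => //; first exact: integrable_const.
apply/integrableP; split; first exact/measurable_EFinP.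
by under eq_integral do rewrite /= ger0_norm ?sqr_ge0//.
Qed.

End finite_measure_integrability.

(** * Projection-valued measures and symmetric operators *)

Section spectral.
Context {R : realType}.
Variables (a b : nat -> R) (E : @pv_fun R) (A : @operator R).
Local Notation J := (jacobi_matrix a b).
Hypothesis actA : act A = J.
Hypothesis spA : spectral_measure A E.
Hypothesis domA_l2 : forall c, dom A c -> l2 c /\ l2 (J c).
Implicit Types (c d : cseq R) (B S : set (measurableTypeR R)).

Let pvm : projection_valued_measure E := spA.1.

Lemma projection_l2 B c : measurable B -> l2 c -> l2 (E B c).
Proof. by case: pvm => + _ _ => /(_ B) + mB => /(_ mB)[+ _ _ _]; apply. Qed.

Lemma projection_linear B al c d : measurable B -> l2 c -> l2 d ->
  E B (fun n => al * c n + d n) = fun n => al * E B c n + E B d n.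
Proof. by case: pvm => + _ _ => /(_ B) + mB => /(_ mB)[_ + _ _]; apply. Qed.

Lemma projection_idem B c : measurable B -> l2 c -> E B (E B c) = E B c.
Proof. by case: pvm => + _ _ => /(_ B) + mB => /(_ mB)[_ _ _]; apply. Qed.

Lemma projection_sym B c d : measurable B -> l2 c -> l2 d ->
  l2dot (E B c) d = l2dot c (E B d).
Proof. by case: pvm => + _ _ => /(_ B) + mB => /(_ mB)[_ _ + _]; apply. Qed.

Lemma projection_full c : l2 c -> E setT c = c.
Proof. by case: pvm => _ + _; apply. Qed.

Lemma scalar_measure_exists c : l2 c -> exists nu, scalar_measure E c nu.
Proof. by case: pvm => _ _; apply. Qed.

Lemma projectionD B c d : measurable B -> l2 c -> l2 d ->
  E B (fun n => c n + d n) = fun n => E B c n + E B d n.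
Proof.
move=> mB cl dl; have := projection_linear B 1 c d mB cl dl.
by under eq_fun do rewrite mul1r; move=> ->; apply/funext => n; rewrite mul1r.
Qed.

Lemma projection0 B : measurable B -> E B (fun=> 0) = fun=> 0.
Proof.
move=> mB; have := projectionD B _ _ mB l2_0 l2_0.
rewrite (_ : (fun _ => _ + _) = fun=> 0); last by apply/funext => n; rewrite addr0.
move=> /(congr1 (fun f => f _)) h; apply/funext => n; have hn := h n.
by rewrite -[LHS](addrK (E B (fun=> 0) n)) -hn subrr.
Qed.

Lemma projectionZ B al c : measurable B -> l2 c ->
  E B (fun n => al * c n) = fun n => al * E B c n.
Proof.
move=> mB cl; have := projection_linear B al c _ mB cl l2_0.
rewrite (_ : (fun n => al * c n + 0) = fun n => al * c n); last first.
  by apply/funext => n; rewrite addr0.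
by move=> ->; apply/funext => n; rewrite projection0// addr0.
Qed.

Lemma projectionB B c d : measurable B -> l2 c -> l2 d ->
  E B (fun n => c n - d n) = fun n => E B c n - E B d n.
Proof.
move=> mB cl dl; have := projection_linear B (-1) d c mB dl cl.
rewrite (_ : (fun n => -1 * d n + c n) = fun n => c n - d n); last first.
  by apply/funext => n; rewrite mulN1r addrC.
by move=> ->; apply/funext => n; rewrite mulN1r addrC.
Qed.

Lemma projection_sum B (m : nat) (F : nat -> cseq R) : measurable B ->
  (forall j, (j < m)%N -> l2 (F j)) ->
  E B (fun n => \sum_(j < m) F j n) = fun n => \sum_(j < m) E B (F j) n.
Proof.
move=> mB; elim: m => [_|m IH Fl].
  rewrite (_ : (fun _ => _) = fun=> 0); last by apply/funext => n; rewrite big_ord0.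
  by rewrite projection0//; apply/funext => n; rewrite big_ord0.
rewrite (_ : (fun _ => _) = fun n => \sum_(j < m) F j n + F m n); last first.
  by apply/funext => n; rewrite big_ord_recr.
rewrite projectionD//; last 2 first.
- by apply: l2_sum => j jm; apply: Fl; apply: ltnW.
- exact: Fl.
rewrite IH => [|j jm]; last by apply: Fl; apply: ltnW.
by apply/funext => n; rewrite big_ord_recr.
Qed.

(** [<E(B)c, c>] is the squared norm of [E(B)c].  The rules for the projections
    below come from the additivity of these measures. *)
Lemma scalar_measureE c nu B : l2 c -> scalar_measure E c nu -> measurable B ->
  nu B = (nsq (E B c))%:E.
Proof.
move=> cl cnu mB; rewrite -cnu//; congr (_%:E).
by rewrite -{1}(projection_idem B)// projection_sym ?l2dotE//; apply: projection_l2.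
Qed.

Lemma scalar_measure_fin c nu : l2 c -> scalar_measure E c nu -> (nu setT < +oo)%E.
Proof. by move=> cl cnu; rewrite (scalar_measureE c)// ltry. Qed.

Lemma projection_nsq_mono B S c : measurable B -> measurable S -> S `<=` B ->
  l2 c -> nsq (E S c) <= nsq (E B c).
Proof.
move=> mB mS SB cl; have [nu cnu] := scalar_measure_exists _ cl.
by rewrite -lee_fin -!(scalar_measureE c nu)// le_measure ?inE.
Qed.

Lemma projection_nsq_le B c : measurable B -> l2 c -> nsq (E B c) <= nsq c.
Proof.
move=> mB cl; rewrite -{2}(projection_full c cl).
exact: projection_nsq_mono.
Qed.

(** The measure of [E(B)c] has total mass [nsq (E B c)], all of it on [B]: nothing
    is left for [S]. *)
Lemma projection_disjoint B S c : measurable B -> measurable S ->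
  S `&` B = set0 -> l2 c -> E S (E B c) = fun=> 0.
Proof.
move=> mB mS SB cl; set c' := E B c.
have c'l : l2 c' by apply: projection_l2.
have [nu cnu] := scalar_measure_exists _ c'l.
have c'B : E B c' = c' by apply: projection_idem.
apply: nsq_eq0; first exact: projection_l2.
have : nu (B `|` S) = (nu B + nu S)%E by rewrite measureU// setIC.
have mU : measurable (B `|` S) by apply: measurableU.
rewrite !(scalar_measureE c' nu)// c'B -EFinD => -[e].
by have := projection_nsq_le _ _ mU c'l; rewrite e gerDl.
Qed.

(** [E(B)] kills [c - E(B)c], whose measure therefore vanishes on [B] and on [S]. *)
Lemma projection_subset B S c : measurable B -> measurable S ->
  S `<=` B -> l2 c -> E S (E B c) = E S c.
Proof.
move=> mB mS SB cl; have Bl : l2 (E B c) by apply: projection_l2.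
suff: E S (fun n => c n - E B c n) = fun=> 0.
  rewrite projectionB// => h; apply/funext => n.
  by have /eqP := congr1 (fun f => f n) h; rewrite subr_eq0 => /eqP ->.
set d := fun n => _.
have dl : l2 d by apply: l2B.
have dB : E B d = fun=> 0.
  rewrite projectionB// projection_idem//.
  by apply/funext => n; rewrite subrr.
apply: nsq_eq0; first exact: projection_l2.
apply: le_trans (projection_nsq_mono _ _ _ mB mS SB dl) _.
by rewrite dB /nsq rdot0l.
Qed.

Lemma domP c nu : l2 c -> scalar_measure E c nu ->
  dom A c <-> (\int[nu]_x (x ^+ 2)%:E < +oo)%E.
Proof. by move=> cl cnu; have [] := spA.2 c nu cl cnu. Qed.

Let measurable_sq (D : set (measurableTypeR R)) :
  measurable_fun D (fun x : measurableTypeR R => (x ^+ 2)%:E).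
Proof.
by apply/measurable_EFinP; apply: measurable_funX; apply: measurable_id.
Qed.

(** The measure of a linear combination is at most [2 |al|^2] times that of [c]
    plus twice that of [d], so the spectral variable stays square integrable. *)
Lemma dom_linear al c d : dom A c -> dom A d -> dom A (fun n => al * c n + d n).
Proof.
move=> cA dA; have [cl _] := domA_l2 _ cA; have [dl _] := domA_l2 _ dA.
have el : l2 (fun n => al * c n + d n) by apply: l2D => //; apply: l2Z.
have [nc ncE] := scalar_measure_exists _ cl.
have [nd ndE] := scalar_measure_exists _ dl.
have [ne neE] := scalar_measure_exists _ el.
apply/(domP _ _ el neE).
have k0 : 0 <= 2 * sqmod al by rewrite mulr_ge0 ?sqmod_ge0.
pose k := NngNum k0; pose k2 := NngNum (ler0n R 2).
pose m : borel_measure R := measure_add (mscale k nc) (mscale k2 nd).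
have nem S : measurable S -> (ne S <= m S)%E.
  move=> mS; rewrite /m /measure_add/= /msum /= 2!big_ord_recl big_ord0 adde0 /=.
  rewrite /mscale /= (scalar_measureE _ _ _ el neE)//.
  rewrite (scalar_measureE _ _ _ cl ncE)// (scalar_measureE _ _ _ dl ndE)//.
  rewrite -!EFinM -EFinD lee_fin projection_linear//.
  apply: le_trans (nsqD_le _ _ _ _) _; [|exact: projection_l2|].
    by apply: l2Z; apply: projection_l2.
  by rewrite nsqZ ?mulrA//; apply: projection_l2.
apply: (@le_lt_trans _ _ (\int[m]_x (x ^+ 2)%:E)%E).
  apply: ge0_le_measure_integral => // x; by rewrite lee_fin sqr_ge0.
have sq0 (x : measurableTypeR R) : [set: measurableTypeR R] x -> (0 <= (x ^+ 2)%:E)%E.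
  by move=> _; rewrite lee_fin sqr_ge0.
rewrite /m ge0_integral_measure_add// !ge0_integral_mscale//.
apply: lte_add_pinfty; apply: lte_mul_pinfty => //.
- by apply/(domP _ _ cl ncE).
- by apply/(domP _ _ dl ndE).
Qed.

Lemma domD c d : dom A c -> dom A d -> dom A (fun n => c n + d n).
Proof.
move=> cA dA; have := dom_linear 1 c d cA dA.
by under eq_fun do rewrite mul1r.
Qed.

Lemma domB c d : dom A c -> dom A d -> dom A (fun n => c n - d n).
Proof.
move=> cA dA; have := dom_linear (-1) d c dA cA.
by rewrite (_ : (fun n => -1 * d n + c n) = fun n => c n - d n) => //;
  apply/funext => n; rewrite mulN1r addrC.
Qed.

Lemma quadratic_form c nu : dom A c -> scalar_measure E c nu ->
  rdot (J c) c = Rintegral nu setT (fun x => x) /\ rdot (J c) (fun n => ii * c n) = 0.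
Proof.
move=> cA cnu; have [cl Jl] := domA_l2 _ cA.
have [_ /(_ cA)] := spA.2 c nu cl cnu.
by rewrite actA l2dotE => -[].
Qed.

Lemma rdot_ii_diag c : rdot c (fun n => ii * c n) = 0.
Proof.
apply: rdot_eq; rewrite (_ : (fun n => _) = fun=> 0); first exact: cvg_cst.
by apply/funext => n; rewrite big1// => i _; rewrite /redot !ReImE; ring.
Qed.

Lemma rdot_quadratic c : dom A c -> rdot (J c) (fun n => ii * c n) = 0.
Proof.
move=> cA; have [cl _] := domA_l2 _ cA.
have [nu cnu] := scalar_measure_exists _ cl.
by have [] := quadratic_form _ _ cA cnu.
Qed.

(** The quadratic form is real; polarize it with [ii d + c]. *)
Lemma operator_symmetric c d : dom A c -> dom A d -> rdot (J c) d = rdot c (J d).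
Proof.
move=> cA dA; have [cl Jcl] := domA_l2 _ cA; have [dl Jdl] := domA_l2 _ dA.
have eA := dom_linear ii d c dA cA.
have := rdot_quadratic _ eA.
have -> : J (fun n => ii * d n + c n) = fun n => ii * J d n + J c n.
  by apply/funext => n; rewrite jacobiD jacobiZ.
have -> : (fun n => ii * (ii * d n + c n)) = fun n => ii * c n - d n.
  apply/funext => n; apply: complex_eq; rewrite !ReImE; ring.
have icl : l2 (fun n => ii * c n) by apply: l2Z.
have iJdl : l2 (fun n => ii * J d n) by apply: l2Z.
rewrite rdotDl//; last exact: l2B.
rewrite !rdotBr//.
rewrite (rdot_quadratic c)// rdot_ii.
have -> : rdot (fun n => ii * J d n) d = 0.
  rewrite -rdot_ii -(oppr0 R) -(rdot_quadratic d)//.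
  rewrite -[RHS]mulN1r -rdotZl//; last exact: l2Z.
  congr rdot; apply/funext => n; apply: complex_eq; rewrite !ReImE; ring.
by move/eqP; rewrite subr0 sub0r subr_eq0 => /eqP <-; rewrite rdotC.
Qed.

(** The first-order estimate behind the functional calculus: on the range of
    [E(B)], with [B] short, [A] is close to a scalar.  The error is tested
    against an arbitrary [d] by polarization; off [B] the measures of [c + d]
    and [c - d] agree, so only [B] contributes. *)
Lemma local_scalar_estimate (al de : R) B c d : measurable B ->
  (forall x, B x -> al <= x <= al + de) -> 0 <= de ->
  dom A c -> E B c = c -> dom A d ->
  2 * rdot (fun n => J c n - al%:C * c n) d <= de * (nsq c + nsq (E B d)).
Proof.
move=> mB Bal de0 cA cB dA.
have [cl Jcl] := domA_l2 _ cA; have [dl Jdl] := domA_l2 _ dA.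
have mCB : measurable (~` B) by apply: measurableC.
pose p n := c n + d n; pose m n := c n - d n.
have pA : dom A p by apply: domD.
have mA : dom A m by apply: domB.
have pl : l2 p by apply: l2D.
have ml : l2 m by apply: l2B.
have [np npE] := scalar_measure_exists _ pl.
have [nm nmE] := scalar_measure_exists _ ml.
have intx c' nu : dom A c' -> scalar_measure E c' nu ->
    nu.-integrable setT (EFin \o (fun x : measurableTypeR R => x - al)).
  move=> c'A c'nu; have [c'l _] := domA_l2 _ c'A.
  have fin := scalar_measure_fin _ _ c'l c'nu.
  rewrite (_ : EFin \o _ = (EFin \o (fun x => x)) \+ (EFin \o cst (- al)))//.
  apply: integrableD => //.
    by apply: integrable_id_of_sq => //; apply/(domP c').
  exact: integrable_const.
have quad c' nu : dom A c' -> scalar_measure E c' nu ->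
    rdot (J c') c' - al * nsq c' =
    Rintegral nu B (fun x => x - al) + Rintegral nu (~` B) (fun x => x - al).
  move=> c'A c'nu; have [c'l _] := domA_l2 _ c'A.
  have fin := scalar_measure_fin _ _ c'l c'nu.
  rewrite -Rintegral_setU//; last 2 first.
  - by rewrite setUv; apply: intx c'A c'nu.
  - by apply/disj_setPS; rewrite setICr.
  rewrite setUv (quadratic_form _ _ c'A c'nu).1 RintegralB//; last 2 first.
  - by apply: integrable_id_of_sq => //; apply/(domP c').
  - exact: integrable_const.
  by rewrite Rintegral_cst// (scalar_measureE c')//= projection_full.
have off : Rintegral np (~` B) (fun x => x - al) = Rintegral nm (~` B) (fun x => x - al).
  congr fine; apply: eq_measure_integral => S mS SB.
  rewrite (scalar_measureE p)// (scalar_measureE m)//.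
  have cS : E S c = fun=> 0.
    rewrite -cB projection_disjoint//; apply/seteqP; split=> // x [Sx Bx].
    by case: (SB x Sx).
  rewrite projectionD// projectionB// cS; congr (_%:E).
  transitivity (nsq (E S d)); [|rewrite -nsqN]; congr nsq; apply/funext => n.
    by rewrite add0r.
  by rewrite sub0r.
have EBp : nsq (E B p) <= 2 * nsq c + 2 * nsq (E B d).
  by rewrite projectionD// cB; apply: nsqD_le => //; apply: projection_l2.
have intB c' nu : dom A c' -> scalar_measure E c' nu ->
    nu.-integrable B (EFin \o (fun x : measurableTypeR R => x - al)).
  by move=> c'A c'nu; apply: integrableS (intx _ _ c'A c'nu).
have bp : Rintegral np B (fun x => x - al) <= de * nsq (E B p).
  have -> : de * nsq (E B p) = Rintegral np B (fun=> de).
    by rewrite Rintegral_cst// (scalar_measureE p).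
  apply: le_Rintegral => //; first exact: intB pA npE.
    by apply: integrable_const => //; apply: (scalar_measure_fin p).
  by move=> x /Bal /andP[_]; rewrite lerBlDl.
have bm : 0 <= Rintegral nm B (fun x => x - al).
  by apply: Rintegral_ge0 => x /Bal /andP[+ _]; rewrite subr_ge0.
have qp := quad _ _ pA npE; have qm := quad _ _ mA nmE.
have Jp : J p = fun n => J c n + J d n by apply/funext => n; rewrite jacobiD.
have Jm : J m = fun n => J c n - J d n.
  apply/funext => n; rewrite /m (_ : (fun n => c n - d n) = fun n => c n + (-1) * d n).
    by rewrite jacobiD jacobiZ mulN1r.
  by apply/funext => k; rewrite mulN1r.
have alc : l2 (fun n => al%:C * c n) by apply: l2Z.
have sym : rdot (J d) c = rdot (J c) d.
  by rewrite operator_symmetric// rdotC.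
have expand : rdot (J p) p - al * nsq p - (rdot (J m) m - al * nsq m) =
    4 * rdot (fun n => J c n - al%:C * c n) d.
  have -> : rdot (J p) p = rdot (J c) c + 2 * rdot (J c) d + rdot (J d) d.
    by rewrite Jp rdotDl// !rdotDr// sym; ring.
  have -> : rdot (J m) m = rdot (J c) c - 2 * rdot (J c) d + rdot (J d) d.
    by rewrite Jm rdotBl// !rdotBr// sym; ring.
  have -> : nsq p = nsq c + 2 * rdot c d + nsq d.
    by rewrite /nsq rdotDl// !rdotDr// (rdotC d c); ring.
  have -> : nsq m = nsq c - 2 * rdot c d + nsq d.
    by rewrite /nsq rdotBl// !rdotBr// (rdotC d c); ring.
  rewrite rdotBl// rdotZl//.
  by ring.
have : 4 * rdot (fun n => J c n - al%:C * c n) d <=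
    de * (2 * nsq c + 2 * nsq (E B d)).
  rewrite -expand qp qm off; apply: (@le_trans _ _ (Rintegral np B (fun x => x - al))).
    by rewrite opprD addrACA subrr addr0 gerDl oppr_le0.
  by apply: le_trans bp _; rewrite ler_wpM2l.
lra.
Qed.

End spectral.

(** * Vectors assembled from spectral pieces *)

Section truncation.
Context {R : realType}.
Implicit Types c d : cseq R.

Definition trunc (N : nat) c : cseq R := fun n => if (n < N)%N then c n else 0.

Lemma trunc_fin N c : finitely_supported (trunc N c).
Proof. by exists N => n Nn; rewrite /trunc ltnNge Nn. Qed.

Lemma rdot_trunc N c d : (forall n, (N <= n)%N -> redot (c n) (d n) = 0) ->
  rdot c d = \sum_(k < N) redot (c k) (d k).
Proof.
move=> cd0; apply: rdot_eq; apply: cvg_near_cst; exists N => // n /= Nn.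
rewrite -(subnKC Nn) big_split_ord /= [X in _ + X]big1 ?addr0// => i _.
by rewrite cd0// leq_addr.
Qed.

Lemma rdot_truncr N c : rdot c (trunc N c) = \sum_(k < N) sqmod (c k).
Proof.
rewrite (rdot_trunc N); last first.
  by move=> n Nn; rewrite /trunc ltnNge Nn /redot !mulr0 addr0.
by apply: eq_bigr => k _; rewrite /trunc ltn_ord redotzz.
Qed.

Lemma nsq_trunc N c : nsq (trunc N c) = \sum_(k < N) sqmod (c k).
Proof.
rewrite /nsq (rdot_trunc N); last first.
  by move=> n Nn; rewrite /trunc ltnNge Nn /redot !mulr0 addr0.
by apply: eq_bigr => k _; rewrite /trunc ltn_ord redotzz.
Qed.

End truncation.

Section spectral_sums.
Context {R : realType}.
Variables (a b : nat -> R) (E : @pv_fun R) (A : @operator R).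
Local Notation J := (jacobi_matrix a b).
Hypothesis actA : act A = J.
Hypothesis spA : spectral_measure A E.
Hypothesis domA_l2 : forall c, dom A c -> l2 c /\ l2 (J c).
Hypothesis finA : forall c, finitely_supported c -> dom A c.
Implicit Types (c d : cseq R) (B S U : set (measurableTypeR R)).

Local Notation proj_l2 := (projection_l2 _ _ spA).

Lemma projection_nsqU B S c : measurable B -> measurable S -> B `&` S = set0 ->
  l2 c -> nsq (E (B `|` S) c) = nsq (E B c) + nsq (E S c).
Proof.
move=> mB mS BS cl; have [nu cnu] := scalar_measure_exists _ _ spA _ cl.
have mU : measurable (B `|` S) by apply: measurableU.
have : nu (B `|` S) = (nu B + nu S)%E by rewrite measureU.
by rewrite !(scalar_measureE _ _ spA c nu)// -EFinD => -[].
Qed.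

Lemma rdot_projection B c : measurable B -> l2 c ->
  rdot (E B c) c = nsq (E B c).
Proof.
move=> mB cl; have := projection_sym _ _ spA B (E B c) c mB (proj_l2 _ _ mB cl) cl.
by rewrite (projection_idem _ _ spA)// !l2dotE => -[].
Qed.

(** Pythagoras: the squared norm of [c - E(B)c] is [nsq c - nsq (E B c)]. *)
Lemma projection_fixed B c : measurable B -> l2 c -> nsq c <= nsq (E B c) ->
  E B c = c.
Proof.
move=> mB cl cB; have Bl : l2 (E B c) by apply: proj_l2.
have dl : l2 (fun n => c n - E B c n) by apply: l2B.
suff /(nsq_eq0 _ dl)/(congr1 (fun f => f _)) h : nsq (fun n => c n - E B c n) <= 0.
  by apply/funext => n; apply/esym/eqP; rewrite -subr_eq0 h.
rewrite /nsq rdotBl// !rdotBr// (rdotC c (E B c)) rdot_projection//.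
rewrite -/(nsq c) -/(nsq (E B c)).
lra.
Qed.

Lemma projection_superset B V c : measurable B -> measurable V -> B `<=` V ->
  l2 c -> E V (E B c) = E B c.
Proof.
move=> mB mV BV cl; have Bl : l2 (E B c) by apply: proj_l2.
apply: projection_fixed => //; rewrite -{1}(projection_idem _ _ spA B)//.
exact: (projection_nsq_mono _ _ spA).
Qed.

(** The defect [w] of additivity is fixed by the projection of the union and
    killed by those of [B] and [S], so its norm vanishes. *)
Lemma projection_setU B S c : measurable B -> measurable S -> B `&` S = set0 ->
  l2 c -> E (B `|` S) c = fun n => E B c n + E S c n.
Proof.
move=> mB mS BS cl; have mU : measurable (B `|` S) by apply: measurableU.
have BU : B `<=` B `|` S by move=> x; left.
have SU : S `<=` B `|` S by move=> x; right.
have Bl : l2 (E B c) by apply: proj_l2.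
have Sl : l2 (E S c) by apply: proj_l2.
have Ul : l2 (E (B `|` S) c) by apply: proj_l2.
pose w n := E (B `|` S) c n - (E B c n + E S c n).
have BSl : l2 (fun n => E B c n + E S c n) by apply: l2D.
have wl : l2 w by apply: l2B.
have EW V : measurable V -> E V w =
    fun n => E V (E (B `|` S) c) n - (E V (E B c) n + E V (E S c) n).
  by move=> mV; rewrite (projectionB _ _ spA)// (projectionD _ _ spA).
have EB : E B w = fun=> 0.
  rewrite EW// (projection_subset _ _ spA)//.
  rewrite (projection_idem _ _ spA)// (projection_disjoint _ _ spA S B)//.
  by apply/funext => n; rewrite addr0 subrr.
have ES : E S w = fun=> 0.
  rewrite EW// (projection_subset _ _ spA)//.
  rewrite (projection_idem _ _ spA)// (projection_disjoint _ _ spA B S)//; last first.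
    by rewrite setIC.
  by apply/funext => n; rewrite add0r subrr.
have EU : E (B `|` S) w = w.
  by rewrite EW// (projection_idem _ _ spA)// !projection_superset.
have w0 : nsq w <= 0.
  by rewrite -EU projection_nsqU// EB ES /nsq rdot0l addr0.
apply/funext => n; have := congr1 (fun f => f n) (nsq_eq0 _ wl w0).
by move/eqP; rewrite subr_eq0 => /eqP.
Qed.

Lemma projection_setI S U c : measurable S -> measurable U -> l2 c ->
  E S (E U c) = E (S `&` U) c.
Proof.
move=> mS mU cl.
have mSU : measurable (S `&` U) by apply: measurableI.
have mSD : measurable (S `\` U) by apply: measurableD.
have Ul : l2 (E U c) by apply: proj_l2.
rewrite -{1}(setUIDK S U) projection_setU//; last first.
  by rewrite setDE setIACA setICr setI0.
rewrite (projection_subset _ _ spA U)//.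
rewrite (projection_disjoint _ _ spA U)//; last first.
  by rewrite setDE -setIA setICl setI0.
by apply/funext => n; rewrite addr0.
Qed.

Lemma projection_comm S U c : measurable S -> measurable U -> l2 c ->
  E S (E U c) = E U (E S c).
Proof. by move=> mS mU cl; rewrite !projection_setI// setIC. Qed.

Lemma projection_setC B c : measurable B -> l2 c ->
  E (~` B) c = fun n => c n - E B c n.
Proof.
move=> mB cl; have mC : measurable (~` B) by apply: measurableC.
apply/funext => n.
have := congr1 (fun f => f n) (projection_setU B (~` B) c mB mC (setICr B) cl).
by rewrite setUv (projection_full _ _ spA) /= // => ->; rewrite addrC addKr.
Qed.

Lemma nsq_orthogonalD B U c d : measurable B -> measurable U -> U `&` B = set0 ->
  l2 c -> l2 d -> E U c = c -> E B d = d ->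
  nsq (fun n => c n + d n) = nsq c + nsq d.
Proof.
move=> mB mU UB cl dl Uc Bd.
have cd0 : rdot c d = 0.
  have := projection_sym _ _ spA U c d mU cl dl.
  rewrite Uc -Bd (projection_disjoint _ _ spA B U)// Bd !l2dotE => -[-> _].
  by rewrite rdotC rdot0l.
by rewrite /nsq rdotDl ?rdotDr ?(rdotC d c) ?cd0 ?addr0 ?add0r//; exact: l2D.
Qed.

Section cells.
(** A vector assembled from pieces over consecutive cells [[x j, x (j+1))]. *)
Variables (x : nat -> R) (m : nat) (F : nat -> cseq R).
Hypothesis x_mono : {homo x : i j / (i <= j)%N >-> i <= j}.
Local Notation cell j := ([set` `[x j, x j.+1[] : set (measurableTypeR R)).
Local Notation upto j := ([set` `[x 0%N, x j[] : set (measurableTypeR R)).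
Hypothesis Fl : forall j, (j < m)%N -> l2 (F j).
Hypothesis FE : forall j, (j < m)%N -> E (cell j) (F j) = F j.

Lemma uptoS j : upto j.+1 = upto j `|` cell j.
Proof.
apply/seteqP; split=> y /=; rewrite !in_itv /=.
  move=> /andP[y0 yj]; have [yx|xy] := ltP y (x j); [left|right].
    by rewrite y0.
  by rewrite yj.
have x0j : x 0%N <= x j by apply: x_mono.
have xjj : x j <= x j.+1 by apply: x_mono.
move=> [/andP[-> yj]|/andP[xy ->]]; first by rewrite (lt_le_trans yj).
by rewrite (le_trans x0j).
Qed.

Lemma upto_cell_disjoint j : upto j `&` cell j = set0.
Proof.
apply/seteqP; split=> // y [] /=; rewrite !in_itv /=.
by move=> /andP[_ yj] /andP[xy _]; have := lt_le_trans yj xy; rewrite ltxx.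
Qed.

Let mcell j : measurable (cell j). Proof. exact: measurable_itv. Qed.
Let mupto j : measurable (upto j). Proof. exact: measurable_itv. Qed.

Lemma projection_upto_nsq c j : l2 c ->
  nsq (E (upto j) c) = \sum_(i < j) nsq (E (cell i) c).
Proof.
move=> cl; elim: j => [|j IH].
  rewrite big_ord0 (_ : upto 0%N = set0); last by rewrite set_itvco0.
  have [nu cnu] := scalar_measure_exists _ _ spA _ cl.
  by have := scalar_measureE _ _ spA c nu set0 cl cnu measurable0; rewrite measure0 => -[].
by rewrite uptoS projection_nsqU ?IH ?big_ord_recr ?upto_cell_disjoint.
Qed.

Lemma projection_upto c j : l2 c ->
  E (upto j) c = fun n => \sum_(i < j) E (cell i) c n.
Proof.
move=> cl; elim: j => [|j IH].
  apply: etrans (_ : (fun=> 0) = _).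
    by apply: nsq_eq0; [exact: proj_l2|rewrite projection_upto_nsq// big_ord0].
  by apply/funext => n; rewrite big_ord0.
rewrite uptoS projection_setU ?upto_cell_disjoint// IH.
by apply/funext => n; rewrite big_ord_recr.
Qed.

Lemma projection_upto_sum j : (j <= m)%N ->
  E (upto j) (fun n => \sum_(i < j) F i n) = fun n => \sum_(i < j) F i n.
Proof.
move=> jm; rewrite (projection_sum _ _ spA) => [|//|i ij]; last first.
  by apply: Fl; apply: leq_trans jm.
apply/funext => n; apply: eq_bigr => -[i ij] _ /=.
have im : (i < m)%N by apply: leq_trans jm.
rewrite -(FE i im) projection_superset//; last exact: Fl.
move=> y /=; rewrite !in_itv /= => /andP[xy yx]; apply/andP; split.
  by apply: le_trans xy; apply: x_mono.
by apply: lt_le_trans yx _; apply: x_mono.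
Qed.

Lemma nsq_projection_sum S j : measurable S -> (j <= m)%N ->
  nsq (E S (fun n => \sum_(i < j) F i n)) = \sum_(i < j) nsq (E S (F i)).
Proof.
move=> mS; elim: j => [_|j IH jm].
  rewrite big_ord0 (_ : (fun _ => _) = fun=> 0); last first.
    by apply/funext => n; rewrite big_ord0.
  by rewrite (projection0 _ _ spA)// /nsq rdot0l.
have sl : l2 (fun n => \sum_(i < j) F i n).
  by apply: l2_sum => i ij; apply: Fl; apply: leq_trans (ltnW jm).
rewrite big_ord_recr /= -IH ?(ltnW jm)//.
rewrite (_ : (fun n => \sum_(i < j.+1) F i n) = fun n => \sum_(i < j) F i n + F j n); last first.
  by apply/funext => n; rewrite big_ord_recr.
have Fjl := Fl j jm.
rewrite (projectionD _ _ spA)//; apply: (nsq_orthogonalD (cell j) (upto j)) => //.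
- exact: upto_cell_disjoint.
- exact: proj_l2.
- exact: proj_l2.
- by rewrite projection_comm// projection_upto_sum// ltnW.
- by rewrite projection_comm// FE.
Qed.

(** On a vector assembled from short cells, [A] acts like multiplication by
    the left end points, up to the mesh.  The errors of the cells add up without
    loss because the projections of a test vector to the cells are orthogonal. *)
Lemma step_function_estimate (de : R) : 0 < de ->
  (forall j, (j < m)%N -> x j.+1 <= x j + de) ->
  (forall j, (j < m)%N -> dom A (F j)) ->
  let y := fun n => \sum_(j < m) (J (F j) n - (x j)%:C * F j n) in
  l2 y /\ nsq y <= de ^+ 2 * \sum_(j < m) nsq (F j).
Proof.
move=> de0 xde FA y.
have yjl j : (j < m)%N -> l2 (fun n => J (F j) n - (x j)%:C * F j n).
  by move=> jm; apply: l2B; [exact: (domA_l2 _ (FA j jm)).2|apply: l2Z; exact: Fl].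
have yl : l2 y by apply: (@l2_sum _ m (fun j n => J (F j) n - (x j)%:C * F j n)).
have est d : dom A d ->
    2 * rdot y d <= de * (\sum_(j < m) nsq (F j) + nsq d).
  move=> dA; have [dl _] := domA_l2 _ dA.
  rewrite (@rdot_suml _ m (fun j n => J (F j) n - (x j)%:C * F j n))//.
  rewrite mulr_sumr.
  apply: (@le_trans _ _ (\sum_(j < m) de * (nsq (F j) + nsq (E (cell j) d)))).
    apply: ler_sum => -[j jm] _ /=.
    apply: (local_scalar_estimate a b E A actA spA domA_l2 _ _ (cell j)) => //.
    - move=> z /=; rewrite in_itv /= => /andP[-> /= zx].
      by rewrite (le_trans (ltW zx))// xde.
    - exact: ltW.
    - exact: FA.
    - exact: FE.
  rewrite -mulr_sumr ler_wpM2l// ?(ltW de0)// big_split /= lerD2l.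
  by rewrite -projection_upto_nsq// (projection_nsq_le _ _ spA).
split=> //; apply: nsq_le => // N.
set M := \sum_(j < m) nsq (F j); set s := \sum_(k < N) sqmod (y k).
(* Testing against a truncation of [y] gives its norm; the factor [de^-1]
   balances the two terms of [est]. *)
have tA : dom A (fun n => (de^-1)%:C * trunc N y n).
  apply: finA; have [K hK] := trunc_fin N y; exists K => n /hK ->.
  by rewrite mulr0.
have tl : l2 (trunc N y) by apply: fin_l2; apply: trunc_fin.
have := est _ tA; rewrite rdotZr// nsqZ// sqmodC rdot_truncr nsq_trunc -/M -/s.
have den0 : de != 0 by rewrite gt_eqF.
have -> : de * (M + de^-1 ^+ 2 * s) = (de ^+ 2 * M + s) / de by field.
have -> : 2 * (de^-1 * s) = (2 * s) / de by field.
by rewrite ler_pM2r ?invr_gt0//; lra.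
Qed.

End cells.

(** The spectral variable is bounded on the set carrying the measure of [c]. *)
Lemma dom_of_null B c M : measurable B -> l2 c -> nsq (E (~` B) c) = 0 ->
  (forall y, B y -> `|y| <= M) -> dom A c.
Proof.
move=> mB cl c0 BM; have [nu cnu] := scalar_measure_exists _ _ spA _ cl.
have mC : measurable (~` B) by apply: measurableC.
apply/(domP _ _ spA c nu cl cnu).
have msq D : measurable_fun D (fun x : measurableTypeR R => (x ^+ 2)%:E).
  by apply/measurable_EFinP; apply: measurable_funX; apply: measurable_id.
rewrite -(setUv B) ge0_integral_setU//; last 2 first.
- by move=> y _; rewrite lee_fin sqr_ge0.
- by apply/disj_setPS; rewrite setICr.
rewrite [X in (_ + X)%E](_ : _ = 0%E) ?adde0; last first.
  apply: null_set_integral => //.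
  by have := scalar_measureE _ _ spA c nu _ cl cnu mC; rewrite c0.
apply: (@le_lt_trans _ _ (\int[nu]_(x in B) (M ^+ 2)%:E)%E).
  apply: ge0_le_integral => //.
    by move=> y _; rewrite lee_fin sqr_ge0.
  move=> y /BM yM; rewrite lee_fin -(real_normK (num_real y)).
  by rewrite ler_pXn2r// ?nnegrE// (le_trans _ yM).
rewrite integral_cst// lte_mul_pinfty// ?lee_fin ?sqr_ge0//.
by rewrite (scalar_measureE _ _ spA c)// ltry.
Qed.

Lemma dom_projection B c M : measurable B -> l2 c ->
  (forall y, B y -> `|y| <= M) -> dom A (E B c).
Proof.
move=> mB cl BM; apply: (dom_of_null B _ M) => //; first exact: proj_l2.
rewrite (projection_disjoint _ _ spA B)//.
- by rewrite /nsq rdot0l.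
- exact: measurableC.
- by rewrite setICl.
Qed.

End spectral_sums.

(** * Cauchy kernels and Riemann sums *)

Section cauchy_kernel.
Context {R : realType}.
Implicit Types (z : R[i]) (x y : R).

Lemma Re_inv z : Re z^-1 = Re z / sqmod z.
Proof. by case: z. Qed.

Lemma Im_inv z : Im z^-1 = - Im z / sqmod z.
Proof. by case: z => u v /=; rewrite mulNr. Qed.

Lemma measurable_sqmod_sub z :
  measurable_fun setT (fun y : measurableTypeR R => sqmod (y%:C - z)).
Proof.
rewrite /sqmod; apply: measurable_funD; apply: measurable_funX => //.
  rewrite (_ : (fun _ => _) = fun y : measurableTypeR R => y - Re z).
    by apply: measurable_funB => //; apply: measurable_cst.
  by apply/funext => y; rewrite !ReImE.
rewrite (_ : (fun _ => _) = fun y : measurableTypeR R => - Im z).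
  by apply: measurable_cst.
by apply/funext => y; rewrite !ReImE sub0r.
Qed.

Lemma measurable_sqmod_subV z :
  measurable_fun setT (fun y : measurableTypeR R => (sqmod (y%:C - z))^-1).
Proof.
rewrite (_ : (fun _ => _) = fun y : measurableTypeR R => sqmod (y%:C - z) `^ (-1)).
  by apply: (@measurableT_comp _ _ _ _ _ _ (fun x : R => x `^ (-1))); [exact: measurable_powR|exact: measurable_sqmod_sub].
by apply/funext => y; rewrite powR_inv1// sqmod_ge0.
Qed.

Lemma measurable_Re_kernel z :
  measurable_fun setT (fun y : measurableTypeR R => Re (y%:C - z)^-1).
Proof.
under eq_fun do rewrite Re_inv.
apply: measurable_funM; last exact: measurable_sqmod_subV.
rewrite (_ : (fun _ => _) = fun y : measurableTypeR R => y - Re z).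
  by apply: measurable_funB => //; apply: measurable_cst.
by apply/funext => y; rewrite !ReImE.
Qed.

Lemma measurable_Im_kernel z :
  measurable_fun setT (fun y : measurableTypeR R => Im (y%:C - z)^-1).
Proof.
under eq_fun do rewrite Im_inv.
apply: measurable_funM; last exact: measurable_sqmod_subV.
rewrite (_ : (fun _ => _) = fun y : measurableTypeR R => Im z).
  by apply: measurable_cst.
by apply/funext => y; rewrite !ReImE sub0r opprK.
Qed.

Lemma abs_le_of_sq (t M : R) : t ^+ 2 <= M -> `|t| <= 1 + M.
Proof.
move=> tM; rewrite ler_norml; apply/andP; split; rewrite -subr_ge0.
  have : 0 <= (t + 1 / 2) ^+ 2 by apply: sqr_ge0.
  by rewrite sqrrD; lra.
have : 0 <= (t - 1 / 2) ^+ 2 by apply: sqr_ge0.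
by rewrite sqrrB; lra.
Qed.

Lemma sqr_Re_le z : Re z ^+ 2 <= sqmod z.
Proof. by rewrite lerDl sqr_ge0. Qed.

Lemma sqr_Im_le z : Im z ^+ 2 <= sqmod z.
Proof. by rewrite lerDr sqr_ge0. Qed.

Lemma le0_of_small (N C : R) : (forall e, 0 < e -> e <= 1 -> N <= C * e) -> N <= 0.
Proof.
move=> h; rewrite leNgt; apply/negP => N0.
have C0 : 0 < `|C| + 1 by rewrite ltr_wpDl.
pose e := Order.min 1 (N / (2 * (`|C| + 1))).
have e0 : 0 < e by rewrite lt_min ltr01 divr_gt0// mulr_gt0.
have e1 : e <= 1 by rewrite ge_min lexx.
have e2 : e <= N / (2 * (`|C| + 1)) by rewrite ge_min lexx orbT.
have := h e e0 e1; apply/negP; rewrite -ltNge.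
apply: (@le_lt_trans _ _ ((`|C| + 1) * (N / (2 * (`|C| + 1))))).
  apply: (@le_trans _ _ ((`|C| + 1) * e)); last by rewrite ler_pM2l.
  by rewrite ler_pM2r// (le_trans (ler_norm C))// lerDl.
have -> : (`|C| + 1) * (N / (2 * (`|C| + 1))) = N / 2.
  by field; rewrite gt_eqF.
by rewrite ltr_pdivrMr//; lra.
Qed.

End cauchy_kernel.

Section step_integral.
Context {R : realType}.
Variables (nu : borel_measure R) (x : nat -> R) (m : nat).
Hypothesis nu_fin : (nu setT < +oo)%E.
Hypothesis x_mono : {homo x : i j / (i <= j)%N >-> i <= j}.
Local Notation cell j := ([set` `[x j, x j.+1[] : set (measurableTypeR R)).
Local Notation upto j := ([set` `[x 0%N, x j[] : set (measurableTypeR R)).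

Let mcell j : measurable (cell j). Proof. exact: measurable_itv. Qed.
Let mupto j : measurable (upto j). Proof. exact: measurable_itv. Qed.

Lemma step_integral_estimate (u : R -> R) (v : nat -> R) (e M : R) :
  nu.-integrable setT (EFin \o u) ->
  (forall j, (j < m)%N ->
    `|Rintegral nu (cell j) u - v j * fine (nu (cell j))| <= e * fine (nu (cell j))) ->
  (forall y, `|u y| <= M) ->
  `|Rintegral nu setT u - \sum_(j < m) v j * fine (nu (cell j))| <=
    e * \sum_(j < m) fine (nu (cell j)) + M * fine (nu (~` upto m)).
Proof.
move=> ui uv uM.
have key j : (j <= m)%N -> `|Rintegral nu (upto j) u - \sum_(i < j) v i * fine (nu (cell i))|
    <= e * \sum_(i < j) fine (nu (cell i)).
  elim: j => [_|j IH jm].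
    by rewrite !big_ord0 (_ : upto 0%N = set0) ?set_itvco0// Rintegral_set0 subrr normr0 mulr0.
  rewrite (uptoS x)// Rintegral_setU//; last 2 first.
  - by apply: integrableS ui => //; apply: measurableU.
  - by apply/disj_setPS; rewrite (upto_cell_disjoint x).
  rewrite !big_ord_recr /= mulrDr opprD addrACA.
  by apply: le_trans (ler_normD _ _) _; rewrite lerD ?IH ?uv// ltnW.
have mC : measurable (~` upto m) by apply: measurableC.
rewrite -{1}(setUv (upto m)) Rintegral_setU//; last 2 first.
- by rewrite setUv.
- by apply/disj_setPS; rewrite setICr.
rewrite addrAC; apply: le_trans (ler_normD _ _) _; rewrite lerD ?key//.
have uiC : nu.-integrable (~` upto m) (EFin \o u) by apply: integrableS ui.
apply: le_trans (le_normr_Rintegral _ uiC) _ => //.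
rewrite -Rintegral_cst//; apply: le_Rintegral => //.
  exact: (integrable_norm uiC).
exact: integrable_const.
Qed.

End step_integral.

(** * Eigenvectors and the resolvent at the cyclic vector *)

Section cyclic_vector.
Context {R : realType}.
Variables (a b : nat -> R) (E : @pv_fun R) (A : @operator R).
Variable mt : borel_measure R.
Local Notation J := (jacobi_matrix a b).
Local Notation e0 := (@e0 R).
Hypothesis a_gt0 : forall n, 0 < a n.
Hypothesis actA : act A = J.
Hypothesis spA : spectral_measure A E.
Hypothesis domA_l2 : forall c, dom A c -> l2 c /\ l2 (J c).
Hypothesis finA : forall c, finitely_supported c -> dom A c.
Hypothesis mtE : scalar_measure E e0 mt.
Implicit Types (c d : cseq R) (B S U : set (measurableTypeR R)).

Local Notation proj_l2 := (projection_l2 _ _ spA).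

Lemma e0_fin : finitely_supported e0.
Proof. by exists 1%N => -[|n]. Qed.

Lemma e0_l2 : l2 e0. Proof. exact: fin_l2 e0_fin. Qed.

Lemma rdot_e0 c : rdot c e0 = Re (c 0%N).
Proof.
rewrite (rdot_trunc 1) => [|[|n]//].
  by rewrite big_ord_recl big_ord0 addr0 /redot /e0 /= mulr1 mulr0 addr0.
by move=> _; rewrite /redot /e0 /= !mulr0 addr0.
Qed.

Lemma rdot_ie0 c : rdot c (fun n => ii * e0 n) = Im (c 0%N).
Proof.
rewrite (rdot_trunc 1) => [|[|n]//].
  rewrite big_ord_recl big_ord0 addr0 (_ : e0 _ = 1)// mulr1 /redot.
  by rewrite Re_ii Im_ii mulr0 mulr1 add0r.
by move=> _; rewrite (_ : e0 _ = 0)// mulr0 /redot /= !mulr0 addr0.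
Qed.

Lemma nsq_e0 : nsq e0 = 1. Proof. by rewrite /nsq rdot_e0. Qed.

Lemma mt_nsq B : measurable B -> mt B = (nsq (E B e0))%:E.
Proof. by move=> mB; rewrite (scalar_measureE _ _ spA _ _ _ e0_l2 mtE). Qed.

Lemma fine_mt B : measurable B -> fine (mt B) = nsq (E B e0).
Proof. by move=> mB; rewrite mt_nsq. Qed.

Lemma mt_fin : (mt setT < +oo)%E.
Proof. by rewrite mt_nsq// ltry. Qed.

(** The zeroth coordinate is the inner product with [e0]. *)
Lemma projection_e0_0 B : measurable B -> E B e0 0%N = (nsq (E B e0))%:C.
Proof.
move=> mB; have Bl : l2 (E B e0) by apply: proj_l2 => //; exact: e0_l2.
have := projection_sym _ _ spA B (E B e0) e0 mB Bl e0_l2.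
rewrite (projection_idem _ _ spA)//; last exact: e0_l2.
rewrite !l2dotE rdot_e0 rdot_ie0 rdot_ii_diag => -[h1 h2].
by apply: complex_eq; rewrite ?h1 ?h2.
Qed.

Section eigenvector.
Variables (x : R) (P Q : cseq R).
Hypothesis P0 : P 0%N = 1.
Hypothesis JP : forall n, J P n = x%:C * P n.
Hypothesis Q0 : Q 0%N = 0.
Hypothesis JQ : forall n, J Q n = x%:C * Q n + e0 n.
Hypothesis Pl2 : l2 P.
Hypothesis Ql2 : l2 Q.

(** A point of the support is an eigenvalue.  The normalized [E(x-de, x+de)e0]
    are approximate eigenvectors, hence by variation of constants close in [l2]
    to multiples of [P]; being concentrated near [x], they force [P] to be so. *)
Lemma support_eigenvector : supp mt x -> dom A P.
Proof.
move=> xs.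
pose B1 : set (measurableTypeR R) := [set` `[x - 1, x + 1[].
have mB1 : measurable B1 by apply: measurable_itv.
have mC1 : measurable (~` B1) by apply: measurableC.
apply: (dom_of_null E A spA B1 P (`|x| + 1)) => //; last first.
  move=> y; rewrite /B1 /= in_itv /= => /andP[xy yx].
  rewrite -(subrKC x y) (le_trans (ler_normD _ _))// lerD2l.
  by rewrite ler_norml; apply/andP; split; lra.
set N := nsq (E (~` B1) P).
have Nl : l2 (E (~` B1) P) by apply: proj_l2.
have N0 : 0 <= N by apply: nsq_ge0.
apply/eqP; rewrite eq_le N0 andbT.
set p := nsq P; have p0 : 0 <= p by apply: nsq_ge0.
pose K := 40 * p * nsq Q.
have K0 : 0 <= K by rewrite !mulr_ge0// nsq_ge0.
apply: (@le0_of_small _ _ (2 * p * K + 2 * K * N)) => de de0 de1.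
pose B : set (measurableTypeR R) := [set` `[x - de, x + de[].
have mB : measurable B by apply: measurable_itv.
pose g := E B e0; set m := nsq g.
have gl : l2 g by apply: proj_l2 => //; exact: e0_l2.
have m0 : 0 < m.
  rewrite -lte_fin /m -mt_nsq//.
  apply: (@lt_le_trans _ _ (mt (ball x de))); last first.
    apply: le_measure; rewrite ?inE//.
      by apply: open_measurable; apply: ball_open.
    move=> y; rewrite /ball /= ltr_distlC /B /= in_itv /= => /andP[/ltW -> ->].
    by [].
  by apply: xs; [exact: ball_open|exact: ballxx].
pose xs_ (j : nat) := if j is 0%N then x - de else x + de.
have xs_mono : {homo xs_ : i j / (i <= j)%N >-> i <= j}.
  by move=> [|i] [|j] //= _; lra.
have gA : dom A g.
  apply: (dom_projection E A spA _ _ (`|x| + 1)) => //; first exact: e0_l2.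
  move=> y; rewrite /B /= in_itv /= => /andP[xy yx].
  rewrite -(subrKC x y) (le_trans (ler_normD _ _))// lerD2l.
  by rewrite ler_norml; apply/andP; split; lra.
have gB : E B g = g by rewrite (projection_idem _ _ spA)//; exact: e0_l2.
have [] := step_function_estimate a b E A actA spA domA_l2 finA xs_ 1%N (fun=> g)
  xs_mono (fun j _ => gl) _ (2 * de) _ _ (fun j _ => gA).
- by case.
- by rewrite mulr_gt0.
- by case=> //= _; lra.
rewrite big_ord_recl big_ord0 addr0 -/m.
set y := fun n => _ => yl yle.
pose h n := y n - de%:C * g n.
have hl : l2 h by apply: l2B => //; apply: l2Z.
have hle : nsq h <= 10 * de ^+ 2 * m.
  apply: le_trans (nsqB_le _ _ yl _) _; first exact: l2Z.
  by rewrite nsqZ// sqmodC -/m; lra.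
have Jg n : J g n = x%:C * g n + 0 * e0 n + h n.
  rewrite /h /y big_ord_recl big_ord0 addr0 /= mul0r addr0 rmorphB /=; ring.
have [_] := nsq_variation a b a_gt0 x%:C P Q P0 JP Q0 JQ Pl2 Ql2 0 h g hl Jg.
rewrite {2}/g projection_e0_0// -/g -/m -/p.
rewrite (_ : (fun n => _) = fun n => g n - m%:C * P n); last first.
  by apply/funext => n; rewrite mul0r addr0.
set r := fun n => _ => rle.
have rl : l2 r by apply: l2B => //; apply: l2Z.
have {}rle : nsq r <= K * de ^+ 2 * m.
  apply: le_trans rle _; rewrite /K.
  apply: (@le_trans _ _ (4 * p * nsq Q * (10 * de ^+ 2 * m))).
    by rewrite ler_wpM2l// !mulr_ge0// nsq_ge0.
  by rewrite le_eqVlt; apply/orP; left; apply/eqP; ring.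
have BB1 : B `<=` B1.
  by move=> z; rewrite /B /B1 /= !in_itv /= => /andP[? ?]; apply/andP; split; lra.
have gout : E (~` B1) g = fun=> 0.
  rewrite -gB (projection_disjoint _ _ spA B)//.
  by apply/seteqP; split=> // z [nz Bz]; apply: nz; apply: BB1.
have mN : m ^+ 2 * N <= K * de ^+ 2 * m.
  apply: le_trans rle; apply: le_trans (projection_nsq_le _ _ spA _ _ mC1 rl).
  rewrite (projectionB _ _ spA)//; last exact: l2Z.
  rewrite gout (projectionZ _ _ spA)//.
  rewrite (_ : (fun n => _) = fun n => - (m%:C * E (~` B1) P n)); last first.
    by apply/funext => n; rewrite sub0r.
  by rewrite nsqN nsqZ// sqmodC.
have m1 : m <= 2 * (m ^+ 2 * p) + 2 * (K * de ^+ 2 * m).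
  rewrite {1}/m (_ : g = fun n => m%:C * P n + r n); last first.
    by apply/funext => n; rewrite /r addrC subrK.
  apply: le_trans (nsqD_le _ _ _ rl) _; first exact: l2Z.
  by rewrite nsqZ// sqmodC -/p lerD2l ler_pM2l.
have mN' : m * N <= K * de ^+ 2.
  by rewrite -(ler_pM2l m0) mulrA -expr2 (mulrC m (K * _)).
(* [m] stays away from 0 as [de] tends to 0: [g] has squared norm [m] and is
   close to [m P], of squared norm [m ^+ 2 * p]. *)
have m1' : 1 <= 2 * (m * p) + 2 * (K * de ^+ 2).
  rewrite -(ler_pM2l m0) mulr1 (le_trans m1)// le_eqVlt; apply/orP; left.
  by apply/eqP; ring.
have : N <= N * (2 * (m * p) + 2 * (K * de ^+ 2)) by rewrite ler_peMr.
move=> /le_trans; apply.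
apply: (@le_trans _ _ ((2 * p * K + 2 * K * N) * de ^+ 2)).
  have -> : N * (2 * (m * p) + 2 * (K * de ^+ 2)) =
    2 * p * (m * N) + 2 * K * N * de ^+ 2 by ring.
  have : 2 * p * (m * N) <= 2 * p * (K * de ^+ 2).
    by rewrite ler_wpM2l// mulr_ge0.
  lra.
have C0 : 0 <= 2 * p * K + 2 * K * N.
  by apply: addr_ge0; apply: mulr_ge0 => //; apply: mulr_ge0.
rewrite ler_wpM2l //.
by rewrite expr2 ler_piMr// ltW.
Qed.

End eigenvector.

Lemma mt_tail (th : R) : 0 < th ->
  exists n : nat, nsq (E (~` [set` `[- n%:R, n%:R[]) e0) <= th.
Proof.
move=> th0.
pose F (n : nat) : set (measurableTypeR R) := ~` [set` `[- n%:R, n%:R[].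
have mF n : measurable (F n) by apply: measurableC; apply: measurable_itv.
have F0 : \bigcap_n F n = set0.
  apply/seteqP; split=> // y /= Fy.
  pose n := (Num.truncn `|y|).+1.
  have yn : `|y| < n%:R by rewrite truncnS_gt.
  apply: (Fy n) => //=; rewrite in_itv /=.
  by move: yn; rewrite ltr_norml => /andP[/ltW -> ->].
have Fmono : {homo F : n m / (n <= m)%N >-> (m <= n)%O}.
  move=> n m nm; rewrite subsetEset; apply: subsetC => y /=.
  rewrite !in_itv /= => /andP[ny yn]; have nm' : (n%:R : R) <= m%:R by rewrite ler_nat.
  by rewrite (le_trans _ ny) ?lerN2// (lt_le_trans yn).
have := @nonincreasing_cvg_mu _ _ _ mt F _ mF _ Fmono.
rewrite F0 measure0 => h.
have {}h : mt (F n) @[n --> \oo] --> 0%E.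
  by apply: h => //; rewrite mt_nsq// ltry.
have [n _ /(_ n (leqnn n))] := cvgr_lt 0 (fine_cvg h) th th0.
by move=> /= /ltW; rewrite fine_mt// => hn; exists n.
Qed.

Section resolvent.
Variables (la : R[i]) (r : R) (P Q : cseq R).
Hypothesis r_gt0 : 0 < r.
Local Notation near_la := ([set y | sqmod (y%:C - la) < r] : set (measurableTypeR R)).
Hypothesis gap : mt near_la = 0%E.
Hypothesis P0 : P 0%N = 1.
Hypothesis JP : forall n, J P n = la * P n.
Hypothesis Q0 : Q 0%N = 0.
Hypothesis JQ : forall n, J Q n = la * Q n + e0 n.
Hypothesis Pl2 : l2 P.
Hypothesis Ql2 : l2 Q.

Let mnear : measurable near_la.
Proof.
have := measurable_sqmod_sub la measurableT _ (measurable_itv `]-oo, r[).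
by rewrite setTI; congr measurable.
Qed.

(** The Cauchy kernel, made bounded by changing it on a null set. *)
Definition cut_kernel (y : R) : R[i] :=
  if r <= sqmod (y%:C - la) then (y%:C - la)^-1 else 0.

Lemma sqmod_cut_kernel y : sqmod (cut_kernel y) <= r^-1.
Proof.
rewrite /cut_kernel; case: ifPn => [h|_].
  by rewrite sqmodV lef_pV2// posrE (lt_le_trans r_gt0).
by rewrite sqmod0 invr_ge0 ltW.
Qed.

Section real_part.
(** [phi] is the real or the imaginary part. *)
Variable phi : R[i] -> R.
Hypothesis phiB : forall z w, phi (z - w) = phi z - phi w.
Hypothesis phi_le : forall z, phi z ^+ 2 <= sqmod z.
Hypothesis phi_measurable :
  measurable_fun setT (fun y : measurableTypeR R => phi (y%:C - la)^-1).

Let phi0 : phi 0 = 0.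
Proof. by rewrite -(subrr 0) phiB subrr. Qed.

Lemma measurable_cut_kernel :
  measurable_fun setT (fun y : measurableTypeR R => phi (cut_kernel y)).
Proof.
rewrite (_ : (fun _ => _) = fun y : measurableTypeR R =>
  if r <= sqmod (y%:C - la) then phi (y%:C - la)^-1 else 0).
  apply: measurable_fun_ifT => //.
  apply: measurable_fun_ler; first exact: measurable_cst.
  exact: measurable_sqmod_sub.
by apply/funext => y; rewrite /cut_kernel; case: ifP.
Qed.

Lemma phi_cut_kernel_le y : `|phi (cut_kernel y)| <= 1 + r^-1.
Proof.
by apply: abs_le_of_sq; apply: le_trans (phi_le _) (sqmod_cut_kernel _).
Qed.

Lemma integrable_cut_kernel :
  mt.-integrable setT (EFin \o (fun y => phi (cut_kernel y))).
Proof.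
apply: (@integrable_bounded _ _ mt_fin _ (1 + r^-1)).
  exact: measurable_cut_kernel.
exact: phi_cut_kernel_le.
Qed.

Lemma Rintegral_cut_kernel :
  Rintegral mt setT (fun y => phi (y%:C - la)^-1) =
  Rintegral mt setT (fun y => phi (cut_kernel y)).
Proof.
congr fine; apply: ae_eq_integral => //.
- exact/measurable_EFinP.
- by apply/measurable_EFinP; apply: measurable_cut_kernel.
exists near_la; split=> // y /= h; rewrite ltNge; apply/negP => h'.
by apply: h => _; rewrite /cut_kernel h'.
Qed.

Variables (x : nat -> R) (m : nat) (de : R).
Hypothesis x_mono : {homo x : i j / (i <= j)%N >-> i <= j}.
Hypothesis x_de : forall j, x j.+1 <= x j + de.
Hypothesis de_gt0 : 0 < de.
Hypothesis de_small : 4 * de ^+ 2 <= r.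
Local Notation cell j := ([set` `[x j, x j.+1[] : set (measurableTypeR R)).
Local Notation upto j := ([set` `[x 0%N, x j[] : set (measurableTypeR R)).
Let mcell j : measurable (cell j). Proof. exact: measurable_itv. Qed.
Let mupto j : measurable (upto j). Proof. exact: measurable_itv. Qed.

(** The cells with a base point close to [la] carry no mass. *)
Definition step_kernel j : R[i] :=
  if r / 4 <= sqmod ((x j)%:C - la) then ((x j)%:C - la)^-1 else 0.

Lemma cell_dist j (y : R) : cell j y -> (y - x j) ^+ 2 <= de ^+ 2.
Proof.
rewrite /= in_itv /= => /andP[xy yx].
rewrite ler_pXn2r// ?nnegrE ?subr_ge0 ?(ltW de_gt0)// lerBlDl.
by rewrite (le_trans (ltW yx)).
Qed.

Lemma cell_far j (y : R) : cell j y -> r <= sqmod (y%:C - la) ->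
  r / 4 <= sqmod ((x j)%:C - la).
Proof.
move=> /cell_dist yx ry.
have := sqmodD_le ((x j)%:C - la) (y - x j)%:C.
rewrite sqmodC (_ : _ - la + _ = y%:C - la); last by rewrite rmorphB /=; ring.
move: ry yx de_small; set t := (y - x j) ^+ 2; set u := de ^+ 2 => ry yx deS h; lra.
Qed.

Lemma step_kernel_close j (y : R) : cell j y -> ~ near_la y ->
  `|phi (cut_kernel y) - phi (step_kernel j)| <= 2 * de / r.
Proof.
move=> yj /negP; rewrite -leNgt => ry; have rx := cell_far j y yj ry.
rewrite /cut_kernel ry /step_kernel rx -phiB.
rewrite -(ler_pXn2r (n := 2)) ?nnegrE ?divr_ge0 ?mulr_ge0 ?(ltW de_gt0) ?(ltW r_gt0)//.
rewrite real_normK ?num_real//; apply: le_trans (phi_le _) _.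
have sy : 0 < sqmod (y%:C - la) by rewrite (lt_le_trans r_gt0).
have sx : 0 < sqmod ((x j)%:C - la) by rewrite (lt_le_trans _ rx)// divr_gt0.
have y0 : y%:C - la != 0 by rewrite -sqmod_eq0 gt_eqF.
have x0 : (x j)%:C - la != 0 by rewrite -sqmod_eq0 gt_eqF.
have -> : (y%:C - la)^-1 - ((x j)%:C - la)^-1 =
    - (y - x j)%:C * (y%:C - la)^-1 * ((x j)%:C - la)^-1.
  by rewrite rmorphB /=; field; rewrite y0 x0.
rewrite !sqmodM sqmodN sqmodC !sqmodV.
have -> : (2 * de / r) ^+ 2 = de ^+ 2 * r^-1 * (r / 4)^-1.
  by field; rewrite gt_eqF.
apply: ler_pM.
- by apply: mulr_ge0; rewrite ?sqr_ge0 ?invr_ge0 ?sqmod_ge0.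
- by rewrite invr_ge0 sqmod_ge0.
- apply: ler_pM; rewrite ?sqr_ge0 ?invr_ge0 ?sqmod_ge0 ?cell_dist//.
  by rewrite lef_pV2.
- by rewrite lef_pV2// posrE divr_gt0.
Qed.

Lemma step_kernel_integral :
  `|Rintegral mt setT (fun y => phi (y%:C - la)^-1) -
    \sum_(j < m) phi (step_kernel j) * nsq (E (cell j) e0)| <=
  2 * de / r + (1 + r^-1) * nsq (E (~` upto m) e0).
Proof.
rewrite Rintegral_cut_kernel.
have fmt B : measurable B -> fine (mt B) = nsq (E B e0) by exact: fine_mt.
under eq_bigr do rewrite -fmt//.
rewrite -(fmt (~` upto m)); last exact: measurableC.
have e0l := e0_l2.
have est j : (j < m)%N ->
    `|Rintegral mt (cell j) (fun y => phi (cut_kernel y)) -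
      phi (step_kernel j) * fine (mt (cell j))| <= 2 * de / r * fine (mt (cell j)).
  move=> jm.
  pose D := cell j `\` near_la.
  have mD : measurable D by apply: measurableD.
  have Dnull : mt (cell j `&` near_la) = 0%E.
    by apply: subset_measure0 gap => //; apply: measurableI.
  have -> : fine (mt (cell j)) = fine (mt D).
    have mI : measurable (cell j `&` near_la) by apply: measurableI.
    have /esym dU : (mt (cell j `&` near_la `|` D) = mt (cell j `&` near_la) + mt D)%E.
      by rewrite measureU// /D setDE setIACA setICr setI0.
    by move: dU; rewrite Dnull add0e setUIDK => ->.
  have iu B : measurable B -> mt.-integrable B (EFin \o (fun y => phi (cut_kernel y))).
    by move=> mB; apply: integrableS integrable_cut_kernel.
  have -> : Rintegral mt (cell j) (fun y => phi (cut_kernel y)) =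
      Rintegral mt D (fun y => phi (cut_kernel y)).
    by congr fine; apply: negligible_integral => //; apply: iu.
  have ic (k : R) : mt.-integrable D (EFin \o cst k).
    by apply: integrable_const => //; exact: mt_fin.
  rewrite -(Rintegral_cst mt mD (phi _)) -RintegralB//; [|exact: iu|exact: ic].
  have ib : mt.-integrable D (EFin \o (fun y => phi (cut_kernel y) - phi (step_kernel j))).
    rewrite (_ : EFin \o _ = ((EFin \o (fun y => phi (cut_kernel y))) \- (EFin \o cst (phi (step_kernel j))))%E)//.
    by apply: integrableB => //; apply: iu.
  apply: le_trans (le_normr_Rintegral _ ib) _ => //.
  rewrite -Rintegral_cst//; apply: le_Rintegral => //.
  - exact: (integrable_norm ib).
  - exact: ic.
  - by move=> y [yj /= yn]; apply: step_kernel_close.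
have := step_integral_estimate mt x m mt_fin x_mono _ (fun j => phi (step_kernel j))
  (2 * de / r) (1 + r^-1) integrable_cut_kernel est phi_cut_kernel_le.
move=> /le_trans; apply.
rewrite lerD2r; under eq_bigr do rewrite fmt//.
rewrite -(projection_upto_nsq _ _ spA)// ler_piMr//.
  by rewrite divr_ge0 ?mulr_ge0 ?(ltW de_gt0) ?(ltW r_gt0).
by rewrite -nsq_e0 (projection_nsq_le _ _ spA).
Qed.

End real_part.

Section step_vector.
Variables (x : nat -> R) (m : nat) (de : R).
Hypothesis x_mono : {homo x : i j / (i <= j)%N >-> i <= j}.
Hypothesis x_de : forall j, x j.+1 <= x j + de.
Hypothesis de_gt0 : 0 < de.
Hypothesis de_small : 4 * de ^+ 2 <= r.
Local Notation cell j := ([set` `[x j, x j.+1[] : set (measurableTypeR R)).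
Local Notation upto j := ([set` `[x 0%N, x j[] : set (measurableTypeR R)).
Let mcell j : measurable (cell j). Proof. exact: measurable_itv. Qed.
Let mupto j : measurable (upto j). Proof. exact: measurable_itv. Qed.
Let e0l : l2 e0 := e0_l2.

Definition step_piece j : cseq R := fun n => step_kernel x j * E (cell j) e0 n.
(** The image of [e0] under a step function that approximates the Cauchy kernel. *)
Definition step_vector : cseq R := fun n => \sum_(j < m) step_piece j n.

Let pieceE j : step_piece j = E (cell j) (fun n => step_kernel x j * e0 n).
Proof. by rewrite (projectionZ _ _ spA). Qed.

Let piece_l2 j : l2 (step_piece j).
Proof. by apply: l2Z; apply: proj_l2. Qed.

Let piece_proj j : E (cell j) (step_piece j) = step_piece j.
Proof. by rewrite pieceE (projection_idem _ _ spA)//; apply: l2Z. Qed.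

Let piece_dom j : dom A (step_piece j).
Proof.
rewrite pieceE; apply: (dom_projection E A spA _ _ (`|x j| + `|x j.+1|)) => //.
  exact: l2Z.
move=> y /=; rewrite in_itv /= => /andP[xy yx].
rewrite ler_norml; apply/andP; split.
  by have := ler_norm (- x j); rewrite normrN; have := normr_ge0 (x j.+1); lra.
by have := ler_norm (x j.+1); have := normr_ge0 (x j); lra.
Qed.

Lemma step_vector_l2 : l2 step_vector.
Proof. by apply: l2_sum. Qed.

Lemma nsq_step_vector_le S k : measurable S -> 0 <= k ->
  (forall j y, S y -> cell j y -> sqmod (step_kernel x j) <= k) ->
  \sum_(j < m) nsq (E S (step_piece j)) <= k * nsq (E S e0).
Proof.
move=> mS k0 Sk; have Sl : l2 (E S e0) by apply: proj_l2.
apply: (@le_trans _ _ (k * \sum_(j < m) nsq (E (cell j) (E S e0)))); last first.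
  by rewrite -(projection_upto_nsq _ _ spA)// ler_wpM2l// (projection_nsq_le _ _ spA).
rewrite mulr_sumr; apply: ler_sum => j _.
rewrite (projectionZ _ _ spA)//; last exact: proj_l2.
rewrite nsqZ; last by apply: proj_l2 => //; apply: proj_l2.
rewrite (projection_comm _ _ spA S)//.
have [Sj0|/set0P[y [Sy yj]]] := eqVneq (S `&` cell j) set0.
  by rewrite (projection_disjoint _ _ spA S)// 1?setIC// /nsq rdot0l !mulr0.
rewrite ler_wpM2r ?(Sk j y)//; apply: nsq_ge0.
by apply: proj_l2.
Qed.

Lemma nsq_projection_step_vector S k : measurable S -> 0 <= k ->
  (forall j y, S y -> cell j y -> sqmod (step_kernel x j) <= k) ->
  nsq (E S step_vector) <= k * nsq (E S e0).
Proof.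
move=> mS k0 Sk; rewrite (nsq_projection_sum E A spA x m)//.
exact: nsq_step_vector_le.
Qed.

Let far_or_null j : step_kernel x j = ((x j)%:C - la)^-1 /\ (x j)%:C - la != 0 \/
  E (cell j) e0 = fun=> 0.
Proof.
rewrite /step_kernel; case: ifPn => [h|h]; [left|right].
  by rewrite -sqmod_eq0 gt_eqF// (lt_le_trans _ h)// divr_gt0.
apply: nsq_eq0; first exact: proj_l2.
suff : (mt (cell j) <= mt near_la)%E by rewrite gap mt_nsq// lee_fin.
apply: le_measure; rewrite ?inE// => y yj /=.
rewrite ltNge; apply/negP => hy; move/negP: h; apply.
exact: (cell_far x de) yj hy.
Qed.

(** [step_vector] almost solves [J c = la c + e0]; the error is that of
    [step_function_estimate] and the part of [e0] outside the grid. *)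
Lemma step_vector_resolvent : exists h, [/\ l2 h,
  nsq h <= 8 / r * de ^+ 2 + 2 * nsq (E (~` upto m) e0) &
  forall n, J step_vector n = la * step_vector n + 1 * e0 n + h n].
Proof.
have [] := step_function_estimate a b E A actA spA domA_l2 finA x m step_piece
  x_mono (fun j _ => piece_l2 j) (fun j _ => piece_proj j) de de_gt0
  (fun j _ => x_de j) (fun j _ => piece_dom j).
set y := fun n => _ => yl yle.
have mC : measurable (~` upto m) by apply: measurableC.
have Cl : l2 (E (~` upto m) e0) by apply: proj_l2.
have sumle : \sum_(j < m) nsq (step_piece j) <= (r / 4)^-1.
  have := nsq_step_vector_le setT (r / 4)^-1 measurableT.
  rewrite (projection_full _ _ spA)// nsq_e0 mulr1.
  under eq_bigr do rewrite (projection_full _ _ spA)//.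
  apply; first by rewrite invr_ge0 divr_ge0// ltW.
  move=> j z _ _; rewrite /step_kernel; case: ifPn => [h|_].
    by rewrite sqmodV lef_pV2// posrE ?divr_gt0// (lt_le_trans _ h)// divr_gt0.
  by rewrite sqmod0 invr_ge0 divr_ge0// ltW.
exists (fun n => y n - E (~` upto m) e0 n); split.
- exact: l2B.
- apply: le_trans (nsqB_le _ _ yl Cl) _; rewrite lerD2r.
  apply: (@le_trans _ _ (2 * (de ^+ 2 * (r / 4)^-1))).
    by rewrite ler_pM2l// (le_trans yle)// ler_wpM2l// sqr_ge0.
  by rewrite le_eqVlt; apply/orP; left; apply/eqP; field; rewrite gt_eqF.
move=> n; rewrite (projection_setC E A spA)// (projection_upto E A spA x)//.
rewrite /step_vector jacobi_sum /y mulr_sumr.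
rewrite -[LHS](subrK (\sum_(j < m) (x j)%:C * step_piece j n)) -sumrB.
have -> : \sum_(j < m) (x j)%:C * step_piece j n =
    \sum_(j < m) la * step_piece j n + \sum_(j < m) E (cell j) e0 n.
  rewrite -big_split /=; apply: eq_bigr => j _; rewrite /step_piece.
  have [[-> h]| ->] := far_or_null j; last by rewrite !mulr0 addr0.
  by field.
ring.
Qed.

End step_vector.

Let w := stieltjes mt la.

(** [nsq_variation] places a step vector near [c 0 *: P + Q], and [c 0] is a
    Riemann sum for [w].  The last clause records that the projections of [c]
    are bounded by the kernel, uniformly in the mesh. *)
Lemma resolvent_approximation : exists C, forall th, 0 < th -> th <= 1 ->
  exists c, [/\ l2 c, nsq (fun n => w * P n + Q n - c n) <= C * th &
    forall S k, measurable S -> 0 <= k ->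
      (forall u y, S y -> `|y - u| <= 1 -> r / 4 <= sqmod (u%:C - la) ->
        (sqmod (u%:C - la))^-1 <= k) ->
      nsq (E S c) <= k * nsq (E S e0)].
Proof.
set p := nsq P; set q := nsq Q.
have p0 : 0 <= p by apply: nsq_ge0.
have q0 : 0 <= q by apply: nsq_ge0.
pose L := 3 / r + 1.
exists (4 * L ^+ 2 * p + 8 * p * q * (8 / r + 2)) => th th0 th1.
(* The last two bounds give [4 * de ^+ 2 <= r], which keeps the cells that meet
   the support away from [la]. *)
pose de := Order.min th (Order.min 1 (r / 4)).
have de0 : 0 < de by rewrite !lt_min th0 ltr01 divr_gt0.
have deth : de <= th by rewrite ge_min lexx.
have de1 : de <= 1 by rewrite !ge_min lexx orbT.
have der : de <= r / 4 by rewrite !ge_min lexx !orbT.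
have de2 : de ^+ 2 <= de by rewrite expr2 ler_piMr// ltW.
have de_small : 4 * de ^+ 2 <= r by lra.
have [N hN] := mt_tail th th0.
pose x (j : nat) : R := - N%:R + j%:R * de.
pose m := (Num.truncn (2 * N%:R / de)).+1.
have x_mono : {homo x : i j / (i <= j)%N >-> i <= j}.
  by move=> i j ij; rewrite lerD2l ler_pM2r// ler_nat.
have x_de j : x j.+1 <= x j + de.
  by rewrite /x -natr1 mulrDl mul1r addrA.
have xm : N%:R <= x m.
  have : 2 * N%:R / de < m%:R by rewrite /m truncnS_gt.
  rewrite ltr_pdivrMr// /x => /ltW h; lra.
pose U : set (measurableTypeR R) := [set` `[x 0%N, x m[].
have mU : measurable U by apply: measurable_itv.
have hU : nsq (E (~` U) e0) <= th.
  apply: le_trans hN; apply: (projection_nsq_mono _ _ spA).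
  - by apply: measurableC; apply: measurable_itv.
  - exact: measurableC.
  - apply: subsetC => y /=; rewrite /U /= !in_itv /= /x mul0r addr0 => /andP[-> yN].
    by rewrite (lt_le_trans yN).
  - exact: e0_l2.
pose c := step_vector x m.
have cl : l2 c by apply: step_vector_l2.
have [h [hl hle Jc]] := step_vector_resolvent x m de x_mono x_de de0 de_small.
exists c; split => //; last first.
  move=> S k mS k0 Sk; apply: nsq_projection_step_vector => // j y Sy.
  rewrite /= in_itv /= => /andP[xy yx]; rewrite /step_kernel; case: ifPn => [far|_].
    rewrite sqmodV; apply: Sk Sy _ far.
    by rewrite ger0_norm ?subr_ge0// lerBlDl (le_trans (ltW yx))// (le_trans (x_de j))// lerD2l.
  by rewrite sqmod0.
have {}hle : nsq h <= (8 / r + 2) * th.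
  apply: le_trans hle _; rewrite [leRHS]mulrDl; apply: lerD; last by rewrite ler_pM2l.
  by rewrite ler_wpM2l ?divr_ge0 ?(ltW r_gt0)// (le_trans de2).
have [_] := nsq_variation a b a_gt0 la P Q P0 JP Q0 JQ Pl2 Ql2 1 h c hl Jc.
rewrite -/p -/q.
set d := fun n => _ => dle.
have dl : l2 d by apply: l2B => //; apply: l2D; apply: l2Z.
have c0 : c 0%N = \sum_(j < m) step_kernel x j * (nsq (E [set` `[x j, x j.+1[] e0))%:C.
  by apply: eq_bigr => j _; rewrite /step_piece projection_e0_0//; apply: measurable_itv.
have err phi : phi = @Re R \/ phi = @Im R -> `|phi (w - c 0%N)| <= L * th.
  move=> hphi.
  have [phiB phi_le phi_m] : [/\ forall z w, phi (z - w) = phi z - phi w,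
      forall z, phi z ^+ 2 <= sqmod z &
      measurable_fun setT (fun y : measurableTypeR R => phi (y%:C - la)^-1)].
    case: hphi => ->; split.
    - by move=> *; rewrite !ReImE.
    - exact: sqr_Re_le.
    - exact: measurable_Re_kernel.
    - by move=> *; rewrite !ReImE.
    - exact: sqr_Im_le.
    - exact: measurable_Im_kernel.
  have phiw : phi w = Rintegral mt setT (fun y => phi (y%:C - la)^-1).
    by case: hphi => ->.
  have phic : phi (c 0%N) = \sum_(j < m) phi (step_kernel x j) * nsq (E [set` `[x j, x j.+1[] e0).
    rewrite c0; case: hphi => ->; rewrite ?Re_sum ?Im_sum; apply: eq_bigr => j _.
      by rewrite !ReImE mulr0 subr0.
    by rewrite !ReImE mulr0 add0r.
  rewrite phiB phiw phic.
  apply: le_trans (step_kernel_integral phi phiB phi_le phi_m x m de x_mono x_de de0 de_small) _.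
  rewrite -/U /L.
  have r0 : 0 <= r^-1 by rewrite invr_ge0 ltW.
  have h1 : (1 + r^-1) * nsq (E (~` U) e0) <= (1 + r^-1) * th.
    by rewrite ler_wpM2l// addr_ge0.
  have h2 : r^-1 * de <= r^-1 * th by rewrite ler_wpM2l.
  lra.
have wc : sqmod (w - c 0%N) <= 2 * L ^+ 2 * th.
  have L0 : 0 <= L by rewrite addr_ge0// divr_ge0// ltW.
  have sq phi : phi = @Re R \/ phi = @Im R -> phi (w - c 0%N) ^+ 2 <= L ^+ 2 * th.
    move=> /err h1; rewrite -(real_normK (num_real _)).
    apply: (@le_trans _ _ ((L * th) ^+ 2)).
      by rewrite ler_pXn2r// nnegrE mulr_ge0// ltW.
    by rewrite exprMn ler_wpM2l ?sqr_ge0// expr2 ler_piMr// ltW.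
  have h1 := sq _ (or_introl erefl); have h2 := sq _ (or_intror erefl).
  by rewrite /sqmod; lra.
rewrite (_ : (fun n => _) = fun n => (w - c 0%N) * P n - d n); last first.
  by apply/funext => n; rewrite /d; ring.
apply: le_trans (nsqB_le _ _ _ dl) _; first exact: l2Z.
rewrite nsqZ// -/p.
have h1 : sqmod (w - c 0%N) * p <= 2 * L ^+ 2 * th * p by rewrite ler_wpM2r.
have h2 : 4 * p * q * nsq h <= 4 * p * q * ((8 / r + 2) * th).
  by rewrite ler_wpM2l// !mulr_ge0.
rewrite [leRHS]mulrDl; apply: lerD.
  have -> : 4 * L ^+ 2 * p * th = 2 * (2 * L ^+ 2 * th * p) by ring.
  by rewrite ler_pM2l.
have -> : 8 * p * q * (8 / r + 2) * th = 2 * (4 * p * q * ((8 / r + 2) * th)) by ring.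
by rewrite ler_pM2l// (le_trans dle).
Qed.

Lemma l2_resolvent : l2 (fun n => w * P n + Q n).
Proof. by apply: l2D => //; apply: l2Z. Qed.

Lemma nsq_projection_resolvent S k : measurable S -> 0 <= k ->
  (forall u y, S y -> `|y - u| <= 1 -> r / 4 <= sqmod (u%:C - la) ->
    (sqmod (u%:C - la))^-1 <= k) ->
  nsq (E S (fun n => w * P n + Q n)) <= 2 * k * nsq (E S e0).
Proof.
move=> mS k0 Sk; have [C HC] := resolvent_approximation.
rewrite -subr_le0; apply: (@le0_of_small _ _ (2 * C)) => th th0 th1.
have [c [cl cle cS]] := HC th th0 th1.
set v := fun n => _; have vl : l2 v := l2_resolvent.
pose d n := v n - c n.
have dl : l2 d by apply: l2B.
rewrite (_ : v = fun n => d n + c n); last first.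
  by apply/funext => n; rewrite /d subrK.
rewrite (projectionD _ _ spA)// lerBlDr.
apply: le_trans (nsqD_le _ _ _ _) _; [exact: proj_l2..|].
apply: lerD; last by rewrite -mulrA ler_pM2l// cS.
by rewrite -mulrA ler_pM2l// (le_trans _ cle)// (projection_nsq_le _ _ spA).
Qed.

(** On the shell [n <= |y| < n + 1] the squared modulus of the kernel is at most a
    constant over [(n + 1) ^ 2], which compensates the growth of [y ^ 2]. *)
Lemma resolvent_dom : dom A (fun n => w * P n + Q n).
Proof.
set v := fun n => _; have vl : l2 v := l2_resolvent.
have [nu vnu] := scalar_measure_exists _ _ spA _ vl.
apply/(domP _ _ spA v nu vl vnu).
pose F (n : nat) : set (measurableTypeR R) := [set y | n%:R <= `|y| < n.+1%:R].
have mF n : measurable (F n).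
  have := @measurable_realfun.normr_measurable R setT measurableT _ (measurable_itv `[n%:R, n.+1%:R[).
  by rewrite setTI; congr measurable; apply/seteqP; split=> y /=; rewrite in_itv.
have FT : \bigcup_n F n = setT.
  apply/seteqP; split=> // y _; exists (Num.truncn `|y|) => //=.
  exact: truncn_itv.
have tF : trivIset setT F.
  apply/trivIsetP => i j _ _ ij; apply/seteqP; split=> // y [/= /andP[iy yi] /andP[jy yj]].
  move: ij; rewrite neq_ltn => /orP[ij|ij].
    have h : (i.+1%:R : R) <= j%:R by rewrite ler_nat.
    by have := le_lt_trans (le_trans h jy) yi; rewrite ltxx.
  have h : (j.+1%:R : R) <= i%:R by rewrite ler_nat.
  by have := le_lt_trans (le_trans h iy) yj; rewrite ltxx.
(* For [u] at distance at most 1 from the shell, [(n + 1) ^ 2] is at most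
   [4 |u - la|^2 + 4 |la|^2 + 8], and [r / 4 <= |u - la|^2] absorbs the constant. *)
pose K := 4 + (4 * sqmod la + 8) * (4 / r).
have K0 : 0 <= K.
  by rewrite /K addr_ge0// mulr_ge0// ?divr_ge0 ?(ltW r_gt0)// addr_ge0// mulr_ge0 ?sqmod_ge0.
have Fv n : n.+1%:R ^+ 2 * nsq (E (F n) v) <= 2 * K * nsq (E (F n) e0).
  have n0 : 0 < n.+1%:R ^+ 2 :> R by rewrite exprn_gt0// ltr0n.
  have := nsq_projection_resolvent (F n) (K / n.+1%:R ^+ 2) (mF n).
  rewrite -/v => h.
  have -> : 2 * K * nsq (E (F n) e0) =
      n.+1%:R ^+ 2 * (2 * (K / n.+1%:R ^+ 2) * nsq (E (F n) e0)).
    have : n.+1%:R != 0 :> R by rewrite pnatr_eq0.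
    by move: (n.+1%:R : R) (nsq _) => t N t0; field.
  rewrite ler_pM2l//; apply: h; first by rewrite divr_ge0// ltW.
  move=> u y /andP[ny _] yu far.
  set s := sqmod _ in far *.
  have s0 : 0 < s by rewrite (lt_le_trans _ far)// divr_gt0.
  rewrite -[K / _]invrK lef_pV2 ?posrE ?invr_gt0//; last first.
    rewrite divr_gt0// /K ltr_pwDl// mulr_ge0// ?divr_ge0 ?(ltW r_gt0)//.
    by rewrite addr_ge0// mulr_ge0 ?sqmod_ge0.
  have Kgt0 : 0 < K.
    rewrite /K ltr_pwDl// mulr_ge0// ?divr_ge0 ?(ltW r_gt0)//.
    by rewrite addr_ge0// mulr_ge0 ?sqmod_ge0.
  rewrite invf_div ler_pdivrMr//.
  have nu2 : n.+1%:R <= `|u| + 2.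
    rewrite -natr1; have := ler_normD (y - u) u; rewrite subrK.
    lra.
  have h1 : n.+1%:R ^+ 2 <= 2 * u ^+ 2 + 8.
    apply: (@le_trans _ _ ((`|u| + 2) ^+ 2)).
      by rewrite ler_pXn2r// nnegrE ?ler0n// addr_ge0.
    rewrite -(real_normK (num_real u)) -subr_ge0.
    have -> : 2 * `|u| ^+ 2 + 8 - (`|u| + 2) ^+ 2 = (`|u| - 2) ^+ 2 by ring.
    exact: sqr_ge0.
  have h2 : u ^+ 2 <= 2 * s + 2 * sqmod la.
    by have := sqmodD_le (u%:C - la) la; rewrite subrK sqmodC.
  apply: le_trans h1 _.
  apply: (@le_trans _ _ (4 * s + (4 * sqmod la + 8))); first lra.
  have -> : s * K = 4 * s + (4 * sqmod la + 8) * (s * (4 / r)) by rewrite /K; ring.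
  rewrite lerD2l ler_peMr//; first by rewrite addr_ge0// mulr_ge0 ?sqmod_ge0.
  by rewrite mulrA ler_pdivlMr// mul1r; lra.
have msq D : measurable_fun D (fun x : measurableTypeR R => (x ^+ 2)%:E).
  by apply/measurable_EFinP; apply: measurable_funX; apply: measurable_id.
rewrite -FT ge0_integral_bigcup//; last by move=> y _; rewrite lee_fin sqr_ge0.
apply: (@le_lt_trans _ _ (\sum_(0 <= n <oo) ((2 * K)%:E * mt (F n)))%E).
  apply: lee_nneseries => [n _ _|n _].
    by apply: integral_ge0 => y _; rewrite lee_fin sqr_ge0.
  apply: (@le_trans _ _ (\int[nu]_(y in F n) (n.+1%:R ^+ 2)%:E)%E).
    apply: ge0_le_integral => //.
      by move=> y _; rewrite lee_fin sqr_ge0.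
    move=> y /andP[_ /ltW yn]; rewrite lee_fin -(real_normK (num_real y)).
    by rewrite ler_pXn2r// nnegrE.
  rewrite integral_cst// (scalar_measureE _ _ spA v nu)// mt_nsq// -!EFinM lee_fin.
  exact: Fv.
rewrite nneseriesZl => [|n _]; last exact: measure_ge0.
have <- : (mt (\bigcup_n F n) = \sum_(0 <= n <oo) mt (F n))%E.
  by rewrite measure_bigcup//; apply: eq_eseriesl => n; rewrite in_setT.
by rewrite FT lte_mul_pinfty// ?lee_fin ?mulr_ge0// mt_nsq// ltry.
Qed.

End resolvent.
End cyclic_vector.

(** * Orthogonal polynomials of the first and second kind *)

Section complex_integral.
Context {R : realType}.
Variable nu : borel_measure R.
Implicit Types f g : R -> R[i].

Definition cintegrable f :=
  nu.-integrable setT (EFin \o (fun x => Re (f x))) /\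
  nu.-integrable setT (EFin \o (fun x => Im (f x))).

Lemma Re_cintegral f : Re (cintegral nu f) = Rintegral nu setT (fun x => Re (f x)).
Proof. by []. Qed.

Lemma Im_cintegral f : Im (cintegral nu f) = Rintegral nu setT (fun x => Im (f x)).
Proof. by []. Qed.

Lemma Rintegrable_add (u v : R -> R) : nu.-integrable setT (EFin \o u) ->
  nu.-integrable setT (EFin \o v) -> nu.-integrable setT (EFin \o (fun x => u x + v x)).
Proof.
by move=> ui vi; rewrite (_ : EFin \o _ = ((EFin \o u) \+ (EFin \o v))%E)//; apply: integrableD.
Qed.

Lemma Rintegrable_scale (k : R) (u : R -> R) : nu.-integrable setT (EFin \o u) ->
  nu.-integrable setT (EFin \o (fun x => k * u x)).
Proof.
by move=> ui; rewrite (_ : EFin \o _ = (fun x => k%:E * (EFin \o u) x)%E)//; apply: integrableZl.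
Qed.

Lemma cintegrableD f g : cintegrable f -> cintegrable g ->
  cintegrable (fun x => f x + g x).
Proof.
move=> [rf jf] [rg jg]; split.
  under [X in EFin \o X]eq_fun do rewrite Re_add; exact: Rintegrable_add.
under [X in EFin \o X]eq_fun do rewrite Im_add; exact: Rintegrable_add.
Qed.

Lemma cintegralD f g : cintegrable f -> cintegrable g ->
  cintegral nu (fun x => f x + g x) = cintegral nu f + cintegral nu g.
Proof.
move=> [rf jf] [rg jg]; apply: complex_eq.
  rewrite [RHS]Re_add !Re_cintegral.
  by under [X in Rintegral _ _ X]eq_fun do rewrite Re_add; rewrite RintegralD.
rewrite [RHS]Im_add !Im_cintegral.
by under [X in Rintegral _ _ X]eq_fun do rewrite Im_add; rewrite RintegralD.
Qed.

Lemma cintegrableZ (k : R[i]) f : cintegrable f -> cintegrable (fun x => k * f x).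
Proof.
move=> [rf jf]; split.
  under [X in EFin \o X]eq_fun do rewrite Re_mul -mulNr.
  by apply: Rintegrable_add; apply: Rintegrable_scale.
under [X in EFin \o X]eq_fun do rewrite Im_mul.
by apply: Rintegrable_add; apply: Rintegrable_scale.
Qed.

Lemma cintegralZ (k : R[i]) f : cintegrable f ->
  cintegral nu (fun x => k * f x) = k * cintegral nu f.
Proof.
move=> [rf jf]; apply: complex_eq.
  rewrite [RHS]Re_mul !(Re_cintegral, Im_cintegral).
  under [X in Rintegral _ _ X]eq_fun do rewrite Re_mul -mulNr.
  by rewrite RintegralD ?RintegralZl ?mulNr//; apply: Rintegrable_scale.
rewrite [RHS]Im_mul !(Re_cintegral, Im_cintegral).
under [X in Rintegral _ _ X]eq_fun do rewrite Im_mul.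
by rewrite RintegralD ?RintegralZl//; apply: Rintegrable_scale.
Qed.

End complex_integral.

Section moments.
Context {R : realType}.
Variables (s : nat -> R) (nu : borel_measure R).
Hypothesis nus : moment_solutions s nu.

Lemma moment_fin : (nu setT < +oo)%E.
Proof.
have [_ /(_ 0%N)[_]] := nus; under eq_integral do rewrite expr0.
by rewrite integral_cst// mul1e => ->; rewrite ltry.
Qed.

Lemma integrable_horner (f : {poly R}) :
  nu.-integrable setT (EFin \o (fun x : R => f.[x])) /\
  Rintegral nu setT (fun x => f.[x]) = \sum_(i < size f) f`_i * s i.
Proof.
suff key n : nu.-integrable setT (EFin \o (fun x : R => \sum_(i < n) f`_i * x ^+ i)) /\
    Rintegral nu setT (fun x => \sum_(i < n) f`_i * x ^+ i) = \sum_(i < n) f`_i * s i.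
  have [k1 k2] := key (size f); split.
    by under [X in EFin \o X]eq_fun do rewrite horner_coef.
  by under [X in Rintegral _ _ X]eq_fun do rewrite horner_coef.
have xi i : nu.-integrable setT (EFin \o (fun x : R => x ^+ i)).
  by have [_ /(_ i)[]] := nus.
have xs i : Rintegral nu setT (fun x => x ^+ i) = s i.
  by rewrite /Rintegral; have [_ /(_ i)[_ ->]] := nus.
elim: n => [|n [IH1 IH2]].
  rewrite big_ord0; split.
    under [X in EFin \o X]eq_fun do rewrite big_ord0.
    exact: integrable0.
  under [X in Rintegral _ _ X]eq_fun do rewrite big_ord0.
  by rewrite Rintegral_cst// mul0r.
split.
  under [X in EFin \o X]eq_fun do rewrite big_ord_recr.
  by apply: Rintegrable_add => //; apply: Rintegrable_scale.
under [X in Rintegral _ _ X]eq_fun do rewrite big_ord_recr /=.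
by rewrite RintegralD// ?IH2 ?RintegralZl ?xs ?big_ord_recr//; apply: Rintegrable_scale.
Qed.

End moments.

Section cpoly_theory.
Context {R : realType}.
Implicit Types (f g : {poly R}) (z : R[i]).

Lemma cpolyD f g z : cpoly (f + g) z = cpoly f z + cpoly g z.
Proof. by rewrite /cpoly rmorphD hornerD. Qed.

Lemma cpolyZ k f z : cpoly (k *: f) z = k%:C * cpoly f z.
Proof. by rewrite /cpoly map_polyZ hornerZ. Qed.

Lemma cpolyXM f z : cpoly ('X * f) z = z * cpoly f z.
Proof. by rewrite /cpoly mulrC rmorphM /= map_polyX hornerMX mulrC. Qed.

Lemma cpolyC k z : cpoly k%:P z = k%:C.
Proof. by rewrite /cpoly map_polyC hornerC. Qed.

Lemma cpoly_real f (x : R) : cpoly f x%:C = (f.[x])%:C.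
Proof. by rewrite /cpoly horner_map. Qed.

End cpoly_theory.

Section orthogonal_polynomials.
Context {R : realType}.
Variables (s : nat -> R) (mu : borel_measure R) (p : nat -> {poly R}) (a b : nat -> R).
Hypothesis mus : moment_solutions s mu.
Hypothesis on : orthonormal_polynomials mu p.
Hypothesis jac : jacobi_parameters p a b.
Local Notation J := (jacobi_matrix a b).
Local Notation P := (first_kind p).
Local Notation Q := (second_kind mu p).

Lemma p0E : p 0%N = 1. Proof. by case: on. Qed.

Lemma orthonormal_Rintegral nu n m : moment_solutions s nu ->
  Rintegral nu setT (fun x => (p n).[x] * (p m).[x]) = (n == m)%:R.
Proof.
move=> nus; have [_ _ _ /(_ n m) h] := on.
have : Rintegral mu setT (fun x => (p n * p m).[x]) = (n == m)%:R.
  by rewrite /Rintegral; under eq_integral do rewrite hornerM; rewrite h.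
rewrite (integrable_horner s mu mus _).2 -(integrable_horner s nu nus _).2 => <-.
by congr (Rintegral _ _ _); apply/funext => x; rewrite hornerM.
Qed.

Lemma Rintegral_p nu n : moment_solutions s nu ->
  Rintegral nu setT (fun x => (p n).[x]) = (n == 0%N)%:R.
Proof.
move=> nus; rewrite -(orthonormal_Rintegral nu n 0)//.
by congr (Rintegral _ _ _); apply/funext => x; rewrite p0E hornerC mulr1.
Qed.

Lemma first_kind0 z : P z 0%N = 1.
Proof. by rewrite /first_kind p0E cpolyC. Qed.

Lemma jacobi_first_kind z n : J (P z) n = z * P z n.
Proof.
have [_ /(_ n)] := jac; rewrite /jacobi_matrix /first_kind -cpolyXM => ->.
rewrite !cpolyD !cpolyZ; case: n => [|n]; last by rewrite cpolyZ; ring.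
by rewrite cpolyC; ring.
Qed.

Lemma jacobi_real (x : R) n : (if n is m.+1 then a m * (p m).[x] else 0)
  + b n * (p n).[x] + a n * (p n.+1).[x] = x * (p n).[x].
Proof.
have [_ /(_ n)/(congr1 (fun f => f.[x]))] := jac.
rewrite mulrC hornerMX mulrC => ->; rewrite !hornerD !hornerZ.
by case: n => [|n]; rewrite ?hornerZ ?horner0; ring.
Qed.

(** The difference quotient [(p_n(z) - p_n(x)) / (z - x)]. *)
Definition diffquo n (z : R[i]) (x : R) : R[i] :=
  cpoly ((p n - (p n).[x]%:P) %/ ('X - x%:P)) z.

Lemma diffquo0 z x : diffquo 0 z x = 0.
Proof. by rewrite /diffquo p0E hornerC subrr div0p cpolyC. Qed.

(** Subtract the recurrence at [x] from the one at the variable, and divide by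
    ['X - x]. *)
Lemma diffquo_rec n z x :
  (if n is m.+1 then (a m)%:C * diffquo m z x else 0)
   + (b n)%:C * diffquo n z x + (a n)%:C * diffquo n.+1 z x =
  z * diffquo n z x + ((p n).[x])%:C.
Proof.
pose D n := (p n - (p n).[x]%:P) %/ ('X - x%:P).
have DE k : p k = D k * ('X - x%:P) + (p k).[x]%:P.
  rewrite /D divpK ?subrK// dvdp_XsubCl rootE !hornerE subrr//.
have nz : 'X - x%:P != 0 :> {poly R} by rewrite polyXsubC_eq0.
suff : (if n is m.+1 then a m *: D m else 0) + b n *: D n + a n *: D n.+1 =
    'X * D n + (p n).[x]%:P.
  move=> /(congr1 (fun f => cpoly f z)); rewrite !cpolyD !cpolyZ cpolyXM cpolyC.
  by case: n => [|n]; rewrite ?cpolyZ ?cpolyC.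
have DX k : D k * ('X - x%:P) = p k - (p k).[x]%:P by rewrite [X in _ = X - _]DE addrK.
apply: (mulIf nz); have [_ /(_ n) h1] := jac.
have /(congr1 polyC) h2 := jacobi_real x n.
transitivity ('X * p n - (x * (p n).[x])%:P).
  rewrite h1 -h2 !mulrDl -!scalerAl !DX !rmorphD !rmorphM /= !scalerBr -!mul_polyC.
  by case: n {h1 h2} => [|n]; rewrite ?mul0r -?scalerAl ?DX -?mul_polyC ?rmorphM /=; ring.
rewrite mulrDl -mulrA DX rmorphM /=; ring.
Qed.

(** Polynomial functions of a real variable with complex coefficients, given by
    their real and imaginary parts; the difference quotients are of this kind
    in [x], which makes them integrable. *)
Definition is_cpoly_fun (f : R -> R[i]) := exists U V : {poly R},
  forall x, Re (f x) = U.[x] /\ Im (f x) = V.[x].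

Lemma is_cpoly_funD f g : is_cpoly_fun f -> is_cpoly_fun g ->
  is_cpoly_fun (fun x => f x + g x).
Proof.
move=> [U [V fE]] [U' [V' gE]]; exists (U + U'), (V + V') => x.
by rewrite Re_add Im_add !hornerD; have [-> ->] := fE x; have [-> ->] := gE x.
Qed.

Lemma is_cpoly_funZ k f : is_cpoly_fun f -> is_cpoly_fun (fun x => k * f x).
Proof.
move=> [U [V fE]].
exists (Re k *: U - Im k *: V), (Re k *: V + Im k *: U) => x.
by rewrite Re_mul Im_mul !hornerE; have [-> ->] := fE x.
Qed.

Lemma is_cpoly_fun_horner (f : {poly R}) : is_cpoly_fun (fun x => (f.[x])%:C).
Proof. by exists f, 0 => x; rewrite horner0. Qed.

Lemma cintegrable_cpoly nu f : moment_solutions s nu -> is_cpoly_fun f ->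
  cintegrable nu f.
Proof.
move=> nus [U [V fE]]; split.
  under [X in EFin \o X]eq_fun do rewrite (fE _).1.
  exact: (integrable_horner s nu nus U).1.
under [X in EFin \o X]eq_fun do rewrite (fE _).2.
exact: (integrable_horner s nu nus V).1.
Qed.

Let a_neq0 n : (a n)%:C != 0 :> R[i].
Proof. by rewrite eq_complex /= eqxx andbT gt_eqF//; case: jac. Qed.

Lemma is_cpoly_fun_diffquo z n : is_cpoly_fun (diffquo n z).
Proof.
suff: is_cpoly_fun (diffquo n z) /\ is_cpoly_fun (diffquo n.+1 z) by case.
have zero : is_cpoly_fun (fun=> 0) by exists 0, 0 => x; rewrite horner0.
have step m : is_cpoly_fun (fun x => if m is k.+1 then (a k)%:C * diffquo k z x else 0) ->
    is_cpoly_fun (diffquo m z) -> is_cpoly_fun (diffquo m.+1 z).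
  move=> hp hm.
  have -> : diffquo m.+1 z = fun x => (a m)%:C^-1 * (((p m).[x])%:C +
      (z - (b m)%:C) * diffquo m z x +
      -1 * (if m is k.+1 then (a k)%:C * diffquo k z x else 0)).
    apply/funext => x; apply: (mulfI (a_neq0 m)); rewrite mulVKf//.
    have := diffquo_rec m z x; set t := (if m is k.+1 then _ else _).
    by move=> h; apply: (addrI (t + (b m)%:C * diffquo m z x)); rewrite h; ring.
  apply: is_cpoly_funZ; apply: is_cpoly_funD; last exact: is_cpoly_funZ.
  by apply: is_cpoly_funD; [exact: is_cpoly_fun_horner|exact: is_cpoly_funZ].
have d0 : is_cpoly_fun (diffquo 0 z).
  by rewrite (_ : diffquo 0 z = fun=> 0)//; apply/funext => x; rewrite diffquo0.
elim: n => [|n [IH1 IH2]]; first by split=> //; apply: step.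
by split=> //; apply: step => //; apply: is_cpoly_funZ.
Qed.

Lemma second_kind0 z : Q z 0%N = 0.
Proof.
rewrite /second_kind (_ : (fun x => _) = fun=> 0); last first.
  by apply/funext => x; apply: diffquo0.
by apply: complex_eq; rewrite ?Re_cintegral ?Im_cintegral Rintegral_cst// mul0r.
Qed.

Lemma cintegral_p nu n : moment_solutions s nu ->
  cintegral nu (fun x => ((p n).[x])%:C) = (e0 n : R[i]).
Proof.
move=> nus; apply: complex_eq; rewrite ?Re_cintegral ?Im_cintegral.
  by rewrite (Rintegral_p nu n nus) /e0; case: n.
by rewrite Rintegral_cst// mul0r /e0; case: n.
Qed.

(** Integrate [diffquo_rec]: as [p 0 = 1], the integral of [p n] is [e0 n]. *)
Lemma jacobi_second_kind z n : J (Q z) n = z * Q z n + e0 n.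
Proof.
have di k : cintegrable mu (diffquo k z).
  by apply: cintegrable_cpoly => //; apply: is_cpoly_fun_diffquo.
have dZ k c : cintegrable mu (fun x => c * diffquo k z x) by apply: cintegrableZ.
have QE k : Q z k = cintegral mu (diffquo k z) by [].
rewrite -(cintegral_p mu n mus) QE -cintegralZ// -cintegralD//; last first.
  by apply: cintegrable_cpoly => //; apply: is_cpoly_fun_horner.
under [X in _ = cintegral _ X]eq_fun do rewrite -diffquo_rec.
rewrite /jacobi_matrix !QE; case: n => [|n].
  rewrite -(cintegralZ _ _ _ (di 0%N)) -(cintegralZ _ _ _ (di 1%N)) add0r.
  rewrite -(cintegralD _ _ _ (dZ 0%N _) (dZ 1%N _)); congr cintegral.
  by apply/funext => x; rewrite add0r.
rewrite -(cintegralZ _ _ _ (di n)) -(cintegralZ _ _ _ (di n.+1)).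
rewrite -(cintegralZ _ _ _ (di n.+2)) -(cintegralD _ _ _ (dZ n _) (dZ n.+1 _)).
by rewrite -(cintegralD _ _ _ (cintegrableD _ _ _ (dZ n _) (dZ n.+1 _)) (dZ n.+2 _)).
Qed.

End orthogonal_polynomials.

(** * Weyl solutions and the Bessel inequality *)

Section bessel.
Context {R : realType}.
Variables (s : nat -> R) (mu nu : borel_measure R) (p : nat -> {poly R}).
Hypothesis mus : moment_solutions s mu.
Hypothesis nus : moment_solutions s nu.
Hypothesis on : orthonormal_polynomials mu p.

Lemma measurable_horner (f : {poly R}) :
  measurable_fun setT (fun x : measurableTypeR R => f.[x]).
Proof.
have [h _] := integrable_horner s nu nus f.
by apply/measurable_EFinP; apply: measurable_int h.
Qed.

Lemma integrable_bounded_horner (u : R -> R) (M : R) (f : {poly R}) :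
  measurable_fun setT (u : measurableTypeR R -> R) -> (forall x, `|u x| <= M) ->
  nu.-integrable setT (EFin \o (fun x => u x * f.[x])).
Proof.
move=> mu' uM; apply: (@integrable_dominated _ _ _ (fun x => M * `|f.[x]|)).
- by apply: measurable_funM => //; apply: measurable_horner.
- by move=> x; rewrite normrM ler_wpM2r.
have [h _] := integrable_horner s nu nus f.
refine (Rintegrable_scale nu M (fun x => `|f.[x]|) _).
exact: (integrable_norm h).
Qed.

Definition weight (h : R -> R) :=
  forall f : {poly R}, nu.-integrable setT (EFin \o (fun x => h x * f.[x])).

Lemma weight_sum (h : R -> R) (c : nat -> R) N : weight h ->
  Rintegral nu setT (fun x => h x * (\sum_(k < N) c k *: p k).[x]) =
  \sum_(k < N) c k * Rintegral nu setT (fun x => h x * (p k).[x]).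
Proof.
move=> hw; elim: N => [|N IH].
  rewrite !big_ord0; under [X in Rintegral _ _ X]eq_fun do rewrite horner0 mulr0.
  by rewrite Rintegral_cst// mul0r.
rewrite !big_ord_recr /= -IH -RintegralZl// -RintegralD//; last first.
  by apply: Rintegrable_scale; apply: hw.
by congr (Rintegral _ _ _); apply/funext => x; rewrite hornerD hornerZ; ring.
Qed.

Lemma weight_horner (f : {poly R}) : weight (fun x => f.[x]).
Proof.
move=> g; have [h _] := integrable_horner s nu nus (f * g).
by under [X in EFin \o X]eq_fun do rewrite -hornerM.
Qed.

Lemma bessel (u : R -> R) (M : R) (N : nat) :
  measurable_fun setT (u : measurableTypeR R -> R) -> (forall x, `|u x| <= M) ->
  \sum_(k < N) Rintegral nu setT (fun x => u x * (p k).[x]) ^+ 2 <=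
  Rintegral nu setT (fun x => u x * u x).
Proof.
move=> mu' uM; pose c k := Rintegral nu setT (fun x => u x * (p k).[x]).
have uw : weight u by move=> f; apply: integrable_bounded_horner mu' uM.
set g := \sum_(k < N) c k *: p k.
have uu : nu.-integrable setT (EFin \o (fun x => u x * u x)).
  apply: (@integrable_bounded _ _ (moment_fin s nu nus) _ (M * M)).
    exact: measurable_funM.
  by move=> x; rewrite normrM ler_pM.
have pc k : (k < N)%N -> Rintegral nu setT (fun x => (p k).[x] * g.[x]) = c k.
  move=> kN; rewrite weight_sum; last exact: weight_horner.
  rewrite (bigD1 (Ordinal kN))//= (orthonormal_Rintegral s mu p mus on nu k k nus) eqxx mulr1.
  rewrite big1 ?addr0// => i ik.
  rewrite (orthonormal_Rintegral s mu p mus on nu k i nus).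
  have -> : (k == i) = false by apply: contraNF ik => /eqP h; apply/eqP/val_inj.
  by rewrite mulr0.
have gg : Rintegral nu setT (fun x => g.[x] * g.[x]) = \sum_(k < N) c k ^+ 2.
  rewrite [LHS]weight_sum; last exact: weight_horner.
  apply: eq_bigr => k _; rewrite expr2; congr (_ * _); rewrite -(pc k)//.
  by congr (Rintegral _ _ _); apply/funext => x; rewrite mulrC.
have ug : Rintegral nu setT (fun x => u x * g.[x]) = \sum_(k < N) c k ^+ 2.
  by rewrite [LHS]weight_sum//; apply: eq_bigr => k _; rewrite expr2.
have : 0 <= Rintegral nu setT (fun x => (u x - g.[x]) ^+ 2).
  by apply: Rintegral_ge0 => x _; apply: sqr_ge0.
rewrite (_ : (fun x => _) = (fun x => u x * u x + ((-2) * (u x * g.[x]) + g.[x] * g.[x]))); last first.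
  by apply/funext => x; ring.
have iug : nu.-integrable setT (EFin \o (fun x => u x * g.[x])) by apply: uw.
have igg := weight_horner g g.
rewrite RintegralD//; last by apply: Rintegrable_add => //; apply: Rintegrable_scale.
rewrite RintegralD//; last exact: Rintegrable_scale.
rewrite RintegralZl// gg ug -/c; lra.
Qed.

Variables (a b : nat -> R) (z : R[i]).
Hypothesis jac : jacobi_parameters p a b.
Hypothesis z_nonreal : Im z != 0.

Lemma sqmod_sub_nonreal (x : R) : Im z ^+ 2 <= sqmod (x%:C - z).
Proof. by have := sqr_Im_le (x%:C - z); rewrite Im_add Im_opp Im_real sub0r sqrrN. Qed.

Lemma sqmod_kernel_le (x : R) : sqmod (x%:C - z)^-1 <= (Im z ^+ 2)^-1.
Proof.
have z0 : 0 < Im z ^+ 2 by rewrite exprn_even_gt0.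
by rewrite sqmodV lef_pV2 ?posrE ?sqmod_sub_nonreal// (lt_le_trans z0)// sqmod_sub_nonreal.
Qed.

Lemma Re_kernel_le (x : R) : `|Re (x%:C - z)^-1| <= 1 + (Im z ^+ 2)^-1.
Proof. by apply: abs_le_of_sq; apply: le_trans (sqr_Re_le _) (sqmod_kernel_le _). Qed.

Lemma Im_kernel_le (x : R) : `|Im (x%:C - z)^-1| <= 1 + (Im z ^+ 2)^-1.
Proof. by apply: abs_le_of_sq; apply: le_trans (sqr_Im_le _) (sqmod_kernel_le _). Qed.

(** The Fourier coefficients of the Cauchy kernel at [z]. *)
Definition kernel_coef : cseq R :=
  fun n => cintegral nu (fun x => (x%:C - z)^-1 * ((p n).[x])%:C).

Let kernel_poly (f : {poly R}) : cintegrable nu (fun x => (x%:C - z)^-1 * (f.[x])%:C).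
Proof.
split.
  under [X in EFin \o X]eq_fun do rewrite Re_mul Im_real mulr0 subr0.
  exact: integrable_bounded_horner (measurable_Re_kernel z) Re_kernel_le.
under [X in EFin \o X]eq_fun do rewrite Im_mul Im_real mulr0 add0r.
exact: integrable_bounded_horner (measurable_Im_kernel z) Im_kernel_le.
Qed.

Lemma l2_kernel_coef : l2 kernel_coef.
Proof.
apply/l2P; exists (Rintegral nu setT (fun x => Re (x%:C - z)^-1 * Re (x%:C - z)^-1) +
  Rintegral nu setT (fun x => Im (x%:C - z)^-1 * Im (x%:C - z)^-1)) => N.
have br := bessel _ _ N (measurable_Re_kernel z) Re_kernel_le.
have bi := bessel _ _ N (measurable_Im_kernel z) Im_kernel_le.
apply: le_trans (lerD br bi); rewrite -big_split /=; apply: ler_sum => k _.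
rewrite /sqmod /kernel_coef Re_cintegral Im_cintegral.
under [X in Rintegral _ _ X ^+ 2 + _]eq_fun do rewrite Re_mul Im_real mulr0 subr0.
by under [X in _ + Rintegral _ _ X ^+ 2]eq_fun do rewrite Im_mul Im_real mulr0 add0r.
Qed.

(** From [x / (x - z) = z / (x - z) + 1] and the orthogonality of [p n] to 1. *)
Lemma jacobi_kernel_coef n :
  jacobi_matrix a b kernel_coef n = z * kernel_coef n + e0 n.
Proof.
have i k := kernel_poly (p k); have iZ k c := cintegrableZ nu c _ (i k).
rewrite -(cintegral_p s mu p mus on nu n nus) -(cintegralZ _ _ _ (i n)).
have pint : cintegrable nu (fun x => ((p n).[x])%:C).
  by apply: (cintegrable_cpoly s) => //; apply: is_cpoly_fun_horner.
rewrite -(cintegralD _ _ _ (iZ n z) pint).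
have xz (x : R) : x%:C - z != 0.
  by rewrite -sqmod_eq0 gt_eqF// (lt_le_trans _ (sqmod_sub_nonreal x))// exprn_even_gt0.
have E x : z * ((x%:C - z)^-1 * ((p n).[x])%:C) + ((p n).[x])%:C =
    (x%:C - z)^-1 * (x * (p n).[x])%:C.
  by rewrite rmorphM /=; field; exact: xz.
under [X in _ = cintegral _ X]eq_fun do rewrite E -(jacobi_real p a b jac).
rewrite /jacobi_matrix /kernel_coef; case: n {pint E} => [|n].
  rewrite -(cintegralZ _ _ _ (i 0%N)) -(cintegralZ _ _ _ (i 1%N)) add0r.
  rewrite -(cintegralD _ _ _ (iZ 0%N _) (iZ 1%N _)); congr cintegral.
  by apply/funext => x; rewrite add0r rmorphD !rmorphM /=; ring.
rewrite -(cintegralZ _ _ _ (i n)) -(cintegralZ _ _ _ (i n.+1)).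
rewrite -(cintegralZ _ _ _ (i n.+2)) -(cintegralD _ _ _ (iZ n _) (iZ n.+1 _)).
rewrite -(cintegralD _ _ _ (cintegrableD _ _ _ (iZ n _) (iZ n.+1 _)) (iZ n.+2 _)).
by congr cintegral; apply/funext => x; rewrite !rmorphD !rmorphM /=; ring.
Qed.

(** The Weyl solution is the sequence of Fourier coefficients of the kernel. *)
Lemma l2_weyl_solution :
  l2 (fun n => stieltjes nu z * first_kind p z n + second_kind mu p z n).
Proof.
rewrite (_ : (fun n => _) = kernel_coef); first exact: l2_kernel_coef.
have a0 : forall n, 0 < a n by case: jac.
apply: (jacobi_unique a b a0 z e0).
- rewrite (first_kind0 mu)// (second_kind0 mu p on) mulr1 addr0.
  by congr cintegral; apply/funext => x; rewrite (p0E mu)// hornerC rmorph1 mulr1.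
- move=> n; rewrite jacobiD jacobiZ (jacobi_first_kind p a b jac).
  by rewrite (jacobi_second_kind s mu p a b mus on jac); ring.
- exact: jacobi_kernel_coef.
Qed.

End bessel.

(** * Injectivity of the Stieltjes transform *)

Section stieltjes_uniqueness.
Context {R : realType}.
Implicit Types (f g : R -> R[i]) (z : R[i]).

Definition cbounded f :=
  [/\ measurable_fun setT ((fun x => Re (f x)) : measurableTypeR R -> R),
      measurable_fun setT ((fun x => Im (f x)) : measurableTypeR R -> R) &
      exists M, forall x, sqmod (f x) <= M].

Lemma cboundedM f g : cbounded f -> cbounded g -> cbounded (fun x => f x * g x).
Proof.
move=> [rf jf [M fM]] [rg jg [N gN]]; split.
- under eq_fun do rewrite Re_mul.
  by apply: measurable_funB; apply: measurable_funM.
- under eq_fun do rewrite Im_mul.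
  by apply: measurable_funD; apply: measurable_funM.
by exists (M * N) => x; rewrite sqmodM ler_pM ?sqmod_ge0.
Qed.

Lemma cbounded_cst (k : R[i]) : cbounded (fun=> k).
Proof. by split; [exact: measurable_cst..|exists (sqmod k)]. Qed.

Lemma cbounded_kernel z : Im z != 0 -> cbounded (fun x => (x%:C - z)^-1).
Proof.
move=> z0; split; [exact: measurable_Re_kernel|exact: measurable_Im_kernel|].
by exists (Im z ^+ 2)^-1 => x; apply: sqmod_kernel_le.
Qed.

Definition kernel_prod (zs : seq R[i]) (x : R) : R[i] :=
  \prod_(z <- zs) (x%:C - z)^-1.

Lemma cbounded_kernel_prod zs : (forall z, z \in zs -> Im z != 0) ->
  cbounded (kernel_prod zs).
Proof.
elim: zs => [|z zs IH] h.
  rewrite (_ : kernel_prod _ = fun=> 1); first exact: cbounded_cst.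
  by apply/funext => x; rewrite /kernel_prod big_nil.
rewrite (_ : kernel_prod _ = fun x => (x%:C - z)^-1 * kernel_prod zs x).
  apply: cboundedM; first by apply: cbounded_kernel; apply: h; rewrite mem_head.
  by apply: IH => y yz; apply: h; rewrite inE yz orbT.
by apply/funext => x; rewrite /kernel_prod big_cons.
Qed.

Lemma cintegrable_cbounded (nu : borel_measure R) f : (nu setT < +oo)%E ->
  cbounded f -> cintegrable nu f.
Proof.
move=> nf [rf jf [M fM]]; split.
  apply: (@integrable_bounded _ nu nf _ (1 + M)) => // x.
  by apply: abs_le_of_sq; apply: le_trans (sqr_Re_le _) (fM x).
apply: (@integrable_bounded _ nu nf _ (1 + M)) => // x.
by apply: abs_le_of_sq; apply: le_trans (sqr_Im_le _) (fM x).
Qed.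

Variables (s1 s2 : borel_measure R).
Hypothesis s1_fin : (s1 setT < +oo)%E.
Hypothesis s12 : s1 setT = s2 setT.
Hypothesis same_stieltjes : forall z, Im z != 0 -> stieltjes s1 z = stieltjes s2 z.

Let s2_fin : (s2 setT < +oo)%E. Proof. by rewrite -s12. Qed.

Lemma kernel_prod_split z1 z2 zs (x : R) : z1 != z2 -> Im z1 != 0 -> Im z2 != 0 ->
  kernel_prod (z1 :: z2 :: zs) x =
  (z1 - z2)^-1 * (kernel_prod (z1 :: zs) x + -1 * kernel_prod (z2 :: zs) x).
Proof.
move=> z12 h1 h2; rewrite /kernel_prod !big_cons.
have n0 z : Im z != 0 -> x%:C - z != 0.
  by move=> h; apply: contra_neq h => /eqP; rewrite subr_eq0 => /eqP <-.
have n1 := n0 _ h1; have n2 := n0 _ h2; have n3 : z1 - z2 != 0 by rewrite subr_eq0.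
by field; rewrite n1 n2 n3.
Qed.

(** Partial fractions: a product of simple nonreal poles is in the linear span
    of the Cauchy kernels, so both measures integrate it alike. *)
Lemma cintegral_kernel_prod zs : uniq zs -> (forall z, z \in zs -> Im z != 0) ->
  cintegral s1 (kernel_prod zs) = cintegral s2 (kernel_prod zs).
Proof.
have [n] := ubnP (size zs); elim: n zs => // n IH [|z1 [|z2 zs]] /=.
- move=> _ _ _; rewrite (_ : kernel_prod _ = fun=> 1).
    apply: complex_eq; rewrite !(Re_cintegral, Im_cintegral) !Rintegral_cst//;
      by rewrite s12.
  by apply/funext => x; rewrite /kernel_prod big_nil.
- move=> _ _ h; rewrite (_ : kernel_prod _ = fun x => (x%:C - z1)^-1).
    by apply: same_stieltjes; apply: h; rewrite mem_head.
  by apply/funext => x; rewrite /kernel_prod big_cons big_nil mulr1.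
rewrite !ltnS inE negb_or => sz /and3P[/andP[z12 z1s] z2s us] h.
have h1 : Im z1 != 0 by apply: h; rewrite mem_head.
have h2 : Im z2 != 0 by apply: h; rewrite !inE eqxx orbT.
have hs z : z \in zs -> Im z != 0 by move=> zz; apply: h; rewrite !inE zz !orbT.
have hc z0 : Im z0 != 0 -> forall z, z \in z0 :: zs -> Im z != 0.
  by move=> h0 z; rewrite inE => /orP[/eqP ->//|/hs].
have -> : kernel_prod [:: z1, z2 & zs] = fun x =>
    (z1 - z2)^-1 * (kernel_prod (z1 :: zs) x + -1 * kernel_prod (z2 :: zs) x).
  by apply/funext => x; apply: kernel_prod_split.
have ci (nu : borel_measure R) z0 : (nu setT < +oo)%E -> Im z0 != 0 ->
    cintegrable nu (kernel_prod (z0 :: zs)).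
  by move=> nf h0; apply: cintegrable_cbounded => //; apply: cbounded_kernel_prod; apply: hc.
have E (nu : borel_measure R) : (nu setT < +oo)%E ->
    cintegral nu (fun x => (z1 - z2)^-1 * (kernel_prod (z1 :: zs) x + -1 * kernel_prod (z2 :: zs) x))
    = (z1 - z2)^-1 * (cintegral nu (kernel_prod (z1 :: zs)) + -1 * cintegral nu (kernel_prod (z2 :: zs))).
  move=> nf; have c1 := ci nu z1 nf h1; have c2 := ci nu z2 nf h2.
  have c3 := cintegrableZ nu (-1) _ c2.
  by rewrite (cintegralZ _ _ _ (cintegrableD _ _ _ c1 c3)) (cintegralD _ _ _ c1 c3) (cintegralZ _ _ _ c2).
rewrite !E//; congr (_ * (_ + _ * _)); apply: IH => //=.
- by rewrite z1s.
- exact: hc.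
- by rewrite z2s.
- exact: hc.
Qed.

(** A rational approximation of the indicator of a neighbourhood of [c]. *)
Definition plateau (c k : R) (m : nat) (x : R) : R := (1 + k * (x - c) ^+ m.+1.*2)^-1.

Lemma plateau_pos (c k x : R) m : 0 < k -> 0 < 1 + k * (x - c) ^+ m.+1.*2.
Proof.
move=> k0; rewrite ltr_pwDl// mulr_ge0// ?(ltW k0)//.
by rewrite exprn_even_ge0// odd_double.
Qed.

(** The poles are simple, because the denominator is coprime to its derivative,
    a multiple of a power of [x - c]; they are nonreal, because the denominator
    is positive on the line. *)
Lemma plateau_kernel_prod (c k : R) (m : nat) : 0 < k -> exists zs (al : R[i]),
  [/\ uniq zs, forall z, z \in zs -> Im z != 0 &
      forall x, (plateau c k m x)%:C = al * kernel_prod zs x].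
Proof.
move=> k0.
pose S : {poly R[i]} := k%:C *: ('X - (c%:C)%:P) ^+ m.+1.*2 + 1.
have Sx x : S.[x%:C] = (1 + k * (x - c) ^+ m.+1.*2)%:C.
  by rewrite /S hornerD hornerZ horner_exp hornerXsubC hornerC addrC rmorphD rmorphM rmorphXn rmorphB rmorph1.
have [zs SE] := closed_field_poly_normal S.
have lS : lead_coef S != 0.
  rewrite lead_coef_eq0; apply/eqP => S0.
  have := Sx c; rewrite S0 horner0 subrr expr0n /= mulr0 addr0 => /eqP.
  by rewrite eq_sym rmorph1 oner_eq0.
have kC0 : k%:C != 0 by rewrite eq_complex /= eqxx andbT gt_eqF.
have cop : coprimep S S^`().
  apply/Bezout_eq1_coprimepP.
  pose q : {poly R[i]} := 'X - (c%:C)%:P; pose N := m.+1.*2.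
  exists (1, - (N%:R^-1 *: q)) => /=.
  have N0 : N%:R != 0 :> R[i] by rewrite pnatr_eq0.
  have -> : S^`() = k%:C *: (q ^+ N.-1 *+ N).
    by rewrite /S derivD derivZ deriv_exp derivXsubC mul1r derivC addr0.
  have key : (N%:R^-1 *: q) * (k%:C *: (q ^+ N.-1 *+ N)) = k%:C *: q ^+ N.
    rewrite -scalerAl -scalerAr mulrnAr -exprS -(scaler_nat N (q ^+ _)) !scalerA.
    by congr (_ *: _); move: (N%:R) N0 => t t0; field.
  by rewrite mul1r mulNr key /S addrAC subrr add0r.
have us : uniq zs.
  rewrite -separable_prod_XsubC.
  have : separable.separable_poly S by rewrite separable.separable_poly.unlock.
  by rewrite {1}SE; rewrite (separable.eqp_separable (eqp_scale _ lS)).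
have Sn0 x : S.[x%:C] != 0 by rewrite Sx eq_complex /= eqxx andbT gt_eqF// plateau_pos.
exists zs, (lead_coef S)^-1; split=> //.
  move=> z zzs; apply/negP => /eqP z0; have := Sn0 (Re z).
  have -> : (Re z)%:C = z by apply: complex_eq.
  have /rootP zr : root (\prod_(z <- zs) ('X - z%:P)) z by rewrite root_prod_XsubC.
  by rewrite SE hornerZ zr mulr0 eqxx.
move=> x; rewrite /plateau fmorphV /= -Sx {1}SE hornerZ horner_prod invfM.
congr (_ * _); rewrite /kernel_prod -prodfV; apply: eq_bigr => z _.
by rewrite hornerXsubC.
Qed.

Lemma Rintegral_plateau (c k : R) (m : nat) : 0 < k ->
  Rintegral s1 setT (plateau c k m) = Rintegral s2 setT (plateau c k m).
Proof.
move=> k0; have [zs [al [us zsn E]]] := plateau_kernel_prod c k m k0.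
have RE (nu : borel_measure R) : (nu setT < +oo)%E ->
    Rintegral nu setT (plateau c k m) = Re (al * cintegral nu (kernel_prod zs)).
  move=> nf; rewrite -cintegralZ; last first.
    by apply: cintegrable_cbounded => //; apply: cbounded_kernel_prod.
  by rewrite Re_cintegral; congr (Rintegral _ _ _); apply/funext => x; rewrite -E.
by rewrite !RE// cintegral_kernel_prod.
Qed.

Lemma bernoulli_le (u : R) n : 0 <= u -> 1 + n%:R * u <= (1 + u) ^+ n.
Proof.
move=> u0; elim: n => [|n IH]; first by rewrite mul0r addr0 expr0.
rewrite exprS; apply: (@le_trans _ _ ((1 + u) * (1 + n%:R * u))); last first.
  by rewrite ler_wpM2l// addr_ge0.
rewrite -natr1 -subr_ge0 (_ : _ - _ = n%:R * u ^+ 2); last by ring.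
by rewrite mulr_ge0 ?sqr_ge0.
Qed.

(** With centre [b + k] and radius [k], the plateau tends to the half-line from
    [b] on; the exponent grows like [k ^ 2] to make the edge at the fixed point [b]
    steep, and the factor [k^-1] brings the value at [b] itself to 1. *)
Definition halfline_plateau (b : R) (n : nat) : R -> R :=
  let m := (n.+1 * n.+1)%N.-1 in
  plateau (b + n.+1%:R) (n.+1%:R^-1 * n.+1%:R^-1 ^+ m.+1.*2) m.

Let k_gt0 n : 0 < n.+1%:R :> R. Proof. by rewrite ltr0n. Qed.

Lemma halfline_plateauE b n x : halfline_plateau b n x =
  (1 + n.+1%:R^-1 * ((x - b) / n.+1%:R - 1) ^+ (n.+1 * n.+1).*2)^-1.
Proof.
rewrite /halfline_plateau /plateau -mulrA -exprMn; congr (1 + _ * _ ^+ _)^-1.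
have := k_gt0 n; move: (n.+1%:R : R) => k k0; field; rewrite gt_eqF//.
Qed.

Lemma halfline_plateau_bounds b n x : 0 <= halfline_plateau b n x <= 1.
Proof.
have h : 1 <= 1 + n.+1%:R^-1 * ((x - b) / n.+1%:R - 1) ^+ (n.+1 * n.+1).*2.
  by rewrite lerDl mulr_ge0 ?invr_ge0 ?ler0n// exprn_even_ge0// odd_double.
have h0 := lt_le_trans ltr01 h.
by rewrite halfline_plateauE invr_ge0 (ltW h0) invf_le1.
Qed.

Lemma halfline_plateau_in b n x : b <= x -> x - b <= 2 * n.+1%:R ->
  1 - halfline_plateau b n x <= n.+1%:R^-1.
Proof.
move=> bx xb; rewrite halfline_plateauE.
set N := (n.+1 * n.+1).*2; set t := (x - b) / n.+1%:R - 1.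
have t1 : `|t| <= 1.
  rewrite ler_norml; apply/andP; split.
    by rewrite /t -subr_ge0 opprK subrK divr_ge0 ?subr_ge0.
  by rewrite /t lerBlDr -[1 + 1]/2 ler_pdivrMr.
have tN : 0 <= t ^+ N <= 1.
  rewrite exprn_even_ge0 ?odd_double//= -[t ^+ N]ger0_norm.
    by rewrite normrX exprn_ile1.
  by rewrite exprn_even_ge0// odd_double.
have /andP[tN0 tN1] := tN.
have k0 : 0 < n.+1%:R^-1 :> R by rewrite invr_gt0.
set v := n.+1%:R^-1 * _; have v0 : 0 <= v by rewrite mulr_ge0// ltW.
apply: (@le_trans _ _ v); last by rewrite /v ler_piMr// ltW.
have -> : 1 - (1 + v)^-1 = v / (1 + v) by field; rewrite gt_eqF// ltr_pwDl.
by rewrite ler_pdivrMr ?ltr_pwDl// ler_peMr// lerDl.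
Qed.

(** With [k = n + 1] and [d = b - x], the Bernoulli inequality used twice gives
    [(1 + d / k) ^ (k * k) >= (1 + d) ^ k >= k * d]. *)
Lemma halfline_plateau_out b n x : x < b ->
  halfline_plateau b n x <= (b - x) ^- 2 * n.+1%:R^-1.
Proof.
move=> xb; rewrite halfline_plateauE.
have d0 : 0 < b - x by rewrite subr_gt0.
have k0 := k_gt0 n.
rewrite -invfM lef_pV2 ?posrE ?mulr_gt0 ?exprn_gt0//; last first.
  by rewrite ltr_pwDl// mulr_ge0 ?invr_ge0 ?ler0n// exprn_even_ge0// odd_double.
have -> : (x - b) / n.+1%:R - 1 = - (1 + (b - x) / n.+1%:R).
  by move: (n.+1%:R : R) k0 => k k0; field; rewrite gt_eqF.
rewrite exprNn -signr_odd odd_double expr0 mul1r -muln2 exprM.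
set w := 1 + (b - x) / n.+1%:R.
have w1 : n.+1%:R * (b - x) <= w ^+ (n.+1 * n.+1).
  have h1 : 1 + (b - x) <= w ^+ n.+1.
    have := @bernoulli_le ((b - x) / n.+1%:R) n.+1.
    rewrite [n.+1%:R * _]mulrC divfK ?gt_eqF//; apply.
    by rewrite divr_ge0// ltW.
  rewrite exprM; apply: (@le_trans _ _ ((1 + (b - x)) ^+ n.+1)).
    apply: le_trans (bernoulli_le _ _ (ltW d0)); by rewrite lerDr.
  by rewrite lerXn2r// nnegrE ?(le_trans _ h1)// addr_ge0// ltW.
have nb0 : 0 <= n.+1%:R * (b - x) by rewrite mulr_ge0// ltW.
apply: (@le_trans _ _ (n.+1%:R^-1 * (n.+1%:R * (b - x)) ^+ 2)).
  rewrite le_eqVlt; apply/orP; left; apply/eqP.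
  by move: (n.+1%:R : R) k0 {w1 nb0 w} => k k0; field; rewrite gt_eqF.
apply: (@le_trans _ _ (n.+1%:R^-1 * (w ^+ (n.+1 * n.+1)) ^+ 2)); last by rewrite lerDr.
by rewrite ler_pM2l ?invr_gt0// lerXn2r// nnegrE (le_trans nb0).
Qed.

Lemma cvg_of_harmonic_bound (u : nat -> R) (l C : R) N :
  (forall n, (N <= n)%N -> `|u n - l| <= C * n.+1%:R^-1) -> u @ \oo --> l.
Proof.
move=> h.
have c0 : (fun n => C * @harmonic R n) @ \oo --> (0 : R).
  by rewrite -(mulr0 C); apply: cvgM; [exact: cvg_cst|exact: cvg_harmonic].
apply: (@squeeze_cvgr _ _ _ _ (fun n => l - C * @harmonic R n) (fun n => l + C * @harmonic R n)).
- exists N => // n /= /h; rewrite /harmonic ler_distl => /andP[-> ->] //.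
- by rewrite -[X in _ --> X]subr0; apply: cvgB => //; apply: cvg_cst.
- by rewrite -[X in _ --> X]addr0; apply: cvgD => //; apply: cvg_cst.
Qed.

Lemma cvg_halfline_plateau b x :
  halfline_plateau b n x @[n --> \oo] --> (\1_(`[b, +oo[%classic) x : R).
Proof.
rewrite indicE; have [bx|xb] := leP b x.
  rewrite mem_set ?in_itv /= ?bx//; last by rewrite in_itv /= bx.
  apply: (cvg_of_harmonic_bound _ _ 1 (Num.truncn (x - b))) => n nx.
  rewrite mul1r distrC ger0_norm; last first.
    by rewrite subr_ge0; have /andP[] := halfline_plateau_bounds b n x.
  apply: halfline_plateau_in => //.
  apply: (@le_trans _ _ n.+1%:R).
    by rewrite ltW// (lt_le_trans (truncnS_gt _))// ler_nat ltnS.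
  by have := k_gt0 n; lra.
rewrite memNset; last by rewrite /= in_itv /= andbT; apply/negP; rewrite -ltNge.
apply: (cvg_of_harmonic_bound _ _ ((b - x) ^- 2) 0) => n _.
rewrite subr0 ger0_norm; last by have /andP[] := halfline_plateau_bounds b n x.
exact: halfline_plateau_out.
Qed.

Lemma measurable_halfline_plateau b n :
  measurable_fun setT (halfline_plateau b n : measurableTypeR R -> R).
Proof.
rewrite (_ : halfline_plateau b n = fun x => (1 + n.+1%:R^-1 *
    ((x - b) / n.+1%:R - 1) ^+ (n.+1 * n.+1).*2) `^ (-1)).
  apply: (@measurableT_comp _ _ _ _ _ _ (fun x : R => x `^ (-1))); first exact: measurable_powR.
  apply: measurable_funD; first exact: measurable_cst.
  apply: measurable_funM; first exact: measurable_cst.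
  apply: measurable_funX; apply: measurable_funB; last exact: measurable_cst.
  apply: measurable_funM; last exact: measurable_cst.
  by apply: measurable_funB => //; apply: measurable_cst.
apply/funext => x; rewrite halfline_plateauE powR_inv1// addr_ge0// mulr_ge0 ?invr_ge0 ?ler0n//.
by rewrite exprn_even_ge0// odd_double.
Qed.

Lemma integral_halfline_plateau b n :
  (\int[s1]_x (halfline_plateau b n x)%:E = \int[s2]_x (halfline_plateau b n x)%:E)%E.
Proof.
have i (nu : borel_measure R) : (nu setT < +oo)%E ->
    nu.-integrable setT (EFin \o halfline_plateau b n).
  move=> nf; apply: (@integrable_bounded _ nu nf _ 1).
    exact: measurable_halfline_plateau.
  by move=> x; have /andP[h0 h1] := halfline_plateau_bounds b n x; rewrite ger0_norm.
have f1 := integrable_fin_num measurableT (i _ s1_fin).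
have f2 := integrable_fin_num measurableT (i _ s2_fin).
rewrite -(fineK f1) -(fineK f2); congr (_%:E).
by apply: Rintegral_plateau; rewrite mulr_gt0// ?exprn_gt0// invr_gt0.
Qed.

Lemma halfline_eq b : s1 `[b, +oo[%classic = s2 `[b, +oo[%classic.
Proof.
have lim (nu : borel_measure R) : (nu setT < +oo)%E ->
    (\int[nu]_x (halfline_plateau b n x)%:E @[n --> \oo] --> nu `[b, +oo[%classic)%E.
  move=> nf.
  have mI : measurable (`[b, +oo[%classic : set (measurableTypeR R)) by exact: measurable_itv.
  have [] := @dominated_convergence _ _ _ nu setT measurableT
    (fun n x => (halfline_plateau b n x)%:E) (fun x => (\1_(`[b, +oo[%classic) x)%:E) (cst 1%E).
  - by move=> n; apply/measurable_EFinP; apply: measurable_halfline_plateau.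
  - by apply/measurable_EFinP.
  - by apply: aeW => x _; apply: cvg_EFin; [exact: nearW|exact: cvg_halfline_plateau].
  - by rewrite (_ : cst 1%E = EFin \o cst 1)//; apply: integrable_const.
  - apply: aeW => x n _ /=; rewrite lee_fin.
    by have /andP[h0 h1] := halfline_plateau_bounds b n x; rewrite ger0_norm.
  by move=> _ _; rewrite integral_indic// setIT.
have l1 := lim _ s1_fin; have := lim _ s2_fin.
under eq_fun do rewrite -integral_halfline_plateau.
by move=> l2; apply: cvg_unique l1 l2.
Qed.

(** The masses of half-lines are limits of integrals of rational functions with
    simple nonreal poles, and half-lines generate the Borel sets. *)
Lemma stieltjes_inj (B : set (measurableTypeR R)) : measurable B -> s1 B = s2 B.
Proof.
move=> mB.
refine (@measure_unique _ R (measurableTypeR R) (@RGenCInfty.G R)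
  (fun n => `[- n%:R, +oo[%classic) _ _ _ _ s1 s2 _ _ B mB).
- exact: RGenCInfty.measurableE.
- move=> _ _ [x ->] [y ->]; exists (Num.max x y).
  by apply/seteqP; split=> z /=; rewrite !in_itv /= !andbT ge_max; [move=> [-> ->]|move=> /andP[-> ->]].
- by move=> n; exists (- n%:R).
- apply/seteqP; split=> // x _; exists (Num.truncn `|x|).+1 => //=.
  rewrite in_itv /= andbT; have := ltW (truncnS_gt `|x|).
  by rewrite ler_norml => /andP[].
- by move=> _ [x ->]; apply: halfline_eq.
- by move=> n; apply: le_lt_trans s1_fin; apply: le_measure; rewrite ?inE//; apply: measurable_itv.
Qed.

End stieltjes_uniqueness.

(** * The limit circle case and the domain of the extensions *)

Section complex_limits.
Context {R : realType}.
Implicit Types (u v : nat -> R[i]) (l k : R[i]).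

Definition ccvg u l :=
  (fun n => Re (u n)) @ \oo --> Re l /\ (fun n => Im (u n)) @ \oo --> Im l.

Lemma ccvgD u v l k : ccvg u l -> ccvg v k -> ccvg (fun n => u n + v n) (l + k).
Proof.
move=> [ur ui] [vr vi]; split; rewrite (Re_add, Im_add).
  by under [X in X @ _]eq_fun do rewrite Re_add; exact: cvgD.
by under [X in X @ _]eq_fun do rewrite Im_add; exact: cvgD.
Qed.

Lemma ccvgM u v l k : ccvg u l -> ccvg v k -> ccvg (fun n => u n * v n) (l * k).
Proof.
move=> [ur ui] [vr vi]; split; rewrite (Re_mul, Im_mul).
  by under [X in X @ _]eq_fun do rewrite Re_mul; apply: cvgB; apply: cvgM.
by under [X in X @ _]eq_fun do rewrite Im_mul; apply: cvgD; apply: cvgM.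
Qed.

Lemma ccvg_cst k : ccvg (fun=> k) k.
Proof. by split; apply: cvg_cst. Qed.

Lemma ccvgB u v l k : ccvg u l -> ccvg v k -> ccvg (fun n => u n - v n) (l - k).
Proof.
move=> ul vk; have := ccvgD _ _ _ _ ul (ccvgM _ _ _ _ (ccvg_cst (-1)) vk).
by rewrite mulN1r; under eq_fun do rewrite mulN1r.
Qed.

Lemma ccvg_unique u l k : ccvg u l -> ccvg u k -> l = k.
Proof.
move=> [ur ui] [ur' ui']; apply: complex_eq.
  exact: cvg_unique ur ur'.
exact: cvg_unique ui ui'.
Qed.

Lemma ccvg_shift u l : ccvg u l -> ccvg (fun n => u n.+1) l.
Proof.
by move=> [ur ui]; split; [move: ur|move: ui]; rewrite -cvg_shiftS.
Qed.

Lemma l2_conj (c : cseq R) : l2 c -> l2 (fun n => conjc (c n)).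
Proof.
move=> /l2P[M cM]; apply/l2P; exists M => n; apply: le_trans (cM n).
by apply: ler_sum => k _; rewrite /sqmod Re_conjc Im_conjc sqrrN.
Qed.

Lemma ccvg_csum (c d : cseq R) : l2 c -> l2 d ->
  ccvg (fun n => \sum_(k < n) c k * d k) (csum (fun n => c n * d n)).
Proof.
move=> cl dl; have dcl := l2_conj _ dl; have idl := l2Z ii _ dcl.
have re (k : nat) : Re (c k * d k) = redot (c k) (conjc (d k)).
  by rewrite /redot !ReImE; ring.
have im (k : nat) : Im (c k * d k) = redot (c k) (ii * conjc (d k)).
  by rewrite /redot !ReImE; ring.
split.
  have -> : Re (csum (fun n => c n * d n)) = rdot c (fun n => conjc (d n)).
    by rewrite /rdot -(funext re).
  rewrite (_ : (fun n => _) = fun n => \sum_(k < n) redot (c k) (conjc (d k))).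
    exact: cvg_rdot.
  by apply/funext => n; rewrite Re_sum; apply: eq_bigr => k _; rewrite re.
have -> : Im (csum (fun n => c n * d n)) = rdot c (fun n => ii * conjc (d n)).
  by rewrite /rdot -(funext im).
rewrite (_ : (fun n => _) = fun n => \sum_(k < n) redot (c k) (ii * conjc (d k))).
  exact: cvg_rdot.
by apply/funext => n; rewrite Im_sum; apply: eq_bigr => k _; rewrite im.
Qed.

End complex_limits.

Section limit_circle.
Context {R : realType}.
Variables (s : nat -> R) (mu : borel_measure R) (p : nat -> {poly R}) (a b : nat -> R).
Hypothesis ind : indeterminate s.
Hypothesis mus : moment_solutions s mu.
Hypothesis on : orthonormal_polynomials mu p.
Hypothesis jac : jacobi_parameters p a b.
Local Notation J := (jacobi_matrix a b).
Local Notation P := (first_kind p).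
Local Notation Q := (second_kind mu p).

Let a_gt0 n : 0 < a n. Proof. by case: jac. Qed.

Let JP z n : J (P z) n = z * P z n.
Proof. exact: jacobi_first_kind jac z n. Qed.

Let JQ z n : J (Q z) n = z * Q z n + e0 n.
Proof. exact: jacobi_second_kind mus on jac z n. Qed.

(** Two solutions with different Stieltjes transforms at [z] have two Weyl
    solutions in [l2], whose difference is a multiple of [P z]. *)
Lemma limit_circle_at_one_point : exists z, l2 (P z) /\ l2 (Q z).
Proof.
have [m1 [m2 [h1 h2 [B mB neq]]]] := ind.
suff [z z0 wz] : exists2 z : R[i], Im z != 0 & stieltjes m1 z <> stieltjes m2 z.
  have w1 := l2_weyl_solution s mu m1 p mus h1 on a b z jac z0.
  have w2 := l2_weyl_solution s mu m2 p mus h2 on a b z jac z0.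
  have w0 : stieltjes m1 z - stieltjes m2 z != 0 by rewrite subr_eq0; apply/eqP.
  have Pl : l2 (P z).
    have := l2Z (stieltjes m1 z - stieltjes m2 z)^-1 _ (l2B _ _ w1 w2).
    rewrite (_ : (fun n => _) = P z)//; apply/funext => n; field.
    exact: w0.
  exists z; split=> //.
  have := l2B _ _ w1 (l2Z (stieltjes m1 z) _ Pl).
  by rewrite (_ : (fun n => _) = Q z)//; apply/funext => n; ring.
apply: contrapT => h; apply: neq; apply: stieltjes_inj => //.
- exact: moment_fin h1.
- have [_ /(_ 0%N)[_ e1]] := h1; have [_ /(_ 0%N)[_ e2]] := h2.
  move: e1 e2; under eq_integral do rewrite expr0.
  rewrite integral_cst// mul1e => -> ; under eq_integral do rewrite expr0.
  by rewrite integral_cst// mul1e.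
move=> z z0; apply: contrapT => hz; apply: h; by exists z.
Qed.

Lemma limit_circle w : l2 (P w) /\ l2 (Q w).
Proof.
have [z [Pl Ql]] := limit_circle_at_one_point.
have inv := limit_circle_invariance a b a_gt0 z (P z) (Q z)
  (first_kind0 mu p on z) (JP z) (second_kind0 mu p on z) (JQ z) Pl Ql w.
split; first by apply: (inv 0) => n; rewrite JP mul0r addr0.
by apply: (inv 1) => n; rewrite JQ mul1r.
Qed.

Lemma l2_jacobi_PQ w : l2 (J (P w)) /\ l2 (J (Q w)).
Proof.
have [Pl Ql] := limit_circle w; split.
  by rewrite (funext (JP w)); apply: l2Z.
rewrite (funext (JQ w)); apply: l2D; first exact: l2Z.
exact: e0_l2.
Qed.

Lemma sqmod_jacobi_le (e : R) (c : cseq R) n : (forall k, sqmod (c k) <= e) ->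
  sqmod (J c n) <= 4 * ((if n is m.+1 then a m ^+ 2 else 0) + b n ^+ 2 + a n ^+ 2) * e.
Proof.
move=> ce; have e0' : 0 <= e := le_trans (sqmod_ge0 _) (ce 0%N).
have s3 (u v w : R[i]) : sqmod (u + v + w) <= 4 * (sqmod u + sqmod v + sqmod w).
  have h1 := sqmodD_le (u + v) w; have h2 := sqmodD_le u v.
  by have := sqmod_ge0 w; lra.
apply: le_trans (s3 _ _ _) _; rewrite -mulrA ler_pM2l// !mulrDl !sqmodM !sqmodC.
apply: lerD; first apply: lerD.
- by case: n => [|n]; rewrite ?sqmod0 ?mul0r// sqmodM sqmodC ler_wpM2l// sqr_ge0.
- by rewrite ler_wpM2l// sqr_ge0.
- by rewrite ler_wpM2l// sqr_ge0.
Qed.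

(** The closure of [J] still acts as [J]: convergence in [l2] is coordinatewise,
    and a coordinate of [J c] involves at most three coordinates of [c]. *)
Lemma jacobi_domain_l2 u : jacobi_domain a b u -> l2 u /\ l2 (J u).
Proof.
move=> [d [ul dl happ]]; split=> //; suff -> : J u = d by [].
apply/funext => n; apply/eqP; rewrite -subr_eq0 -sqmod_eq0 eq_le sqmod_ge0 andbT.
pose K := 4 * ((if n is m.+1 then a m ^+ 2 else 0) + b n ^+ 2 + a n ^+ 2).
apply: (@le0_of_small _ _ (2 + 2 * K)) => e e_gt0 e1.
have [f ff [/= h1 h2]] := happ e e_gt0.
have fl := fin_l2 _ ff.
have norm_nsq c : l2 c -> l2norm c < e -> nsq c <= e ^+ 2.
  move=> cl; rewrite /l2norm; under [X in series X]eq_fun do rewrite sqmod_normc.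
  rewrite -nsqE => h.
  rewrite -(sqr_sqrtr (nsq_ge0 _ cl)) ler_pXn2r// ?nnegrE ?sqrtr_ge0 ?(ltW e_gt0)//.
  exact: ltW.
have Jfl : l2 (J f).
  have [N fN] := ff; apply: fin_l2; exists N.+1 => -[//|k] Nk.
  by rewrite /jacobi_matrix !fN ?mulr0 ?addr0// ltnW// ltnW.
have k1 := norm_nsq _ (l2B _ _ fl ul) h1.
have k2 := norm_nsq _ (l2B _ _ Jfl dl) h2.
have -> : J u n - d n = (J f n - d n) + - J (fun k => f k - u k) n.
  rewrite (_ : (fun k => f k - u k) = fun k => f k + -1 * u k).
    by rewrite jacobiD jacobiZ; ring.
  by apply/funext => k; rewrite mulN1r.
have k3 : sqmod (J f n - d n) <= e ^+ 2.
  by apply: le_trans k2; apply: (sqmod_le_nsq (fun k => J f k - d k)); apply: l2B.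
have k4 : sqmod (J (fun k => f k - u k) n) <= K * e ^+ 2.
  apply: sqmod_jacobi_le => k; apply: le_trans k1.
  by apply: (sqmod_le_nsq (fun k => f k - u k)); apply: l2B.
have e2 : e ^+ 2 <= e by rewrite expr2 ler_piMr// ltW.
have K0 : 0 <= K.
  by rewrite mulr_ge0// !addr_ge0 ?sqr_ge0//; case: (n) => // m; rewrite sqr_ge0.
apply: le_trans (sqmodD_le _ _) _; rewrite sqmodN.
have k5 : K * e ^+ 2 <= K * e by rewrite ler_wpM2l.
lra.
Qed.

Variable t : option R.
Local Notation A := (extension mu p a b t).

Lemma extension_dom_l2 c : dom A c -> l2 c /\ l2 (J c).
Proof.
move=> [u /jacobi_domain_l2 [ul Jul] [al ->]].
set v := (if t is Some t' then _ else _).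
have [vl Jvl] : l2 v /\ l2 (J v).
  have [Pl Ql] := limit_circle 0; have [JPl JQl] := l2_jacobi_PQ 0.
  rewrite /v; case: t => [t'|//]; split; first by apply: l2D => //; apply: l2Z.
  rewrite (_ : J _ = fun n => J (Q 0) n + t'%:C * J (P 0) n).
    by apply: l2D => //; apply: l2Z.
  by apply/funext => n; rewrite jacobiD jacobiZ.
split; first by apply: l2D => //; apply: l2Z.
rewrite (_ : J _ = fun n => J u n + al * J v n).
  by apply: l2D => //; apply: l2Z.
by apply/funext => n; rewrite jacobiD jacobiZ.
Qed.

Lemma extension_dom_fin c : finitely_supported c -> dom A c.
Proof.
move=> cf; exists c; last by exists 0; apply/funext => n; rewrite mul0r addr0.
have Jcl : l2 (J c).
  have [N fN] := cf; apply: fin_l2; exists N.+1 => -[//|k] Nk.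
  by rewrite /jacobi_matrix !fN ?mulr0 ?addr0// ltnW// ltnW.
exists (J c); split=> //; first exact: fin_l2.
move=> eps eps0; exists c => //=; rewrite !subrr.
have -> : l2norm (0 : cseq R) = 0; last by [].
rewrite /l2norm; under [X in series X]eq_fun do rewrite sqmod_normc.
by rewrite -nsqE /nsq rdot0l sqrtr0.
Qed.

End limit_circle.

(** * The boundary form and the Nevanlinna functions *)

Section boundary_form.
Context {R : realType}.
Variables (a b : nat -> R).
Local Notation J := (jacobi_matrix a b).
Implicit Types c d : cseq R.

(** The boundary form of [J]; by the Green formula it is the limit of the
    Wronskians. *)
Definition boundary c d : R[i] :=
  csum (fun n => J c n * d n) - csum (fun n => c n * J d n).

Lemma ccvg_wronskian c d : l2 c -> l2 (J c) -> l2 d -> l2 (J d) ->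
  ccvg (wronskian a c d) (boundary c d).
Proof.
move=> cl Jcl dl Jdl.
rewrite (_ : wronskian a c d = fun n => \sum_(k < n.+1) J c k * d k - \sum_(k < n.+1) c k * J d k).
  by apply: ccvgB; [apply: (ccvg_shift (fun n => \sum_(k < n) J c k * d k))|apply: (ccvg_shift (fun n => \sum_(k < n) c k * J d k))]; apply: ccvg_csum.
by apply/funext => n; rewrite (green a b) sumrB.
Qed.

End boundary_form.

(** For nonreal [la] no real point is near [la]; for real [la] outside the closed
    support, [la] has a null neighbourhood. *)
Lemma gap_off_support {R : realType} (nu : borel_measure R) (la : R[i]) :
  ~ (real_complex R @` supp nu) la ->
  exists2 r : R, 0 < r &
    nu ([set y | sqmod (y%:C - la) < r] : set (measurableTypeR R)) = 0%E.
Proof.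
move=> las; have [la0|la0] := eqVneq (Im la) 0; last first.
  exists (Im la ^+ 2); first by rewrite exprn_even_gt0.
  rewrite (_ : [set y | _] = set0) ?measure0//; apply/seteqP; split=> // y /=.
  by rewrite ltNge sqmod_sub_nonreal.
have laE : la = (Re la)%:C by apply: complex_eq; rewrite ?Im_real.
have /existsNP[U] : ~ supp nu (Re la) by move=> h; apply: las; exists (Re la).
move=> /not_implyP[oU /not_implyP[Ula /negP]]; rewrite -leNgt => U0.
have {}U0 : nu U = 0%E by apply/eqP; rewrite eq_le U0 measure_ge0.
have /nbhs_ballP[e /= e0 eU] : nbhs (Re la) U by apply: open_nbhs_nbhs.
exists (e ^+ 2); first by rewrite exprn_gt0.
have mU : measurable (U : set (measurableTypeR R)) by apply: open_measurable.
have sub : ([set y | sqmod (y%:C - la) < e ^+ 2] : set (measurableTypeR R)) `<=` U.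
  move=> y /= h; apply: eU; rewrite /ball /= distrC.
  rewrite -(ltr_pXn2r (n := 2)) ?nnegrE ?(ltW e0)// real_normK ?num_real//.
  by move: h; rewrite {1}laE -rmorphB sqmodC.
apply: subset_measure0 U0 => //.
have := measurable_sqmod_sub la measurableT _ (measurable_itv `]-oo, (e ^+ 2)[).
by rewrite setTI; congr measurable; apply/seteqP; split=> y /=; rewrite in_itv.
Qed.

Theorem theorem3p2 (R : realType) (s : nat -> R) (p : nat -> {poly R})
    (a b : nat -> R) (mu : borel_measure R) (t : option R) (E : @pv_fun R)
    (mu_t : borel_measure R) (lambda : R[i]) :
  s 0%N = 1 ->
  indeterminate s ->
  moment_solutions s mu ->
  orthonormal_polynomials mu p ->
  jacobi_parameters p a b ->
  spectral_measure (extension mu p a b t) E ->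
  scalar_measure E e0 mu_t ->
  ~ (real_complex R @` supp mu_t) lambda ->
  [/\ dom (extension mu p a b t)
        (fun n => stieltjes mu_t lambda * first_kind p lambda n
                  + second_kind mu p lambda n),
      forall x : R, supp mu_t x ->
        nevanlinna_D p lambda x%:C != 0 /\
        stieltjes mu_t lambda
          = - (nevanlinna_C mu p lambda x%:C / nevanlinna_D p lambda x%:C) &
      forall x y : R, supp mu_t x -> supp mu_t y ->
        nevanlinna_C mu p lambda x%:C / nevanlinna_D p lambda x%:C
          = nevanlinna_C mu p lambda y%:C / nevanlinna_D p lambda y%:C].
Proof.
move=> _ ind mus on jac sp mtE las.
set A := extension mu p a b t; pose J := jacobi_matrix a b.
set w := stieltjes mu_t lambda.
have a_gt0 n : 0 < a n by case: jac.
have l2A : forall c, dom A c -> l2 c /\ l2 (J c).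
  exact: extension_dom_l2 ind mus on jac t.
have finA : forall c, finitely_supported c -> dom A c.
  exact: extension_dom_fin.
have actA : act A = J by [].
have lc z := limit_circle s mu p a b ind mus on jac z.
have lJ z := l2_jacobi_PQ s mu p a b ind mus on jac z.
have P0 z := first_kind0 mu p on z.
have Q0 z := second_kind0 mu p on z.
have JP z n : J (first_kind p z) n = z * first_kind p z n := jacobi_first_kind p a b jac z n.
have JQ z n : J (second_kind mu p z) n = z * second_kind mu p z n + e0 n :=
  jacobi_second_kind s mu p a b mus on jac z n.
pose v n := w * first_kind p lambda n + second_kind mu p lambda n.
have vA : dom A v.
  have [r r0 gap] := gap_off_support mu_t lambda las.
  exact: (resolvent_dom a b E A mu_t a_gt0 actA sp l2A finA mtE lambda r
    (first_kind p lambda) (second_kind mu p lambda) r0 gap (P0 _) (JP _) (Q0 _) (JQ _)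
    (lc _).1 (lc _).2).
have main x : supp mu_t x -> nevanlinna_D p lambda x%:C != 0 /\
    w = - (nevanlinna_C mu p lambda x%:C / nevanlinna_D p lambda x%:C).
  move=> xs.
  set P := first_kind p lambda; set Q := second_kind mu p lambda.
  set c := first_kind p x%:C; set d := second_kind mu p x%:C.
  have eP : forall n, jacobi_matrix a b P n = lambda * P n := JP lambda.
  have eQ : forall n, jacobi_matrix a b Q n = lambda * Q n + e0 n := JQ lambda.
  have ec : forall n, jacobi_matrix a b c n = x%:C * c n := JP x%:C.
  have cA : dom A c.
    exact: (support_eigenvector a b E A mu_t a_gt0 actA sp l2A finA mtE x c d
      (P0 _) (JP _) (Q0 _) (JQ _) (lc _).1 (lc _).2 xs).
  have W u1 u2 : l2 u1 -> l2 (J u1) -> l2 u2 -> l2 (J u2) ->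
    ccvg (wronskian a u1 u2) (boundary a b u1 u2) := ccvg_wronskian a b u1 u2.
  have [Pl Ql] := lc lambda; have [JPl JQl] := lJ lambda.
  have [cl dl] := lc x%:C; have [Jcl Jdl] := lJ x%:C.
  have WD : ccvg (wronskian a P c) (nevanlinna_D p lambda x%:C).
    rewrite (_ : wronskian a P c = fun n => (lambda - x%:C) * \sum_(k < n.+1) P k * c k).
      apply: ccvgM; first exact: ccvg_cst.
      by apply: (ccvg_shift (fun n => \sum_(k < n) P k * c k)); apply: ccvg_csum.
    apply/funext => n; rewrite (green a b) mulr_sumr; apply: eq_bigr => k _.
    by rewrite eP ec; ring.
  have WC : ccvg (wronskian a Q c) (nevanlinna_C mu p lambda x%:C).
    rewrite (_ : wronskian a Q c = fun n => 1 + (lambda - x%:C) * \sum_(k < n.+1) Q k * c k).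
      apply: ccvgD; first exact: ccvg_cst.
      apply: ccvgM; first exact: ccvg_cst.
      by apply: (ccvg_shift (fun n => \sum_(k < n) Q k * c k)); apply: ccvg_csum.
    apply/funext => n; rewrite (green a b) mulr_sumr.
    rewrite (eq_bigr (fun k : 'I_n.+1 => e0 k * c k + (lambda - x%:C) * (Q k * c k))).
      rewrite big_split /=; congr (_ + _); rewrite big_ord_recl big1 ?addr0.
        by rewrite /e0 /= mul1r /c P0.
      by move=> i _; rewrite /e0 /= mul0r.
    by move=> k _; rewrite ec eQ; ring.
  (* [T_t] is symmetric, and [c] is real, so that the bilinear boundary form is
     the sesquilinear one. *)
  have Wv : ccvg (wronskian a v c) 0.
    have [vl Jvl] := l2A _ vA.
    suff <- : boundary a b v c = 0 by apply: W.
    have conj_c n : conjc (c n) = c n.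
      by rewrite /c /first_kind cpoly_real conjc_real.
    have Jc_conj n : conjc (J c n) = J c n.
      rewrite /J ec; transitivity (conjc x%:C * conjc (c n)); first exact: rmorphM.
      by rewrite conj_c conjc_real.
    have icA : dom A (fun n => ii * c n).
      have := dom_linear a b E A sp l2A ii c _ cA (finA (fun=> 0) (ex_intro _ 0%N (fun _ _ => erefl))).
      by under eq_fun do rewrite addr0.
    have s1 := operator_symmetric a b E A actA sp l2A v c vA cA.
    have s2 := operator_symmetric a b E A actA sp l2A v _ vA icA.
    apply/eqP; rewrite subr_eq0; apply/eqP.
    transitivity (l2dot (J v) c).
      by rewrite /l2dot; congr csum; apply/funext => n; rewrite conj_c.
    transitivity (l2dot v (J c)); last first.
      by rewrite /l2dot; congr csum; apply/funext => n; rewrite Jc_conj.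
    rewrite !l2dotE s1 s2; congr (_ +i* rdot _ _).
    by apply/funext => n; rewrite jacobiZ.
  have wDC : w * nevanlinna_D p lambda x%:C + nevanlinna_C mu p lambda x%:C = 0.
    apply: ccvg_unique Wv.
    rewrite (_ : wronskian a v c = fun n => w * wronskian a P c n + wronskian a Q c n).
      by apply: ccvgD => //; apply: ccvgM => //; apply: ccvg_cst.
    by apply/funext => n; rewrite /wronskian /v -/P -/Q; ring.
  have D0 : nevanlinna_D p lambda x%:C != 0.
    apply/eqP => D0; move: wDC; rewrite D0 mulr0 add0r => C0.
    (* The limit of the Pluecker relation would read [1 = 0]. *)
    have := ccvgB _ _ _ _ (ccvgM _ _ _ _ (W _ _ Ql JQl dl Jdl) WD)
      (ccvgM _ _ _ _ WC (W _ _ Pl JPl dl Jdl)).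
    rewrite D0 C0 mulr0 mul0r subr0 => lim0.
    have : (1 : R[i]) = 0.
      apply: ccvg_unique lim0.
      rewrite (_ : (fun n => _) = fun=> 1); first exact: ccvg_cst.
      apply/funext => n; rewrite -wronskian_pluecker.
      rewrite (wronskian_QP a b lambda P Q (P0 _) (JP _) (JQ _)).
      by rewrite (wronskian_QP a b x%:C c d (P0 _) (JP _) (JQ _)) mulr1.
    by move/eqP; rewrite oner_eq0.
  split=> //; apply: (mulIf D0); rewrite mulNr divfK//.
  by apply/eqP; rewrite -addr_eq0 wDC.
split=> //.
move=> x y xs ys; have [_ wx] := main x xs; have [_ wy] := main y ys.
by apply: oppr_inj; rewrite -wx -wy.
Qed.
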